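(* Let $\mathbb{H}^n(-1)$ be the $n$-dimensional hyperbolic space in the Poincaré unit disk model $\left(\mathbb{B}^n,\frac{4}{(1-|x|^2)^2}(dx_1^2+\cdots+dx_n^2)\right)$, where $\mathbb{B}^n$ is the open unit ball in $\mathbb{R}^n$, and let $\Omega$ be a bounded connected domain in $\mathbb{H}^n(-1)$. Let $0<\lambda_1<\lambda_2\le\lambda_3\le\cdots$ be the eigenvalues of the Dirichlet problem $\Delta u=-\lambda u$ in $\Omega$, $u|_{\partial\Omega}=0$, and let $u_1,u_2,\dots$ be corresponding orthonormal eigenfunctions. Then for every integer $k\ge1$, $$\sum_{i=1}^{k}(\lambda_{k+1}-\lambda_i)^2\left(n\int_\Omega(1-|x|^2)^2u_i^2\right)\le\sum_{i=1}^{k}(\lambda_{k+1}-\lambda_i)\left[4\lambda_i\int_\Omega(1-|x|^2)^2u_i^2-n^2\int_\Omega(1-|x|^2)^2u_i^2+(2n+4)\int_\Omega(1-|x|^2)^2|x|^2u_i^2\right].$$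
   Context: $\Delta$ is the Laplacian (Laplace--Beltrami operator, the divergence of the gradient) of the hyperbolic metric, and $|x|$ is the Euclidean norm. Eigenvalues are repeated according to multiplicity; the Dirichlet condition is understood in the usual sense ($u\in H^1_0(\Omega)$). The eigenfunctions $u_i$ are real-valued with $\Delta u_i=-\lambda_iu_i$ in $\Omega$, $u_i|_{\partial\Omega}=0$ and $\int_\Omega u_iu_j=\delta_{ij}$. All integrals are with respect to the Riemannian volume measure of the hyperbolic metric. *)

(* Defs.v *)
From HB Require Import structures.
From mathcomp Require Import all_boot all_order all_algebra.
From mathcomp Require Import all_classical all_reals all_analysis.
Import Order.TTheory GRing.Theory Num.Theory.
Import numFieldNormedType.Exports.

Set Implicit Arguments.
Unset Strict Implicit.
Unset Printing Implicit Defensive.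

Local Open Scope classical_set_scope.
Local Open Scope ring_scope.

Definition rV_display : measure_display.
Proof. exact: default_measure_display. Qed.

(* 'rV[R]_n carries the sigma-algebra generated by the coordinate functions,
   that is the Borel sigma-algebra. *)
Section measurable_rV.
Variables (R : realType) (n : nat).

Let coord (i : 'I_n) (v : 'rV[R]_n) : measurableTypeR R := v ord0 i.

Let rV_set0 : g_sigma_preimage coord set0.
Proof. exact: sigma_algebra0. Qed.

Let rV_setC A : g_sigma_preimage coord A -> g_sigma_preimage coord (~` A).
Proof. exact: sigma_algebraC. Qed.

Let rV_bigcup (F : (set 'rV[R]_n)^nat) :
  (forall i, g_sigma_preimage coord (F i)) ->
  g_sigma_preimage coord (\bigcup_i (F i)).
Proof. exact: sigma_algebra_bigcup. Qed.

HB.instance Definition _ := @isMeasurable.Build rV_display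
  'rV[R]_n (g_sigma_preimage coord) rV_set0 rV_setC rV_bigcup.

End measurable_rV.

Lemma measurable_coord (R : realType) n (i : 'I_n) :
  measurable_fun setT (fun v : 'rV[R]_n => v ord0 i : measurableTypeR R).
Proof.
move=> _ Y mY; rewrite setTI; apply: sub_sigma_algebra => /=.
rewrite -bigcup_seq/=; exists i => /=; first by rewrite mem_index_enum.
by exists Y => //; rewrite setTI.
Qed.

Lemma measurable_fun_rV d (T : measurableType d) (R : realType) n
    (f : T -> 'rV[R]_n) :
  (forall i, measurable_fun setT (fun x => f x ord0 i : measurableTypeR R)) ->
  measurable_fun setT f.
Proof.
move=> mf _.
suff: @measurable _ 'rV[R]_n `<=` [set A | measurable (setT `&` f @^-1` A)].
  by [].
apply: smallest_sub.
  split => /=.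
  - by rewrite preimage_set0 setI0.
  - by move=> A; rewrite !setTI setTD preimage_setC; exact: measurableC.
  - move=> F mF; rewrite setTI preimage_bigcup; apply: bigcup_measurable => i _.
    by have := mF i; rewrite setTI.
rewrite -bigcup_seq => A [i _ [Y mY <-]] /=.
by rewrite !setTI -[X in measurable X]setTI; exact: mf.
Qed.

Section cons_rV.
Variables (R : realType) (n : nat).

Definition cons_rV (p : measurableTypeR R * 'rV[R]_n) : 'rV[R]_n.+1 :=
  \row_i oapp (p.2 ord0) p.1 (unlift ord0 i).

Definition uncons_rV (v : 'rV[R]_n.+1) : measurableTypeR R * 'rV[R]_n :=
  (v ord0 ord0, \row_j v ord0 (lift ord0 j)).

Lemma cons_rVK : cancel cons_rV uncons_rV.
Proof.
move=> [t v]; rewrite /uncons_rV /cons_rV !mxE unlift_none; congr pair.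
by apply/rowP => j; rewrite !mxE liftK.
Qed.

Lemma measurable_cons_rV : measurable_fun setT cons_rV.
Proof.
apply: measurable_fun_rV => i; under eq_fun do rewrite mxE.
case: unliftP => [j _|_] /=; last exact: measurable_fst.
exact: (measurableT_comp (measurable_coord j) measurable_snd).
Qed.

Lemma measurable_uncons_rV : measurable_fun setT uncons_rV.
Proof.
apply/measurable_fun_pairP; split; first exact: measurable_coord.
apply: measurable_fun_rV => j /=; under eq_fun do rewrite mxE.
exact: measurable_coord.
Qed.

Variable mu : {sigma_finite_measure set 'rV[R]_n -> \bar R}.

Local Notation m := (@lebesgue_measure R \x mu)%E.

Definition lebesgue_cons : set 'rV[R]_n.+1 -> \bar R := pushforward m cons_rV.

Let mpre A : measurable A -> measurable (cons_rV @^-1` A).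
Proof.
by move=> mA; rewrite -[X in measurable X]setTI; exact: measurable_cons_rV.
Qed.

Let push0 : lebesgue_cons set0 = 0%E.
Proof. by rewrite /lebesgue_cons /pushforward preimage_set0 measure0. Qed.

Let push_ge0 A : (0 <= lebesgue_cons A)%E.
Proof. by rewrite /lebesgue_cons /pushforward; exact: measure_ge0. Qed.

Let push_sigma_additive : semi_sigma_additive lebesgue_cons.
Proof.
move=> F mF tF mUF; rewrite /lebesgue_cons /pushforward preimage_bigcup.
apply: measure_semi_sigma_additive.
- by move=> k; exact: mpre.
- apply/trivIsetP => /= i j _ _ ij; rewrite -preimage_setI.
  by move/trivIsetP : tF => /(_ _ _ _ _ ij) ->//; rewrite preimage_set0.
- by rewrite -preimage_bigcup; exact: mpre.
Qed.

HB.instance Definition _ := isMeasure.Build _ _ _ lebesgue_cons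
  push0 push_ge0 push_sigma_additive.

Let push_sigma_finite : sigma_finite setT lebesgue_cons.
Proof.
have /sigma_finiteP[F [TF ndF Foo]] := sigma_finiteT (@lebesgue_measure R).
have /sigma_finiteP[G [TG ndG Goo]] := sigma_finiteT mu.
exists (fun k => uncons_rV @^-1` (F k `*` G k)).
  rewrite -preimage_bigcup (_ : \bigcup_k _ = setT) ?preimage_setT//.
  apply/seteqP; split=> // -[x y] _.
  have [i _ Fx] : (\bigcup_k F k) x by rewrite -TF.
  have [j _ Gy] : (\bigcup_k G k) y by rewrite -TG.
  exists (maxn i j) => //; split.
    by move: x Fx; exact/subsetPset/ndF/leq_maxl.
  by move: y Gy; exact/subsetPset/ndG/leq_maxr.
move=> k; have [mF Fk] := Foo k; have [mG Gk] := Goo k; split.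
  rewrite -[X in measurable X]setTI; apply: measurable_uncons_rV => //.
  exact: measurableX.
rewrite /lebesgue_cons /pushforward -comp_preimage.
rewrite (_ : uncons_rV \o cons_rV = id); last first.
  by apply/funext => p; exact: cons_rVK.
by rewrite preimage_id product_measure1E// lte_mul_pinfty// ge0_fin_numE.
Qed.

HB.instance Definition _ := Measure_isSigmaFinite.Build _ _ _ lebesgue_cons
  push_sigma_finite.

End cons_rV.

(* n-dimensional Lebesgue measure: the n-fold product of [lebesgue_measure]. *)
Fixpoint lebesgue_rV (R : realType) (n : nat) :
    {sigma_finite_measure set 'rV[R]_n -> \bar R} :=
  match n with
  | 0 => \d_ (0 : 'rV[R]_0)
  | n'.+1 => lebesgue_cons (lebesgue_rV R n')
  end.

Section hyperbolic.
Variables (R : realType) (n : nat).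
Implicit Types (x y : 'rV[R]_n) (f v : 'rV[R]_n -> R) (X : 'rV[R]_n -> 'rV[R]_n).
Implicit Types (Omega : set 'rV[R]_n).

(* The library norm on 'rV[R]_n is the sup norm. *)
Definition enorm x : R := Num.sqrt (\sum_i x ord0 i ^+ 2).

Definition unit_ball : set 'rV[R]_n := [set x | enorm x < 1].

Definition arcosh (t : R) : R := ln (t + Num.sqrt (t ^+ 2 - 1)).

Definition hyp_dist x y : R :=
  arcosh (1 + 2 * enorm (x - y) ^+ 2 /
              ((1 - enorm x ^+ 2) * (1 - enorm y ^+ 2))).

Definition hyp_bounded Omega :=
  exists M : R, forall x y, Omega x -> Omega y -> hyp_dist x y <= M.

Definition bounded_domain Omega :=
  [/\ open Omega, connected Omega, Omega !=set0, Omega `<=` unit_ball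
    & hyp_bounded Omega].

(* The metric is g = conf x * (dx_1^2 + ... + dx_n^2), and sqrt (det g) is the
   density of the Riemannian volume. *)
Definition conf x : R := 4 / (1 - enorm x ^+ 2) ^+ 2.

Definition hyp_sqnorm x (X : 'rV[R]_n) : R := conf x * enorm X ^+ 2.

Definition vol_density x : R := Num.sqrt (conf x ^+ n).

Definition partial (i : 'I_n) f : 'rV[R]_n -> R :=
  fun x => 'D_(delta_mx ord0 i) f x.

Definition hyp_grad f : 'rV[R]_n -> 'rV[R]_n :=
  fun x => \row_i ((conf x)^-1 * partial i f x).

Definition hyp_div X : 'rV[R]_n -> R :=
  fun x => (vol_density x)^-1 *
    \sum_i partial i (fun y => vol_density y * X y ord0 i) x.

Definition hyp_laplacian f : 'rV[R]_n -> R := hyp_div (hyp_grad f).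

Definition hyp_integral Omega f : \bar R :=
  \int[lebesgue_rV R n]_(x in Omega) (f x * vol_density x)%:E.

Definition hyp_Rintegral Omega f : R := fine (hyp_integral Omega f).

Definition smooth f :=
  forall (s : seq 'I_n) x, differentiable (foldr partial f s) x.

(* C_c^oo(Omega), each function being extended by 0 outside Omega. *)
Definition test_function Omega f :=
  smooth f /\
  exists K : set 'rV[R]_n,
    [/\ compact K, K `<=` Omega & forall x, ~ K x -> f x = 0].

(* H^1_0(Omega) as the completion of C_c^oo(Omega) for the H^1 norm of the
   hyperbolic metric, realized in L^2(Omega); X is then the weak gradient of v.
   Only the values of v and X on Omega matter. *)
Definition H10 Omega v :=
  exists (X : 'rV[R]_n -> 'rV[R]_n) (phi : nat -> 'rV[R]_n -> R),
    [/\ measurable_fun Omega v, measurable_fun Omega X,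
        forall m, test_function Omega (phi m),
        hyp_integral Omega (fun x => (phi m x - v x) ^+ 2)
          @[m --> \oo] --> 0%E
      & hyp_integral Omega (fun x => hyp_sqnorm x (hyp_grad (phi m) x - X x))
          @[m --> \oo] --> 0%E].

(* Solutions of the Dirichlet problem Delta v = - mu v in Omega, v = 0 on the
   boundary: v lies in H^1_0(Omega) and satisfies the equation in the sense of
   distributions.  This set is the eigenspace of mu, zero function included. *)
Definition dirichlet_eigenspace Omega (mu : R) v :=
  H10 Omega v /\
  forall phi, test_function Omega phi ->
    hyp_Rintegral Omega (fun x => v x * hyp_laplacian phi x) =
    - mu * hyp_Rintegral Omega (fun x => v x * phi x).

Definition ae_eq_on Omega f v :=
  {ae lebesgue_rV R n, forall x, Omega x -> f x = v x}.

(* Dimension of a space of functions on Omega modulo a.e. equality. *)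
Definition has_dimension Omega (E : ('rV[R]_n -> R) -> Prop) (d : nat) :=
  exists w : 'I_d -> 'rV[R]_n -> R,
    [/\ forall i, E (w i),
        forall c : 'I_d -> R,
          ae_eq_on Omega (fun x => \sum_i c i * w i x) (fun=> 0) ->
          forall i, c i = 0
      & forall v, E v -> exists c : 'I_d -> R,
          ae_eq_on Omega v (fun x => \sum_i c i * w i x)].

(* lam lists all the Dirichlet eigenvalues, each one repeated according to its
   multiplicity: every real mu occurs in lam exactly as many times as the
   dimension of its eigenspace (0 when mu is not an eigenvalue). *)
Definition lists_dirichlet_eigenvalues Omega (lam : nat -> R) :=
  forall mu : R, exists s : seq nat,
    [/\ uniq s, forall i, (i \in s) = (lam i == mu)
      & has_dimension Omega (dirichlet_eigenspace Omega mu) (size s)].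

Definition L2_orthonormal Omega (u : nat -> 'rV[R]_n -> R) :=
  forall i j, hyp_Rintegral Omega (fun x => u i x * u j x) = (i == j)%:R.

End hyperbolic.

(* Main.v *)
From HB Require Import structures.
Require Import Defs.
From mathcomp Require Import all_boot all_order all_algebra.
From mathcomp Require Import all_classical all_reals all_analysis.
From mathcomp Require Import measurable_realfun.
From mathcomp Require Import ring lra.
Import Order.TTheory GRing.Theory Num.Theory.
Import numFieldNormedType.Exports.

(** Everything is expressed in the Euclidean coordinates of the ball. Write
    q = 2 / (1 - |x|^2) and s = 1 / q, so that the metric is q^2 |dx|^2; for
    functions vanishing on the boundary the L2 product and the Dirichlet form
    become [mass], with weight q^n, and [energy], with weight a = q^n s^2 on the
    Euclidean gradients. A hyperbolically bounded domain stays away from the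
    unit sphere ([bounded_domain_radius]), so the weights are bounded above and
    below on it, and H^1_0 is the closure [sobolev0] of the test functions for the
    Euclidean H^1 norm. The eigenfunctions are the u in that space with
    energy u v = lambda mass u v for all v ([dirichlet_weak]).

    The inequality comes from commuting the Laplacian with the coordinates. Fix a
    coordinate x_p and let phi_i be x_p u_i minus its projection on the span of the
    first k eigenfunctions. By the [Rayleigh_principle] the energy of phi_i is at
    least lambda_k times its mass. On the other hand
      - Delta (x_p u_i) = lambda_i x_p u_i - P_i,
      P_i = 2 <grad x_p, grad u_i> + u_i Delta x_p
    ([energy_commutator]), and the integral of P_i x_p u_i is minus the integral of
    s^2 u_i^2 ([commutator_mulx]). Pure linear algebra then yields
      sum_i (lambda_k - lambda_i)^2 int s^2 u_i^2
        <= sum_i (lambda_k - lambda_i) int P_i^2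
    ([yang_inequality], [directional_inequality]). Summing over p multiplies the
    left side by n, and two integrations by parts evaluate the right side
    ([sum_commutator_sqr]):
      sum_p int P_i^2 = 4 lambda_i int s^2 u_i^2 - n^2 int s^2 u_i^2
        + (2 n + 4) int s^2 |x|^2 u_i^2.
    Since (1 - |x|^2)^2 = 4 s^2, this is the claim divided by 4.

    The Rayleigh principle rests on the completeness of the list of eigenvalues.
    If some F orthogonal to the first k eigenfunctions had a Rayleigh quotient
    below lambda_k, the infimum of the quotient over such functions would be attained
    ([Rayleigh_quotient_attained]), at an eigenfunction whose eigenvalue mu is below
    lambda_k. All the listed eigenfunctions of mu are among the first k, so this
    one would be orthogonal to them and mu would have too large a multiplicity.
    Attainment needs compactness in the form of [mean_values_control_norm]: up to
    a small multiple of the energy, the L2 norm is controlled by finitely many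
    means over small boxes. This is proved by induction on the dimension, slicing
    the cube along the first coordinate. *)

Set Implicit Arguments.
Unset Strict Implicit.
Unset Printing Implicit Defensive.
Local Open Scope classical_set_scope.
Local Open Scope ring_scope.

(** * Yang's inequality for a semidefinite form *)

Lemma quadratic_ge0_discriminant (R : realFieldType) (a b c : R) : 0 <= c ->
  (forall t, 0 <= a + t * (2 * b) + t ^+ 2 * c) -> b ^+ 2 <= a * c.
Proof.
move=> c_ge0 P; have [c0|c0] := eqVneq c 0.
  rewrite c0 mulr0; have [->|b0] := eqVneq b 0; first by rewrite expr0n.
  have := P (- (a + 1) / (2 * b)).
  rewrite c0 mulr0 addr0 divfK ?mulf_neq0 ?pnatr_eq0//; lra.
have cp : 0 < c by rewrite lt0r c0.
have := P (- (b / c)); rewrite -(pmulr_rge0 _ cp).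
rewrite (_ : c * _ = a * c - b ^+ 2) ?subr_ge0//.
by field.
Qed.

Section forms.
Variables (R : realType) (V : lmodType R).
Implicit Types (B E : V -> V -> R) (f g h : V).

(** Only semidefinite: the elements of L2 below are functions, so that the mass
    also vanishes on nonzero functions that are zero almost everywhere. *)
Record psd_form B : Prop := PsdForm {
  form_linear : forall c f g h, B (c *: f + g) h = c * B f h + B g h;
  form_sym : forall f g, B f g = B g f;
  form_ge0 : forall f, 0 <= B f f }.

Variable B : V -> V -> R.
Hypothesis hB : psd_form B.

Lemma formDl f g h : B (f + g) h = B f h + B g h.
Proof. by rewrite -[f]scale1r (form_linear hB) mul1r scale1r. Qed.
Lemma form0l h : B 0 h = 0.
Proof. by apply: (addIr (B 0 h)); rewrite -formDl addr0 add0r. Qed.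
Lemma formZl c f h : B (c *: f) h = c * B f h.
Proof. by rewrite -[c *: f]addr0 (form_linear hB) form0l addr0. Qed.
Lemma formNl f h : B (- f) h = - B f h.
Proof. by rewrite -scaleN1r formZl mulN1r. Qed.
Lemma formDr f g h : B h (f + g) = B h f + B h g.
Proof. by rewrite (form_sym hB) formDl !(form_sym hB _ h). Qed.
Lemma formZr c f h : B h (c *: f) = c * B h f.
Proof. by rewrite (form_sym hB) formZl (form_sym hB _ h). Qed.
Lemma formNr f h : B h (- f) = - B h f.
Proof. by rewrite (form_sym hB) formNl (form_sym hB _ h). Qed.
Lemma form0r h : B h 0 = 0.
Proof. by rewrite (form_sym hB) form0l. Qed.
Lemma form_suml (I : Type) (r : seq I) (P : pred I) (F : I -> V) h :
  B (\sum_(i <- r | P i) F i) h = \sum_(i <- r | P i) B (F i) h.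
Proof. by apply: (big_morph (B^~ h)) => [x y|]; rewrite ?formDl ?form0l. Qed.
Lemma form_sumr (I : Type) (r : seq I) (P : pred I) (F : I -> V) h :
  B h (\sum_(i <- r | P i) F i) = \sum_(i <- r | P i) B h (F i).
Proof. by apply: (big_morph (B h)) => [x y|]; rewrite ?formDr ?form0r. Qed.

Lemma form_CauchySchwarz f g : B f g ^+ 2 <= B f f * B g g.
Proof.
apply: quadratic_ge0_discriminant; first exact: (form_ge0 hB).
move=> t; have := form_ge0 hB (f + t *: g).
rewrite !(formDl, formDr, formZl, formZr) (form_sym hB g f).
by rewrite (_ : _ + _ = B f f + t * (2 * B f g) + t ^+ 2 * B g g) //; ring.
Qed.

Lemma form_le2 f g : B (f + g) (f + g) <= 2 * B f f + 2 * B g g.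
Proof.
have := form_ge0 hB (f - g).
rewrite !(formDl, formDr, formNl, formNr) (form_sym hB g f); lra.
Qed.

End forms.

Section yang.
Variables (R : realType) (V : lmodType R) (B : V -> V -> R).
Hypothesis hB : psd_form B.
Variables (k : nat) (u g p : 'I_k -> V) (lam : 'I_k -> R) (lamk : R).
Variables (A : 'I_k -> R).
Let a i j := B (g i) (u j).
Let phi i := g i - \sum_j a i j *: u j.
Hypotheses
  (ortho : forall i j, B (u i) (u j) = (i == j)%:R)
  (a_sym : forall i j, B (g i) (u j) = B (g j) (u i))
  (p_u : forall i j, B (p i) (u j) = (lam i - lam j) * B (g i) (u j))
  (p_g : forall i, B (p i) (g i) = - A i)
  (rayleigh : forall i, (lamk - lam i) * B (phi i) (phi i) <= - B (p i) (phi i))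
  (le_lam : forall i, lam i <= lamk).

Let phi_u i j : B (phi i) (u j) = 0.
Proof.
rewrite /phi (formDl hB) (formNl hB) (form_suml hB) (bigD1 j)//= big1 ?addr0.
  by rewrite (formZl hB) ortho eqxx mulr1 subrr.
by move=> l lj; rewrite (formZl hB) ortho (negbTE lj) mulr0.
Qed.

Let b i j := (lam i - lam j) * a i j.

Let w_def i : - B (p i) (phi i) = A i + \sum_j b i j * a i j.
Proof.
rewrite /phi (formDr hB) (formNr hB) p_g (form_sumr hB) opprD !opprK.
by congr (_ + _); apply: eq_bigr => j _; rewrite (formZr hB) p_u mulrC.
Qed.

Let p' i := p i - \sum_j b i j *: u j.

Let p'_u i j : B (p' i) (u j) = 0.
Proof.
rewrite /p' (formDl hB) (formNl hB) (form_suml hB) (bigD1 j)//= big1 ?addr0.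
  by rewrite (formZl hB) ortho eqxx mulr1 p_u subrr.
by move=> l lj; rewrite (formZl hB) ortho (negbTE lj) mulr0.
Qed.

Let p'_norm i : B (p i) (p i) - \sum_j b i j ^+ 2 = B (p' i) (p' i).
Proof.
rewrite {2}/p' (formDr hB) (formNr hB) (form_sumr hB).
rewrite [X in _ = _ - X]big1 ?subr0; last first.
  by move=> j _; rewrite (formZr hB) p'_u mulr0.
rewrite /p' (formDl hB) (formNl hB) (form_suml hB); congr (_ - _).
by apply: eq_bigr => j _; rewrite (formZl hB) (form_sym hB) p_u expr2.
Qed.

Let bessel i : B (p i) (phi i) ^+ 2 <=
  B (phi i) (phi i) * (B (p i) (p i) - \sum_j b i j ^+ 2).
Proof.
rewrite p'_norm; have -> : B (p i) (phi i) = B (phi i) (p' i).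
  rewrite /p' (formDr hB) (formNr hB) (form_sumr hB) big1 ?subr0 1?(form_sym hB)//.
  by move=> j _; rewrite (formZr hB) phi_u mulr0.
exact: form_CauchySchwarz.
Qed.

(** Exchanging i and j pairs off the terms: a is symmetric, b is antisymmetric and
    (lamk - lam i) - (lamk - lam j) = lam j - lam i. *)
Let antisym :
  \sum_i \sum_j (lamk - lam i) ^+ 2 * (b i j * a i j) =
  - \sum_i \sum_j (lamk - lam i) * b i j ^+ 2.
Proof.
have aC i j : a j i = a i j by rewrite /a a_sym.
pose S := \sum_i \sum_j ((lamk - lam i) ^+ 2 * (b i j * a i j) +
  (lamk - lam i) * b i j ^+ 2).
suff : S + S = 0.
  rewrite /S; under eq_bigr do rewrite big_split/=.
  by rewrite big_split/=; lra.
rewrite {2}/S exchange_big /S -big_split/= big1// => i _.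
rewrite -big_split/= big1// => j _; rewrite /b aC; ring.
Qed.

(** The u_i are the eigenfunctions, the g_i are the functions x_p u_i and the p_i
    are the commutators; phi_i and p'_i are the parts of g_i and p_i orthogonal
    to the u_j, and b i j is the coordinate of p_i along u_j. Put
    d_i = lamk - lam_i and w_i = - B p_i phi_i. The Rayleigh bound
    d_i |phi_i|^2 <= w_i and the Cauchy-Schwarz inequality
    w_i^2 <= |phi_i|^2 |p'_i|^2 give d_i w_i <= |p'_i|^2. Multiplying by d_i and
    summing, the terms in the coordinates b i j cancel by antisymmetry. *)
Lemma yang_inequality :
  \sum_i (lamk - lam i) ^+ 2 * A i <= \sum_i (lamk - lam i) * B (p i) (p i).
Proof.
have key i : (lamk - lam i) ^+ 2 * (A i + \sum_j b i j * a i j) <=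
    (lamk - lam i) * (B (p i) (p i) - \sum_j b i j ^+ 2).
  have := bessel i; have := rayleigh i; rewrite -(w_def i).
  have := le_lam i; rewrite -subr_ge0.
  set d := lamk - _; set w := B (p i) (phi i); set x := B (phi i) (phi i).
  set P := _ - _ => d0 h1 h2.
  have x0 : 0 <= x by exact: (form_ge0 hB).
  have P0 : 0 <= P by rewrite /P p'_norm; exact: (form_ge0 hB).
  have [w0|w0] := eqVneq w 0; first by rewrite w0 oppr0 mulr0 mulr_ge0.
  have nw : 0 < - w by rewrite lt0r oppr_eq0 w0; apply: le_trans h1; rewrite mulr_ge0.
  rewrite expr2 -mulrA ler_wpM2l// -(ler_pM2l nw).
  apply: (@le_trans _ _ (d * (x * P))).
    by rewrite mulrCA -expr2 sqrrN ler_wpM2l.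
  by rewrite mulrA ler_wpM2r.
rewrite -subr_ge0.
have : \sum_i (lamk - lam i) ^+ 2 * (A i + \sum_j b i j * a i j) <=
    \sum_i (lamk - lam i) * (B (p i) (p i) - \sum_j b i j ^+ 2).
  by apply: ler_sum => i _; exact: key.
under eq_bigr do rewrite mulrDr mulr_sumr; rewrite big_split/= antisym.
under [X in _ <= X]eq_bigr do rewrite mulrBr mulr_sumr; rewrite sumrB/=.
lra.
Qed.

End yang.

(** * Existence of minimizers of a Rayleigh quotient *)

Lemma ler_coord_norm (R : realDomainType) n (x : 'rV[R]_n) j : `|x ord0 j| <= `|x|.
Proof.
rewrite [leRHS]/Num.norm/= mx_normrE; apply/bigmax_geP; right => /=.
by exists (ord0, j).
Qed.

Section minimizer.
Variables (R : realType) (V : lmodType R) (B E : V -> V -> R).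
Hypotheses (hB : psd_form B) (hE : psd_form E).

Lemma form_cvgl (Q : V -> V -> R) (hQ : psd_form Q) (f : nat -> V) v h :
  Q (f m - v) (f m - v) @[m --> \oo] --> 0 ->
  Q (f m) h @[m --> \oo] --> Q v h.
Proof.
move=> cf; apply/subr_cvg0.
apply: norm_cvg0.
have bnd m : 0 <= `|Q (f m) h - Q v h| <=
    Num.sqrt (Q (f m - v) (f m - v)) * Num.sqrt (Q h h).
  rewrite normr_ge0/= -(formNl hQ) -(formDl hQ).
  rewrite -sqrtrM ?(form_ge0 hQ)// -sqrtr_sqr ler_wsqrtr//.
  exact: form_CauchySchwarz.
apply: (squeeze_cvgr _ (cvg_cst 0)).
  by apply: nearW; exact: bnd.
rewrite -(mul0r (Num.sqrt (Q h h))); apply: cvgMr_tmp.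
rewrite -[X in _ --> X]sqrtr0; apply: continuous_cvg => //.
exact: sqrt_continuous.
Qed.

Lemma form_cvg (Q : V -> V -> R) (hQ : psd_form Q) (f : nat -> V) v :
  Q (f m - v) (f m - v) @[m --> \oo] --> 0 ->
  Q (f m) (f m) @[m --> \oo] --> Q v v.
Proof.
move=> cf; have cfv := form_cvgl (h := v) hQ cf.
have -> : (fun m => Q (f m) (f m)) =
    (fun m => Q (f m - v) (f m - v) + 2 * Q (f m) v - Q v v).
  apply/funext => m; rewrite !(formDl hQ, formDr hQ, formNl hQ, formNr hQ).
  by rewrite (form_sym hQ v (f m)); ring.
have e : Q v v = 0 + 2 * Q v v - Q v v by ring.
rewrite [X in _ --> X]e.
apply: cvgB; last exact: cvg_cst.
by apply: cvgD => //; apply: cvgMl_tmp.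
Qed.

Variable H : V -> Prop.
Hypothesis Hlin : forall c f g, H f -> H g -> H (c *: f + g).

Let HD f g : H f -> H g -> H (f + g).
Proof. by move=> hf hg; rewrite -[f]scale1r; exact: Hlin. Qed.

Let HZ c f : H f -> H (c *: f).
Proof.
move=> hf; rewrite -[_ *: _]addr0 -[X in _ + X](subrr f) addrA.
by rewrite -scaleN1r addrC; apply: Hlin => //; exact: Hlin.
Qed.

Let HB f g : H f -> H g -> H (f - g).
Proof. by move=> hf hg; rewrite -scaleN1r addrC; exact: Hlin. Qed.

Let N f := B f f + E f f.
Hypothesis complete_H : forall f : nat -> V, (forall m, H (f m)) ->
  (forall e : R, 0 < e -> exists M, forall m l, (M <= m)%N -> (M <= l)%N ->
     N (f m - f l) < e) ->
  exists2 v, H v & N (f m - v) @[m --> \oo] --> 0.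

Hypothesis compact_H : forall e : R, 0 < e ->
  exists (M : nat) (l : 'I_M -> V -> R) (C : R),
  [/\ 0 <= C, forall j f g, l j (f - g) = l j f - l j g,
      forall j f, H f -> l j f ^+ 2 <= C * B f f
    & forall f, H f -> B f f <= e * E f f + C * \sum_j l j f ^+ 2].

(** The direct method. Along a subsequence of a minimizing sequence the finitely
    many functionals of the compactness estimate converge; the parallelogram
    identity bounds the energy of a difference by its mass and a small error, and the compactness
    estimate, taken with a small e, bounds the mass by the functionals. The
    subsequence is therefore Cauchy. Compactness enters as an inequality,
    which avoids weak convergence altogether. *)
Lemma Rayleigh_quotient_attained (f0 : V) (M : R) :
  H f0 -> E f0 f0 < M * B f0 f0 ->
  exists v mu, [/\ H v, mu < M, B v v = 1 & forall f, H f -> E v f = mu * B v f].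
Proof.
move=> Hf0 EM.
have B0 : 0 < B f0 f0.
  rewrite lt0r (form_ge0 hB) andbT; apply/eqP => B0.
  by move: EM; rewrite B0 mulr0 ltNge (form_ge0 hE).
(* the energies of the normalized admissible functions *)
pose S := [set E f f | f in [set f | H f /\ B f f = 1]].
have normalize f : H f -> 0 < B f f ->
    let g := (Num.sqrt (B f f))^-1 *: f in
    [/\ H g, B g g = 1 & E g g = (B f f)^-1 * E f f].
  move=> Hf Bf g; have s0 : Num.sqrt (B f f) != 0 by rewrite gt_eqF ?sqrtr_gt0.
  split; first exact: HZ.
    rewrite /g (formZl hB) (formZr hB) mulrA -invfM -expr2 sqr_sqrtr ?ltW//.
    by rewrite mulVf// gt_eqF.
  by rewrite /g (formZl hE) (formZr hE) mulrA -invfM -expr2 sqr_sqrtr ?ltW.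
have hS : has_inf S.
  split.
    have [Hg Bg Eg] := normalize f0 Hf0 B0.
    by eexists; eexists; [split; [exact: Hg|exact: Bg]|reflexivity].
  by exists 0 => _ [f _ <-]; exact: (form_ge0 hE).
pose mu := inf S.
have mu_le f : H f -> mu * B f f <= E f f.
  move=> Hf; have [Bf|Bf] := ltP 0 (B f f); last first.
    have -> : B f f = 0 by apply/le_anti; rewrite Bf (form_ge0 hB).
    by rewrite mulr0 (form_ge0 hE).
  have [Hg Bg Eg] := normalize f Hf Bf.
  rewrite mulrC -ler_pdivlMl// -Eg; apply: ge_inf; first exact: hS.2.
  by eexists; [split; [exact: Hg|exact: Bg]|].
have muM : mu < M.
  have [Hg Bg Eg] := normalize f0 Hf0 B0.
  apply: (@le_lt_trans _ _ ((B f0 f0)^-1 * E f0 f0)).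
    rewrite -Eg; apply: ge_inf; first exact: hS.2.
    by eexists; [split; [exact: Hg|exact: Bg]|].
  by rewrite ltr_pdivrMl// mulrC.
have mu0 : 0 <= mu.
  by apply: lb_le_inf => //; [exact: hS.1|move=> _ [f _ <-]; exact: (form_ge0 hE)].
have /choice[f fP] : forall m : nat, exists f,
    [/\ H f, B f f = 1 & E f f < mu + m.+1%:R^-1].
  move=> m; have /(inf_adherent)/(_ hS)[_ [f [Hf Bf] <-] Ef] : (0 : R) < m.+1%:R^-1.
    by rewrite invr_gt0.
  by exists f.
clearbody mu; pose e := (2 * (mu + 1))^-1.
have e0 : 0 < e by rewrite invr_gt0; lra.
have emu : e * mu <= 2^-1 by rewrite /e mulrC ler_pdivrMr; lra.
have [K [l [C [C0 lB lC lE]]]] := compact_H e0.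
pose r m : 'rV[R]_K := \row_j l j (f m).
pose box : set 'rV[R]_K := [set x | forall j, `[- (C + 1), C + 1]%classic (x ord0 j)].
have cbox : compact box.
  by apply: (@rV_compact _ _ (fun=> `[- (C + 1), C + 1]%classic)) => j; exact: segment_compact.
have rbox m : box (r m).
  move=> j; rewrite mxE /= in_itv/= -ler_norml.
  have [Hf Bf _] := fP m; have := lC j _ Hf; rewrite Bf mulr1 => h.
  rewrite -(@ler_pXn2r _ 2)// ?nnegrE ?normr_ge0//; last lra.
  by rewrite real_normK ?num_real//; nra.
have [p [_ clp]] : box `&` cluster (r @ \oo) !=set0.
  apply: cbox; exists 0%N => // m _; exact: rbox.
have /choice[s sP] : forall m : nat, exists s : nat, (m <= s)%N /\ `|p - r s| < m.+1%:R^-1.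
  move=> m.
  have := clp [set r k | k in [set k | (m <= k)%N]] (ball p m.+1%:R^-1).
  case; first by exists m => // k mk; exists k.
    by apply: nbhsx_ballx; rewrite invr_gt0.
  move=> _ [[k mk <-]]; rewrite -ball_normE/= => h; by exists k.
pose g m := f (s m).
have gP m : [/\ H (g m), B (g m) (g m) = 1 & E (g m) (g m) <= mu + m.+1%:R^-1].
  have [Hf Bf Ef] := fP (s m); split => //; apply: (le_trans (ltW Ef)).
  by rewrite lerD2l lef_pV2 ?posrE// ler_nat ltnS; exact: (sP m).1.
have lg j m k : (l j (g m) - l j (g k)) ^+ 2 <= (m.+1%:R^-1 + k.+1%:R^-1) ^+ 2.
  have -> : l j (g m) - l j (g k) = (r (s m) - r (s k)) ord0 j by rewrite !mxE.
  rewrite -[X in X <= _]real_normK ?num_real// lerXn2r ?nnegrE ?addr_ge0 ?invr_ge0//.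
  apply: (@le_trans _ _ `|r (s m) - r (s k)|).
    exact: ler_coord_norm.
  rewrite -(subrKA p); apply: le_trans (ler_normD _ _) _; apply: lerD.
    by rewrite distrC ltW//; exact: (sP m).2.
  by rewrite ltW//; exact: (sP k).2.
pose dl m k : R := m.+1%:R^-1 + k.+1%:R^-1.
have dl0 m k : 0 <= dl m k by rewrite addr_ge0 ?invr_ge0.
(* parallelogram identity, as (g m + g k) / 2 has quotient at least mu *)
have Ed m k : E (g m - g k) (g m - g k) <= 2 * dl m k + mu * B (g m - g k) (g m - g k).
  have [Hm Bm Em] := gP m; have [Hk Bk Ek] := gP k.
  have := mu_le _ (HD Hm Hk); move: Em Ek.
  rewrite !(formDl hB, formDr hB, formNl hB, formNr hB) Bm Bk (form_sym hB (g k) (g m)).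
  rewrite !(formDl hE, formDr hE, formNl hE, formNr hE) (form_sym hE (g k) (g m)) /dl.
  move: (E (g m) (g m)) (E (g m) (g k)) (E (g k) (g k)) (B (g m) (g k)) m.+1%:R^-1 k.+1%:R^-1.
  move=> {Bm Bk Hm Hk dl0 dl lg gP g sP s clp cbox rbox box r lE lC lB C0 l e0 emu e}.
  move=> *; lra.
(* e * mu <= 1 / 2 lets the mass coming from Ed be absorbed on the left *)
have Bd m k : B (g m - g k) (g m - g k) <= 4 * e * dl m k + 2 * C * (K%:R * dl m k ^+ 2).
  have [Hm Bm Em] := gP m; have [Hk Bk Ek] := gP k.
  have := lE _ (HB Hm Hk); have := Ed m k.
  have : \sum_j l j (g m - g k) ^+ 2 <= K%:R * dl m k ^+ 2.
    apply: (@le_trans _ _ (\sum_(j < K) dl m k ^+ 2)).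
      by apply: ler_sum => j _; rewrite lB; exact: lg.
    by rewrite sumr_const card_ord mulr_natl.
  have := form_ge0 hB (g m - g k).
  set y := E _ _; set b := B _ _; set z := \sum_j _ => b0 h1 h2 h3.
  have := ler_wpM2l C0 h1; have := ler_wpM2l (ltW e0) h2.
  have := ler_wpM2r b0 emu.
  move=> h4 h5 h6; rewrite -(mulrA 4) -(mulrA 2).
  have {}h5 : e * y <= 2 * (e * dl m k) + e * mu * b.
    by apply: (le_trans h5); rewrite le_eqVlt; apply/orP; left; apply/eqP; ring.
  move: h3 h4 h5 h6; set w := C * (K%:R * _); set ed := e * dl m k.
  move: (e * mu * b) (e * y) (C * z) => p1 p2 p3 *.
  by move=> {emu e0}; lra.
have [v Hv cv] : exists2 v, H v & N (g m - v) @[m --> \oo] --> 0.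
  apply: complete_H => [m|d d0]; first by case: (gP m).
  pose T := 2 + (mu + 1) * (4 * e + 4 * C * K%:R).
  have T0 : 0 < T.
    rewrite ltr_pwDl// mulr_ge0//; first lra.
    by rewrite addr_ge0// !mulr_ge0// ltW.
  have NT m k : N (g m - g k) <= T * dl m k.
    have dl2 : dl m k <= 2.
      have inv1 q : q.+1%:R^-1 <= 1 :> R by rewrite invf_le1// ler1n.
      by rewrite (_ : 2 = 1 + 1) // /dl; apply: lerD.
    have := Bd m k; have := Ed m k; rewrite /N.
    set y := E _ _; set b := B _ _; set x := dl m k in dl2 *; set K' := K%:R => h1 h2.
    have K0 : 0 <= K' by rewrite /K'.
    have x0 : 0 <= x by exact: dl0.
    have h3 : b <= (4 * e + 4 * C * K') * x.
      apply: (le_trans h2); rewrite [leRHS](mulrDl (4 * e)) lerD2l.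
      have : 2 * C * K' * (x * x) <= 2 * C * K' * (2 * x).
        by rewrite ler_wpM2l ?mulr_ge0// ler_wpM2r.
      rewrite expr2 => h4; apply: le_trans (_ : _ <= 2 * C * K' * (2 * x)) _; first by rewrite mulrA.
      by rewrite le_eqVlt; apply/orP; left; apply/eqP; ring.
    apply: (@le_trans _ _ (2 * x + (mu + 1) * b)); first by lra.
    by rewrite /T [leRHS](mulrDl 2) lerD2l -mulrA ler_wpM2l//; lra.
  have [k kP] : exists k : nat, k.+1%:R^-1 < d / (2 * T).
    have /ltr_add_invr[k] : (0 : R) < d / (2 * T) by rewrite divr_gt0 ?mulr_gt0.
    by rewrite add0r => hk; exists k.
  exists k => m q km kq; apply: (le_lt_trans (NT _ _)).
  have inv q' : (k <= q')%N -> q'.+1%:R^-1 <= k.+1%:R^-1 :> R.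
    by move=> kq'; rewrite lef_pV2 ?posrE// ler_nat.
  apply: (@le_lt_trans _ _ (T * (2 * k.+1%:R^-1))).
    by rewrite (ler_wpM2l (ltW T0))// /dl mulr_natl mulr2n; apply: lerD; exact: inv.
  have T2 : 0 < 2 * T by rewrite mulr_gt0.
  by rewrite mulrA (mulrC T) [ltLHS]mulrC -ltr_pdivlMr.
have cB : B (g m - v) (g m - v) @[m --> \oo] --> 0.
  apply: (squeeze_cvgr _ (cvg_cst 0) cv); apply: nearW => m.
  by rewrite (form_ge0 hB)/= lerDl (form_ge0 hE).
have cE : E (g m - v) (g m - v) @[m --> \oo] --> 0.
  apply: (squeeze_cvgr _ (cvg_cst 0) cv); apply: nearW => m.
  by rewrite (form_ge0 hE)/= lerDr (form_ge0 hB).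
have uniq_lim (z : nat -> R) (x y : R) :
    z m @[m --> \oo] --> x -> z m @[m --> \oo] --> y -> x = y.
  by move=> zx zy; apply: (@cvg_unique R _ (z m @[m --> \oo])) zx zy; exact: norm_hausdorff.
have Bv : B v v = 1.
  apply: uniq_lim (form_cvg hB cB) _.
  under eq_fun do rewrite (let: And3 _ h _ := gP _ in h).
  exact: cvg_cst.
have Ev : E v v = mu.
  apply: uniq_lim (form_cvg hE cE) _.
  apply: (@squeeze_cvgr _ _ _ _ (cst mu) (fun m => mu + m.+1%:R^-1)).
  - apply: nearW => m; have [Hm Bm ->] := gP m; rewrite andbT.
    by have := mu_le _ Hm; rewrite Bm mulr1.
  - exact: cvg_cst.
  - rewrite -[X in _ --> X]addr0; apply: cvgD; [exact: cvg_cst|exact: cvg_harmonic].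
exists v, mu; split => // h Hh.
(* E - mu B is nonnegative and vanishes at v; expand it at t h + v *)
have P t : 0 <= t * (2 * (E v h - mu * B v h)) + t ^+ 2 * (E h h - mu * B h h).
  have := mu_le _ (Hlin t Hh Hv).
  rewrite !(formDl hB, formDr hB, formZl hB, formZr hB) Bv (form_sym hB h v).
  rewrite !(formDl hE, formDr hE, formZl hE, formZr hE) Ev (form_sym hE h v).
  by rewrite -subr_ge0 => h1; apply: (le_trans h1); rewrite le_eqVlt; apply/orP; left; apply/eqP; ring.
apply/eqP; rewrite -subr_eq0; apply/eqP; apply/eqP.
set a := _ - _ in P *; set b := _ - _ in P.
apply/negPn/negP => a0.
have b0 : 0 <= b by rewrite /b subr_ge0; exact: mu_le.
have b1 : 0 < b + 1 by rewrite ltr_wpDl.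
have b2 : 0 < b + 2 by rewrite ltr_wpDl.
(* the parabola takes a negative value near its vertex; b + 1 avoids dividing by 0 *)
have := P (- a / (b + 1)).
have -> : - a / (b + 1) * (2 * a) + (- a / (b + 1)) ^+ 2 * b =
    - ((b + 1)^-1 ^+ 2 * (a ^+ 2 * (b + 2))) by field; rewrite gt_eqF.
rewrite oppr_ge0; apply/negP; rewrite -ltNge; apply: mulr_gt0.
  by rewrite exprn_gt0// invr_gt0.
by apply: mulr_gt0 => //; rewrite exprn_even_gt0.
Qed.

End minimizer.

(** * Lebesgue measure on the cube: continuous functions and Fubini *)

Section rV_measurable.
Variables (R : realType) (n : nat).
Implicit Types (U : set 'rV[R]_n).

Let cube (p : 'rV[rat]_n * nat) : set 'rV[R]_n :=
  [set x : 'rV[R]_n | forall i, ball (ratr (p.1 ord0 i) : R) p.2.+1%:R^-1 (x ord0 i)].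

Let measurable_cube p : measurable (cube p).
Proof.
have -> : cube p = \bigcap_(i in setT)
    ((fun x : 'rV[R]_n => x ord0 i : measurableTypeR R) @^-1`
       ball (ratr (p.1 ord0 i) : R) p.2.+1%:R^-1).
  by apply/seteqP; split => x /= h i; [move=> _; exact: h|exact: h].
apply: fin_bigcap_measurable => [|i _]; first exact: finite_finset.
rewrite -[X in measurable X]setTI; apply: measurable_coord => //.
by apply: open_measurable; exact: ball_open.
Qed.

(** The sigma-algebra is generated by the coordinates, the topology by the sup
    norm; they are compatible because open sets are countable unions of rational
    cubes. *)
Lemma open_measurable_rV U : open U -> measurable U.
Proof.
move=> oU.
pose F m : set 'rV[R]_n := if @unpickle ('rV[rat]_n * nat)%type m is Some p then
  if `[< cube p `<=` U >] then cube p else set0 else set0.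
have -> : U = \bigcup_m F m.
  apply/seteqP; split => [x Ux|x [m _]]; last first.
    by rewrite /F; case: unpickle => // p; case: asboolP => // h; exact: h.
  have /nbhs_ballP[e /= e0 xeU] : nbhs x U by exact: open_nbhs_nbhs.
  have [k ke] : exists k : nat, k.+1%:R^-1 < e / 2.
    have /ltr_add_invr[k] : 0 < e / 2 by rewrite divr_gt0.
    by rewrite add0r => ?; exists k.
  have k0 : (0 : R) < k.+1%:R^-1 by rewrite invr_gt0.
  have /choice[c cP] : forall i, exists q : rat, ball (x ord0 i) k.+1%:R^-1 (ratr q).
    move=> i; have /rat_in_itvoo[q] : x ord0 i < x ord0 i + k.+1%:R^-1 by rewrite ltrDl.
    rewrite in_itv/= => /andP[q1 q2]; exists q.
    by rewrite -ball_normE/= ltr_distl ltrBlDr q2 ltr_wpDr// ltW.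
  pose p := (\row_i c i, k).
  have pU : cube p `<=` U.
    move=> y yp; apply: xeU; split => // i j; rewrite !ord1.
    have := yp j; rewrite mxE => h1; have := ball_triangle (cP j) h1.
    by apply: le_ball; rewrite [leRHS](splitr e); apply: lerD; exact: ltW.
  exists (pickle p) => //; rewrite /F pickleK asboolT// => i.
  by rewrite mxE; apply: ball_sym; exact: cP.
apply: bigcupT_measurable => m; rewrite /F; case: unpickle => // p.
by case: asboolP => // _; exact: measurable_cube.
Qed.

Lemma open_continuous_measurable_rV U (f : 'rV[R]_n -> R) :
  open U -> (forall x, U x -> {for x, continuous f}) -> measurable_fun U f.
Proof.
move=> oU cf; apply: (measurability _ (RGenOpens.measurableE R)).
move=> _ [_ [a [b ->] <-]]; apply: open_measurable_rV.
rewrite openE => x [Ux fx]; apply: filterI; first exact: open_nbhs_nbhs.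
by apply: cf => //; apply: open_nbhs_nbhs; split => //; exact: interval_open.
Qed.

Lemma continuous_measurable_rV (f : 'rV[R]_n -> R) :
  continuous f -> measurable_fun setT f.
Proof.
by move=> cf; apply: open_continuous_measurable_rV => [|x _]; [exact: openT|exact: cf].
Qed.

End rV_measurable.

Section bounded_support.
Context d (T : measurableType d) (R : realType) (mu : {measure set T -> \bar R}).
Implicit Types (D : set T) (f g : T -> R).

(** The indicator makes one bound say that f is bounded and vanishes off D. *)
Definition bounded_on D f :=
  measurable_fun setT f /\ exists C : R, forall x, `|f x| <= C * \1_D x.

Lemma bounded_onP D f : bounded_on D f ->
  exists C : R, [/\ 0 <= C, forall x, `|f x| <= C & forall x, ~ D x -> f x = 0].
Proof.
move=> [_ [C fC]]; exists `|C|; split => // x.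
  apply: (le_trans (fC x)); rewrite indicE; case: (x \in D); rewrite ?mulr1 ?mulr0//.
  exact: ler_norm.
move=> nDx; apply/eqP; rewrite -normr_le0; apply: (le_trans (fC x)).
by rewrite indicE memNset// mulr0.
Qed.

Lemma bounded_onI D f (C : R) : measurable_fun setT f -> (forall x, `|f x| <= C) ->
  (forall x, ~ D x -> f x = 0) -> bounded_on D f.
Proof.
move=> mf fC fD; split => //; exists C => x; rewrite indicE.
have [/set_mem Dx|nDx] := boolP (x \in D); first by rewrite mulr1.
by rewrite fD ?normr0 ?mulr0//; move=> Dx; move/negP : nDx; apply; exact: mem_set.
Qed.

Lemma bounded_on_integrable D f : measurable D -> (mu D < +oo)%E ->
  bounded_on D f -> mu.-integrable setT (EFin \o f).
Proof.
move=> mD Doo [mf [C fC]].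
apply: (@le_integrable _ _ _ _ _ _ _ (EFin \o (fun x => C * \1_D x))) => //.
- exact/measurable_EFinP.
- by move=> x _ /=; rewrite lee_fin (le_trans (fC x))// ler_norm.
- apply: (@eq_integrable _ _ _ _ _ _ (fun x => C%:E * (\1_D x)%:E)%E) => //.
  apply: integrableZl => //; apply/integrableP; split.
    by apply/measurable_EFinP; exact: measurable_indic.
  under eq_integral do rewrite gee0_abs ?lee_fin//.
  by rewrite integral_indic// setIT.
Qed.

Lemma bounded_onM D f g : bounded_on D f -> bounded_on D g ->
  bounded_on D (fun x => f x * g x).
Proof.
move=> hf hg; have [C [C0 fC fD]] := bounded_onP hf.
have [C' [C'0 gC gD]] := bounded_onP hg.
apply: (bounded_onI (C := C * C')).
- by apply: measurable_funM; [exact: hf.1|exact: hg.1].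
- by move=> x; rewrite normrM; apply: ler_pM.
- by move=> x /fD ->; rewrite mul0r.
Qed.

Lemma bounded_onMindic D Q f : measurable Q -> bounded_on D f ->
  bounded_on D (fun x => \1_Q x * f x).
Proof.
move=> mQ hf; have [C [C0 fC fD]] := bounded_onP hf.
apply: (bounded_onI (C := C)).
- by apply: measurable_funM; [exact: measurable_indic|exact: hf.1].
- move=> x; rewrite normrM -[leRHS]mul1r; apply: ler_pM => //.
  by rewrite indicE; case: (_ \in _); rewrite /= ?normr1 ?normr0.
- by move=> x /fD ->; rewrite mulr0.
Qed.

Lemma bounded_on_norm D f : bounded_on D f -> bounded_on D (fun x => `|f x|).
Proof.
move=> hf; have [C [C0 fC fD]] := bounded_onP hf.
apply: (bounded_onI (C := C)).
- by apply: measurableT_comp => //; exact: hf.1.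
- by move=> x; rewrite normr_id.
- by move=> x /fD ->; rewrite normr0.
Qed.

Lemma bounded_on_le_Rintegral D f (C : R) : measurable D -> (mu D < +oo)%E ->
  bounded_on D f -> (forall x, `|f x| <= C) ->
  `|\int[mu]_x f x| <= C * fine (mu D).
Proof.
move=> mD Doo hf fC; have hi := bounded_on_integrable mD Doo hf.
have [C' [_ _ fD]] := bounded_onP hf.
apply: (le_trans (le_normr_Rintegral _ hi)) => //.
rewrite -Rintegral_cst// [leRHS]Rintegral_mkcond.
apply: le_Rintegral => //.
- exact: (integrable_norm hi).
- have bC : bounded_on D (cst C \_ D).
    apply: (bounded_onI (C := `|C|)).
    + by apply/(measurable_restrictT _ mD).1; exact: measurable_cst.
    + by move=> x; rewrite patchE; case: ifP; rewrite ?normr0.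
    + by move=> x nDx; rewrite patchE memNset.
  exact: bounded_on_integrable bC.
- move=> x _; rewrite patchE; case: ifPn => [_|xD]; first exact: fC.
  by rewrite fD ?normr0// => Dx; move/negP : xD; apply; exact: mem_set.
Qed.

End bounded_support.

(** The unit ball lies in this cube, so integrals over a domain of the ball are
    integrals over a product of intervals, to which Fubini applies. *)
Definition unit_box (R : realType) (m : nat) : set 'rV[R]_m :=
  [set x | forall i, `|x ord0 i| <= 1].
Arguments unit_box : clear implicits.

Section unit_box.
Variables (R : realType) (n : nat).

Lemma measurable_unit_box m : measurable (unit_box R m).
Proof.
have -> : unit_box R m = \bigcap_(i in setT)
    ((fun x : 'rV[R]_m => x ord0 i : measurableTypeR R) @^-1` `[-1, 1]%classic).
  apply/seteqP; split => x /= h i; first by move=> _ /=; rewrite in_itv/= -ler_norml.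
  by have := h i I => /=; rewrite in_itv/= -ler_norml.
apply: fin_bigcap_measurable => [|i _]; first exact: finite_finset.
rewrite -[X in measurable X]setTI; apply: measurable_coord => //.
Qed.

Lemma cons_rV0 (p : R * 'rV[R]_n) : cons_rV p ord0 ord0 = p.1.
Proof. by rewrite mxE unlift_none. Qed.
Lemma cons_rVS (p : R * 'rV[R]_n) j : cons_rV p ord0 (lift ord0 j) = p.2 ord0 j.
Proof. by rewrite mxE liftK. Qed.

Lemma unit_box_cons t (v : 'rV[R]_n) :
  unit_box R n.+1 (cons_rV (t, v)) <-> (`|t| <= 1 /\ unit_box R n v).
Proof.
split=> [h|[ht hv] i].
  by split=> [|j]; [have := h ord0; rewrite cons_rV0|have := h (lift ord0 j); rewrite cons_rVS].
by case: (unliftP ord0 i) => [j|] ->; rewrite ?cons_rV0 ?cons_rVS//; exact: hv.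
Qed.

End unit_box.

Local Notation unit_itv R := (`[(-1)%R, 1%R]%classic : set (measurableTypeR R)).

Lemma lebesgue_unit_itv (R : realType) :
  @lebesgue_measure R `[-1, 1]%classic = 2%:E.
Proof.
by rewrite lebesgue_measure_itv/= lte_fin ifT; [congr _%:E; ring|lra].
Qed.

Lemma unit_itv_fin (R : realType) :
  (@lebesgue_measure R `[(-1)%R, 1%R]%classic < +oo)%E.
Proof. by rewrite lebesgue_unit_itv ltry. Qed.

Lemma lebesgue_rV_unit_box (R : realType) n :
  lebesgue_rV R n (unit_box R n) = (2 ^+ n)%:E.
Proof.
elim: n => [|n IH].
  by rewrite /= diracE mem_set// => -[].
rewrite /= /lebesgue_cons /pushforward.
rewrite (_ : _ @^-1` _ = `[-1, 1]%classic `*` unit_box R n); last first.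
  apply/seteqP; split => -[t v] /=; rewrite /preimage/= in_itv/= -ler_norml.
    by move/unit_box_cons.
  by move/unit_box_cons.
rewrite product_measure1E//; last exact: measurable_unit_box.
rewrite IH exprS EFinM; congr (_ * _)%E.
exact: lebesgue_unit_itv.
Qed.

Section rV_fubini.
Variables (R : realType) (n : nat).
Local Notation mu1 := (@lebesgue_measure R).
Local Notation mu := (lebesgue_rV R n).
Variable F : 'rV[R]_n.+1 -> R.
Hypothesis hF : bounded_on (unit_box R n.+1) F.

Lemma unit_box_fin m : (lebesgue_rV R m (unit_box R m) < +oo)%E.
Proof. by rewrite lebesgue_rV_unit_box ltry. Qed.

Lemma unit_box_integrable m f : bounded_on (unit_box R m) f ->
  (lebesgue_rV R m).-integrable setT (EFin \o f).
Proof.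
by apply: bounded_on_integrable; [exact: measurable_unit_box|exact: unit_box_fin].
Qed.

Lemma unit_itv_integrable (f : measurableTypeR R -> R) :
  bounded_on (unit_itv R) f ->
  mu1.-integrable setT (EFin \o f).
Proof.
by apply: bounded_on_integrable => //; exact: unit_itv_fin.
Qed.

Let mFc : measurable_fun setT (F \o @cons_rV R n).
Proof. by apply: measurableT_comp; [exact: hF.1|exact: measurable_cons_rV]. Qed.

Lemma bounded_on_slicel t : bounded_on (unit_box R n) (fun v => F (cons_rV (t, v))).
Proof.
have [C [C0 FC FD]] := bounded_onP hF.
apply: (bounded_onI (C := C)) => //.
  by apply: (measurableT_comp mFc); exact: measurable_pair1.
by move=> v nv; apply: FD => /unit_box_cons[_].
Qed.

Lemma bounded_on_slicer v :
  bounded_on (unit_itv R) (fun t : measurableTypeR R => F (cons_rV (t, v))).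
Proof.
have [C [C0 FC FD]] := bounded_onP hF.
apply: (bounded_onI (C := C)) => //.
  by apply: (measurableT_comp mFc); exact: measurable_pair2.
by move=> t /=; rewrite in_itv/= -ler_norml => nt; apply: FD => /unit_box_cons[].
Qed.

Let box_fin : ((mu1 \x mu) (unit_itv R `*` unit_box R n) < +oo)%E.
Proof.
rewrite product_measure1E//; last exact: measurable_unit_box.
by rewrite lte_mul_pinfty// ?ge0_fin_numE//; [exact: unit_itv_fin|exact: unit_box_fin].
Qed.

Let iF : (mu1 \x mu)%E.-integrable setT (EFin \o (F \o @cons_rV R n)).
Proof.
have [C [C0 FC FD]] := bounded_onP hF.
apply: (@bounded_on_integrable _ _ _ _ (unit_itv R `*` unit_box R n)).
- by apply: measurableX => //; exact: measurable_unit_box.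
- exact: box_fin.
- apply: (bounded_onI (C := C)) => //; first by move=> p; exact: FC.
  move=> -[t v] /= h; apply: FD => /unit_box_cons[h1 h2].
  by apply: h; split => //=; rewrite in_itv/= -ler_norml.
Qed.

Let RintE : \int[lebesgue_rV R n.+1]_x F x =
  fine (\int[(mu1 \x mu)%E]_p (F (cons_rV p))%:E).
Proof.
rewrite /Rintegral; congr fine.
have := @integral_pushforward _ _ _ _ _ _ (@measurable_cons_rV R n) (mu1 \x mu)%E setT (EFin \o F).
by rewrite preimage_setT => ->//; apply/measurable_EFinP; exact: hF.1.
Qed.

Lemma bounded_on_Rintegrall :
  bounded_on (unit_itv R) (fun t : measurableTypeR R => \int[mu]_v F (cons_rV (t, v))).
Proof.
have [C [C0 FC FD]] := bounded_onP hF.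
have sl t := unit_box_integrable (bounded_on_slicel t).
apply: (bounded_onI (C := C * fine (mu (unit_box R n)))).
- apply/measurable_EFinP.
  have := measurable_fubini_F iF; apply: eq_measurable_fun => t _.
  by rewrite /fubini_F/= fineK//; exact: integrable_fin_num (sl t).
- move=> t; apply: bounded_on_le_Rintegral => //.
  + exact: measurable_unit_box.
  + exact: unit_box_fin.
  + exact: bounded_on_slicel.
- move=> t /=; rewrite in_itv/= -ler_norml => nt.
  rewrite (@eq_Rintegral _ _ _ _ _ (cst 0)) ?Rintegral_cst ?mul0r// => s _.
  by apply: FD => /unit_box_cons[].
Qed.

Lemma Rintegral_consl :
  \int[lebesgue_rV R n.+1]_x F x = \int[mu1]_t \int[mu]_v F (cons_rV (t, v)).
Proof.
have sl t := unit_box_integrable (bounded_on_slicel t).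
rewrite RintE -(integral12_prod_meas1 iF) [RHS]/Rintegral; congr fine.
apply: eq_integral => t _.
by rewrite /fubini_F/= fineK//; exact: integrable_fin_num (sl t).
Qed.

Lemma bounded_on_Rintegralr :
  bounded_on (unit_box R n) (fun v => \int[mu1]_t F (cons_rV (t, v))).
Proof.
have [C [C0 FC FD]] := bounded_onP hF.
have sl v := unit_itv_integrable (bounded_on_slicer v).
apply: (bounded_onI (C := C * fine (mu1 `[-1, 1]%classic))).
- apply/measurable_EFinP.
  have := measurable_fubini_G iF; apply: eq_measurable_fun => t _.
  by rewrite /fubini_G/= fineK//; exact: integrable_fin_num (sl t).
- move=> v; apply: bounded_on_le_Rintegral => //.
  + exact: unit_itv_fin.
  + exact: bounded_on_slicer.
- move=> v nv.
  rewrite (@eq_Rintegral _ _ _ _ _ (cst 0)) ?Rintegral_cst ?mul0r// => s _.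
  by apply: FD => /unit_box_cons[].
Qed.

Lemma Rintegral_consr :
  \int[lebesgue_rV R n.+1]_x F x = \int[mu]_v \int[mu1]_t F (cons_rV (t, v)).
Proof.
have sl v := unit_itv_integrable (bounded_on_slicer v).
rewrite RintE -(integral21_prod_meas1 iF) [RHS]/Rintegral; congr fine.
apply: eq_integral => v _.
by rewrite /fubini_G/= fineK//; exact: integrable_fin_num (sl v).
Qed.

End rV_fubini.

(** * The divergence theorem for functions supported in the cube *)

Section rV_calculus.
Variables (R : realType).

Lemma continuous_rV (T : topologicalType) n (g : T -> 'rV[R]_n) :
  (forall i, continuous (fun x => g x ord0 i)) -> continuous g.
Proof.
move=> cg x; apply/cvg_ballP => e e0.
have : \forall y \near x, forall i, ball (g x ord0 i) e (g y ord0 i).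
  apply: filter_forall => i; have := cg i x; move/cvg_ballP; exact.
by apply: filterS => y h; split => // i j; rewrite ord1.
Qed.

Lemma continuous_cons_rVl n (v : 'rV[R]_n) :
  continuous (fun t : R => cons_rV (t, v)).
Proof.
apply: continuous_rV => i; case: (unliftP ord0 i) => [j|] ->.
  by under eq_fun do rewrite cons_rVS /=; exact: cst_continuous.
by under eq_fun do rewrite cons_rV0 /=.
Qed.

Lemma continuous_cons_rVr n (t : R) :
  continuous (fun v : 'rV[R]_n => cons_rV (t, v)).
Proof.
apply: continuous_rV => i; case: (unliftP ord0 i) => [j|] ->.
  by under eq_fun do rewrite cons_rVS /=; exact: coord_continuous.
by under eq_fun do rewrite cons_rV0 /=; exact: cst_continuous.
Qed.

(** Only the values along the line through the base point matter for a
    directional derivative, so it can be computed on any function with the same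
    restriction to a line. *)
Lemma is_derive_line (V W : normedModType R) (f : V -> R) (g : W -> R) x v y w (d : R) :
  (forall h : R, g (h *: w + y) = f (h *: v + x)) ->
  is_derive x v f d -> is_derive y w g d.
Proof.
move=> gf [df <-].
have e : (fun h => h^-1 *: ((g \o shift y) (h *: w) - g y)) =
    (fun h => h^-1 *: ((f \o shift x) (h *: v) - f x)).
  apply/funext => h /=; have := gf 0; rewrite !scale0r !add0r => ->.
  by rewrite gf.
by split; [rewrite /derivable e|rewrite /derive e].
Qed.

Lemma is_derive_consl n (f : 'rV[R]_n.+1 -> R) t v d :
  is_derive (cons_rV (t, v)) (delta_mx ord0 ord0) f d ->
  is_derive t (1 : R) (fun s => f (cons_rV (s, v))) d.
Proof.
apply: is_derive_line => h; congr f; apply/rowP => i.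
rewrite !mxE; case: (unliftP ord0 i) => [j|] -> /=.
  by rewrite mulr0 add0r.
by [].
Qed.

Lemma is_derive_consr n (f : 'rV[R]_n.+1 -> R) t v j d :
  is_derive (cons_rV (t, v)) (delta_mx ord0 (lift ord0 j)) f d ->
  is_derive v (delta_mx ord0 j) (fun w => f (cons_rV (t, w))) d.
Proof.
apply: is_derive_line => h; congr f; apply/rowP => i.
rewrite !mxE; case: (unliftP ord0 i) => [k|] -> /=.
  by rewrite !mxE (inj_eq lift_inj).
by rewrite mulr0 add0r.
Qed.

Lemma FTC_Rintegral (g g' : R -> R) a b : a < b ->
  (forall t, is_derive t (1 : R) g (g' t)) -> continuous g' ->
  \int[lebesgue_measure]_(t in `[a, b]) g' t = g b - g a.
Proof.
move=> ab dg cg'; rewrite /Rintegral (continuous_FTC2 (F := g)) //.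
- exact: continuous_subspaceT.
- have cg : continuous g.
    by move=> t; apply/differentiable_continuous/derivable1_diffP; case: (dg t).
  split; first by move=> t _; case: (dg t).
    by apply: cvg_at_right_filter; exact: cg.
  by apply: cvg_at_left_filter; exact: cg.
- by move=> t _; rewrite derive1E; exact: derive_val.
Qed.

(** The derivatives are part of the data, so that slicing along a coordinate
    yields again an instance, in one dimension less. *)
Definition C1_box n (f : 'rV[R]_n -> R) (df : 'I_n -> 'rV[R]_n -> R) :=
  [/\ continuous f, forall i, continuous (df i),
      forall x i, is_derive x (delta_mx ord0 i) f (df i x)
    & forall x, ~ unit_box R n x -> f x = 0 /\ forall i, df i x = 0].

Lemma C1_box_slice n (f : 'rV[R]_n.+1 -> R) df t : C1_box f df ->
  C1_box (fun v => f (cons_rV (t, v))) (fun j v => df (lift ord0 j) (cons_rV (t, v))).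
Proof.
move=> [cf cdf ddf f0]; split.
- by move=> v; apply: continuous_comp; [exact: continuous_cons_rVr|exact: cf].
- by move=> i v; apply: continuous_comp; [exact: continuous_cons_rVr|exact: cdf].
- by move=> v j; exact: is_derive_consr (ddf _ _).
- by move=> v nv; have [|-> h] := f0 (cons_rV (t, v)) => [/unit_box_cons[]|].
Qed.

Lemma compact_unit_box n : compact (unit_box R n).
Proof.
have := @rV_compact R n (fun=> `[(-1 : R), 1]%classic) (fun=> @segment_compact R (-1) 1).
congr (compact _); apply/seteqP; split => x /= h i; have := h i.
  by rewrite /= in_itv/= -ler_norml.
by rewrite /= in_itv/= -ler_norml.
Qed.

Lemma continuous_bounded_on n (f : 'rV[R]_n -> R) : continuous f ->
  (forall x, ~ unit_box R n x -> f x = 0) -> bounded_on (unit_box R n) f.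
Proof.
move=> cf f0.
have [M fM] : exists M, forall x, unit_box R n x -> `|f x| <= M.
  have /compact_bounded[M [_ fM]] := continuous_compact
    (continuous_subspaceT cf) (compact_unit_box (n := n)).
  exists (M + 1) => x ux; apply: (fM (M + 1)); first by rewrite ltrDl.
  by exists x.
apply: (bounded_onI (C := Num.max M 0)) => //.
  exact: continuous_measurable_rV.
move=> x; have [/fM h|/f0 ->] := pselect (unit_box R n x).
  by rewrite le_max h.
by rewrite normr0 le_max lexx orbT.
Qed.

Lemma C1_box_bounded n (f : 'rV[R]_n -> R) df : C1_box f df ->
  bounded_on (unit_box R n) f.
Proof. by move=> [cf _ _ f0]; apply: continuous_bounded_on => // x /f0[]. Qed.

Lemma C1_box_bounded_d n (f : 'rV[R]_n -> R) df i : C1_box f df ->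
  bounded_on (unit_box R n) (df i).
Proof. by move=> [_ cdf _ f0]; apply: continuous_bounded_on => // x /f0[]. Qed.

(** Integrate first in the variable of the derivative, by the fundamental theorem
    of calculus on [-2, 2], whose endpoints lie off the support. *)
Lemma Rintegral_partial0 n (f : 'rV[R]_n -> R) df i : C1_box f df ->
  \int[lebesgue_rV R n]_x df i x = 0.
Proof.
elim: n => [|n IH] in f df i *; first by case: i.
move=> hf; have bi := C1_box_bounded_d i hf.
case: (unliftP ord0 i) => [j|] ij; last first.
  rewrite (Rintegral_consr bi).
  rewrite (@eq_Rintegral _ _ _ _ _ (cst 0)) ?Rintegral_cst ?mul0r// => v _.
  have [cf cdf ddf f0] := hf.
  have out (t : R) : 1 < `|t| -> ~ unit_box R n.+1 (cons_rV (t, v)).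
    by move=> t1 /unit_box_cons[]; rewrite leNgt t1.
  rewrite -(_ : \int[lebesgue_measure]_(t in `[-2, 2]%classic) df i (cons_rV (t, v)) = 0).
    rewrite [RHS]Rintegral_mkcond; apply: eq_Rintegral => t _.
    rewrite patchE; case: ifPn => // /negP nt; apply: (f0 _ _).2; apply: out.
    rewrite ltNge; apply/negP => t1; apply: nt; apply/mem_set => /=.
    by rewrite in_itv/= -ler_norml (le_trans t1)// ler1n.
  have dg t : is_derive t (1 : R) (fun s => f (cons_rV (s, v))) (df i (cons_rV (t, v))).
    by apply: is_derive_consl; rewrite -ij; exact: ddf.
  have cg : continuous (fun t : R => df i (cons_rV (t, v))).
    by move=> t; apply: continuous_comp; [exact: continuous_cons_rVl|exact: cdf].
  have m22 : - 2 < 2 :> R by lra.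
  have n2 : `|2| = 2 :> R by rewrite ger0_norm.
  have o2 : ~ unit_box R n.+1 (cons_rV (2, v)) by apply: out; rewrite n2 ltr1n.
  have o2' : ~ unit_box R n.+1 (cons_rV (-2, v)) by apply: out; rewrite normrN n2 ltr1n.
  by rewrite (FTC_Rintegral m22 dg cg) (f0 _ o2).1 (f0 _ o2').1 subrr.
rewrite (Rintegral_consl bi).
rewrite (@eq_Rintegral _ _ _ _ _ (cst 0)) ?Rintegral_cst ?mul0r// => t _.
by rewrite ij; exact: IH (C1_box_slice t hf).
Qed.

End rV_calculus.

(** * Means over small boxes control the L2 norm *)

Section means_on_intervals.
Variable (R : realType).
Local Notation mu1 := (@lebesgue_measure R).

Lemma Rintegral_fsum d (T : measurableType d) (mu : {measure set T -> \bar R})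
    (I : Type) (s : seq I) (f : I -> T -> R) :
  (forall i, mu.-integrable setT (EFin \o f i)) ->
  \int[mu]_x (\sum_(i <- s) f i x) = \sum_(i <- s) \int[mu]_x f i x.
Proof.
move=> hf; elim: s => [|i s IH].
  rewrite big_nil (@eq_Rintegral _ _ _ _ _ (cst 0)) ?Rintegral_cst ?mul0r// => x _.
  by rewrite big_nil.
rewrite big_cons -IH -RintegralD//.
  by apply: eq_Rintegral => x _; rewrite big_cons.
have := @integrable_sum _ _ _ mu _ measurableT _ s predT _ (fun i _ => hf i).
by apply: eq_integrable => // x _; rewrite /= -sumEFin.
Qed.

Lemma bounded_on_sum d (T : measurableType d) (D : set T)
    (I : Type) (s : seq I) (f : I -> T -> R) :
  (forall i, bounded_on D (f i)) -> bounded_on D (fun x => \sum_(i <- s) f i x).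
Proof.
move=> hf; elim: s => [|i s [m [C IH]]].
  split; first by under eq_fun do rewrite big_nil; exact: measurable_cst.
  by exists 0 => x; rewrite big_nil normr0 mul0r.
have [m' [C' h]] := hf i.
split; first by under eq_fun do rewrite big_cons; apply: measurable_funD.
exists (C' + C) => x; rewrite big_cons mulrDl (le_trans (ler_normD _ _))//.
exact: lerD.
Qed.

Lemma bounded_onD d (T : measurableType d) (D : set T) (f g : T -> R) :
  bounded_on D f -> bounded_on D g -> bounded_on D (fun x => f x + g x).
Proof.
move=> [mf [C h]] [mg [C' h']]; split; first exact: measurable_funD.
exists (C + C') => x; rewrite mulrDl (le_trans (ler_normD _ _))//.
exact: lerD.
Qed.

Lemma bounded_onZ d (T : measurableType d) (D : set T) (f : T -> R) c :
  bounded_on D f -> bounded_on D (fun x => c * f x).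
Proof.
move=> [m [C h]]; split; first exact: measurable_funM.
by exists (`|c| * C) => x; rewrite normrM -mulrA ler_wpM2l.
Qed.

Lemma bounded_on_indic d (T : measurableType d) (D Q : set T) :
  measurable Q -> Q `<=` D -> bounded_on D (\1_Q : T -> R).
Proof.
move=> mQ QD; apply: (bounded_onI (C := 1)) => [|x|x nD].
- exact: measurable_indic.
- by rewrite indicE; case: (_ \in _); rewrite ?normr1 ?normr0.
- by rewrite indicE memNset// => /QD.
Qed.

(** A function oscillating little on an interval is close to its mean there; this
    turns an estimate on each slice into one on the means. *)
Lemma oscillation_le_mean (g : measurableTypeR R -> R) a b M t :
  -1 <= a -> a < b -> b <= 1 ->
  bounded_on (unit_itv R) g ->
  (forall s, `[a, b]%classic s -> `|g t - g s| <= M) ->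
  g t ^+ 2 <= 2 * (\int[mu1]_s (\1_(`[a, b]%classic : set (measurableTypeR R)) s * g s) / (b - a)) ^+ 2
    + 2 * M ^+ 2.
Proof.
move=> a1 ab b1 bg osc; set I : set (measurableTypeR R) := `[a, b]%classic.
set G := \int[mu1]_s _; have ba : 0 < b - a by rewrite subr_gt0.
have mI : measurable I by exact: measurable_itv.
have I1 : I `<=` (unit_itv R).
  by apply: subset_itv; rewrite bnd_simp.
have bI : bounded_on (unit_itv R) (\1_I : _ -> R).
  exact: bounded_on_indic.
have bIg := bounded_onMindic mI bg.
have II : \int[mu1]_s (\1_I s : R) = b - a.
  have <- : fine (mu1 `[a, b]%classic) = b - a.
    by rewrite lebesgue_measure_itv/= lte_fin ab.
  by rewrite /Rintegral integral_indic// setIT.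
have bgt : bounded_on (unit_itv R) (fun s => \1_I s * g t).
  rewrite (_ : (fun s => _) = (fun s => g t * \1_I s)); first exact: bounded_onZ.
  by apply/funext => s; rewrite mulrC.
have e : `|(b - a) * g t - G| <= M * (b - a).
  rewrite -II -RintegralZr//; last exact: unit_itv_integrable.
  rewrite -RintegralB//; last first.
  - exact: unit_itv_integrable.
  - exact: unit_itv_integrable.
  have bd : bounded_on (unit_itv R)
      (fun s => \1_I s * g t - \1_I s * g s).
    apply: bounded_onD => //.
    rewrite (_ : (fun s => _) = (fun s => (-1) * (\1_I s * g s))); first exact: bounded_onZ.
    by apply/funext => s; rewrite mulN1r.
  apply: le_trans (le_normr_Rintegral _ (unit_itv_integrable bd)) _ => //.
  rewrite -RintegralZl//; last exact: unit_itv_integrable.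
  apply: le_Rintegral => //.
  - exact: integrable_norm (unit_itv_integrable bd).
  - by apply: unit_itv_integrable; exact: bounded_onZ.
  - move=> s _; rewrite -mulrBr normrM indicE.
    have [/set_mem sI|_] := boolP (s \in I).
      by rewrite normr1 mul1r mulr1; exact: osc.
    by rewrite normr0 mul0r mulr0.
have {}e : `|g t - G / (b - a)| <= M.
  rewrite -(ler_pM2r ba) -[X in _ * X](gtr0_norm ba) -normrM mulrBl divfK ?gt_eqF//.
  by rewrite mulrC.
have {}e : (g t - G / (b - a)) ^+ 2 <= M ^+ 2.
  rewrite -real_normK ?num_real// lerXn2r ?nnegrE//; exact: le_trans e.
move: e; set x := G / (b - a); set y := g t => e.
have := sqr_ge0 (y - 2 * x); move: e; rewrite !expr2; lra.
Qed.

End means_on_intervals.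

Section compactness_estimate.
Variable (R : realType).
Local Notation mu1 := (@lebesgue_measure R).

Lemma bounded_on_sqr d (T : measurableType d) (D : set T) (f : T -> R) :
  bounded_on D f -> bounded_on D (fun x => f x ^+ 2).
Proof. by move=> hf; exact: (bounded_onM hf hf). Qed.

Lemma box_CauchySchwarz n (f g : 'rV[R]_n -> R) :
  bounded_on (unit_box R n) f -> bounded_on (unit_box R n) g ->
  (\int[lebesgue_rV R n]_x (f x * g x)) ^+ 2 <=
  \int[lebesgue_rV R n]_x (f x ^+ 2) * \int[lebesgue_rV R n]_x (g x ^+ 2).
Proof.
move=> bf bg; apply: quadratic_ge0_discriminant.
  by apply: Rintegral_ge0 => x _; exact: sqr_ge0.
move=> t; have b1 := bounded_on_sqr bf; have b2 := bounded_onM bf bg.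
have b3 := bounded_on_sqr bg.
rewrite mulrA -!RintegralZl//; try exact: unit_box_integrable.
rewrite -RintegralD//; last 2 first.
- exact: unit_box_integrable.
- by apply: unit_box_integrable; exact: bounded_onZ.
rewrite -RintegralD//; last 2 first.
- by apply: unit_box_integrable; apply: bounded_onD => //; exact: bounded_onZ.
- by apply: unit_box_integrable; exact: bounded_onZ.
apply: Rintegral_ge0 => x _.
by rewrite (_ : _ + _ = (f x + t * g x) ^+ 2) ?sqr_ge0//; ring.
Qed.

Lemma increment_le_Rintegral (g g' : measurableTypeR R -> R) (a b s t : R) :
  (forall r, is_derive (r : R) (1 : R) (g : R -> R) (g' r)) ->
  continuous (g' : R -> R) -> bounded_on (unit_itv R) g' ->
  a <= s -> s < t -> t <= b ->
  `|g t - g s| <= \int[mu1]_r (\1_(`[a, b]%classic : set (measurableTypeR R)) r * `|g' r|).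
Proof.
move=> dg cg' bg' as_ st tb; rewrite -(FTC_Rintegral st dg cg').
have mI (x y : R) : measurable (`[x, y]%classic : set (measurableTypeR R)) by exact: measurable_itv.
have bI x y := bounded_onMindic (mI x y) bg'.
have bI' x y := bounded_onMindic (mI x y) (bounded_on_norm bg').
have -> : \int[mu1]_(x in `[s, t]) g' x =
    \int[mu1]_r (\1_(`[s, t]%classic : set (measurableTypeR R)) r * g' r).
  rewrite Rintegral_mkcond; apply: eq_Rintegral => r _.
  by rewrite patchE indicE; case: (r \in _); rewrite ?mul1r ?mul0r.
apply: (le_trans (le_normr_Rintegral _ (unit_itv_integrable (bI _ _)))) => //.
apply: le_Rintegral => //.
- exact: integrable_norm (unit_itv_integrable (bI _ _)).
- exact: unit_itv_integrable.
- move=> r _; rewrite normrM ger0_norm// ler_wpM2r// !indicE ler_nat.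
  have [/set_mem/= h|//] := boolP (r \in _); rewrite mem_set//=.
  move: h; rewrite !in_itv/= => /andP[h1 h2].
  by rewrite (le_trans as_)// (le_trans h2).
Qed.

(** The part of Rellich's theorem that concerns functions on a cube. Cut [-1, 1]
    into K intervals I_m of length h and apply the induction hypothesis to the
    slices f (t, .): it remains to bound the integrals over t of g_j t ^ 2, where
    g_j t is the integral of the slice over Q_j. On I_m each g_j oscillates by at most
    the integral M_m of |d_0 f| over I_m x box, and M_m^2 <= h 2^n D0 with D0 the
    integral of (d_0 f)^2. So the integral of g_j^2 over I_m is at most
    (2 / h) G^2 + 2 h M_m^2, where G is the integral of f over I_m x Q_j;
    the contributions of D0 add up to at most e D0 when K is large. *)
Theorem mean_values_control_norm n e : 0 < e ->
  exists (J : finType) (Q : J -> set 'rV[R]_n) (C : R),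
    [/\ 0 <= C, forall j, measurable (Q j) &
      forall f df, C1_box f df ->
        \int[lebesgue_rV R n]_x (f x ^+ 2) <=
        e * \sum_i \int[lebesgue_rV R n]_x (df i x ^+ 2) +
        C * \sum_j (\int[lebesgue_rV R n]_x (\1_(Q j) x * f x)) ^+ 2].
Proof.
move=> e0; elim: n => [|n [J [Q [C [C0 mQ IH]]]]].
  exists unit, (fun=> setT), 1; split => // f df _.
  rewrite big_ord0 mulr0 add0r mul1r big_const card_unit/= addr0.
  have point (h : 'rV[R]_0 -> R) : \int[lebesgue_rV R 0]_x h x = h 0.
    rewrite (@eq_Rintegral _ _ _ _ _ (cst (h 0))) ?Rintegral_cst//= ?indicT ?mulr1// => x _.
    by rewrite (thinmx0 x).
  by rewrite !point indicT mul1r.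
(* K >= X makes the total contribution C #|J| 4 h 2^n of D0 at most e *)
pose X := C * #|J|%:R * (8 * 2 ^+ n) / e.
have X0 : 0 <= X by rewrite !mulr_ge0// ?invr_ge0 ltW.
pose K := (Num.truncn X).+1.
have KX : X <= K%:R by rewrite ltW// truncnS_gt.
have K0 : (0 : R) < K%:R by rewrite ltr0n.
pose h : R := 2 / K%:R.
have h0 : 0 < h by rewrite divr_gt0.
have Kh : K%:R * h = 2 by rewrite mulrCA divff ?mulr1 ?gt_eqF.
pose a (m : 'I_K) : R := -1 + m%:R * h.
pose b (m : 'I_K) : R := -1 + m.+1%:R * h.
have a1 m : -1 <= a m by rewrite lerDl mulr_ge0// ltW.
have bah m : b m - a m = h by rewrite /a /b -natr1; ring.
have ab m : a m < b m by rewrite -subr_gt0 bah.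
have b1 m : b m <= 1.
  apply: (@le_trans _ _ (-1 + K%:R * h)); last by rewrite Kh; lra.
  by rewrite lerD2l (ler_wpM2r (ltW h0))// ler_nat.
pose I m : set (measurableTypeR R) := `[a m, b m]%classic.
have mI m : measurable (I m) by exact: measurable_itv.
pose Q' (p : 'I_K * J) : set 'rV[R]_n.+1 := @uncons_rV R n @^-1` (I p.1 `*` Q p.2).
pose IT m : set 'rV[R]_n.+1 := @uncons_rV R n @^-1` (I m `*` setT).
pose TQ j : set 'rV[R]_n.+1 := @uncons_rV R n @^-1` (setT `*` Q j).
have mpre A : measurable A -> measurable (@uncons_rV R n @^-1` A).
  by move=> mA; rewrite -[X in measurable X]setTI; exact: measurable_uncons_rV.
have memE A (t : measurableTypeR R) v :
    (cons_rV (t, v) \in @uncons_rV R n @^-1` A) = ((t, v) \in A).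
  apply/idP/idP => /set_mem hA; apply/mem_set; first by rewrite -(cons_rVK (t, v)).
  by rewrite /preimage/= cons_rVK.
have Q'E p t v : \1_(Q' p) (cons_rV (t, v)) = \1_(I p.1) t * \1_(Q p.2) v :> R.
  by rewrite !indicE -natrM mulnb memE in_setX.
have ITE m t v : \1_(IT m) (cons_rV (t, v)) = \1_(I m) t :> R.
  by rewrite !indicE memE in_setX in_setT andbT.
have TQE j t v : \1_(TQ j) (cons_rV (t, v)) = \1_(Q j) v :> R.
  by rewrite !indicE memE in_setX in_setT.
exists ('I_K * J)%type, Q', (C * (2 / h)); split.
- by rewrite mulr_ge0// divr_ge0// ltW.
- by move=> p; apply: mpre; apply: measurableX.
move=> f df hf; have bf := C1_box_bounded hf; have bdf i := C1_box_bounded_d i hf.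
pose D0 := \int[lebesgue_rV R n.+1]_x (df ord0 x ^+ 2).
pose g j (t : measurableTypeR R) := \int[lebesgue_rV R n]_v (\1_(Q j) v * f (cons_rV (t, v))).
have bTQ j : bounded_on (unit_box R n.+1) (fun x => \1_(TQ j) x * f x).
  by apply: bounded_onMindic => //; apply: mpre; exact: measurableX.
have gE j : (fun t : measurableTypeR R =>
    \int[lebesgue_rV R n]_v (\1_(TQ j) (cons_rV (t, v)) * f (cons_rV (t, v)))) = g j.
  by apply/funext => t; apply: eq_Rintegral => v _; rewrite TQE.
have bg j : bounded_on (unit_itv R) (g j).
  by have := bounded_on_Rintegrall (bTQ j); rewrite gE.
pose G (p : 'I_K * J) := \int[lebesgue_rV R n.+1]_x (\1_(Q' p) x * f x).
have GE m j : G (m, j) = \int[mu1]_t (\1_(I m) t * g j t).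
  have bQ' : bounded_on (unit_box R n.+1) (fun x => \1_(Q' (m, j)) x * f x).
    by apply: bounded_onMindic => //; apply: mpre; exact: measurableX.
  rewrite /G (Rintegral_consl bQ'); apply: eq_Rintegral => t _.
  rewrite /g -RintegralZl//; last first.
    by apply: unit_box_integrable; apply: bounded_onMindic => //; exact: bounded_on_slicel.
  by apply: eq_Rintegral => v _; rewrite Q'E/= mulrA.
have bIT m : bounded_on (unit_box R n.+1) (fun x => \1_(IT m) x * `|df ord0 x|).
  by apply: bounded_onMindic; [apply: mpre; exact: measurableX|exact: bounded_on_norm].
pose M m := \int[lebesgue_rV R n.+1]_x (\1_(IT m) x * `|df ord0 x|).
have M2 m : M m ^+ 2 <= h * 2 ^+ n * D0.
  pose B : set 'rV[R]_n.+1 := IT m `&` unit_box R n.+1.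
  have mB : measurable B.
    by apply: measurableI; [apply: mpre; exact: measurableX|exact: measurable_unit_box].
  have bB : bounded_on (unit_box R n.+1) (\1_B : _ -> R).
    by apply: bounded_on_indic => // x [].
  have -> : M m = \int[lebesgue_rV R n.+1]_x (\1_B x * `|df ord0 x|).
    apply: eq_Rintegral => x _; have [ux|nux] := pselect (unit_box R n.+1 x).
      by rewrite !indicE /B in_setI (mem_set ux) andbT.
    by case: hf => _ _ _ /(_ x nux)[_ ->]; rewrite normr0 !mulr0.
  apply: (le_trans (box_CauchySchwarz bB (bounded_on_norm (bdf ord0)))).
  have -> : \int[lebesgue_rV R n.+1]_x (`|df ord0 x| ^+ 2) = D0.
    by apply: eq_Rintegral => x _; rewrite real_normK ?num_real.
  have -> // : \int[lebesgue_rV R n.+1]_x (\1_B x ^+ 2) = h * 2 ^+ n.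
  have -> : h * 2 ^+ n = fine (lebesgue_rV R n.+1 B).
    rewrite /= /lebesgue_cons /pushforward.
    rewrite (_ : _ @^-1` _ = I m `*` unit_box R n); last first.
      rewrite /B preimage_setI (_ : _ @^-1` IT m = I m `*` setT); last first.
        by apply/funext => p; rewrite /IT /preimage/= -[in RHS](cons_rVK p).
      apply/seteqP; split => -[t v] /=; first by move=> [[It _]] /unit_box_cons[].
      move=> [It uv]; split => //; apply/unit_box_cons; split=> //.
      rewrite ler_norml; move: It; rewrite /I/= in_itv/= => /andP[h1 h2].
      by rewrite (le_trans (a1 m))// (le_trans h2).
    rewrite product_measure1E//; last exact: measurable_unit_box.
    rewrite [X in fine X](_ : _ = (h%:E * (2 ^+ n)%:E)%E)//.
    congr (_ * _)%E; last exact: lebesgue_rV_unit_box.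
    by apply: etrans (lebesgue_measure_itv _) _; rewrite /= lte_fin ab -EFinD bah.
  rewrite /Rintegral; congr fine; rewrite -[X in lebesgue_rV R n.+1 X]setIT.
  rewrite -integral_indic//; apply: eq_integral => x _.
  by rewrite indicE; case: (_ \in _); rewrite ?expr1n ?expr0n.
have osc m j t s : I m t -> I m s -> `|g j t - g j s| <= M m.
  have bf' (t' : R) := bounded_on_slicel bf t'.
  have bQf (t' : R) := bounded_onMindic (mQ j) (bf' t').
  have bL : bounded_on (unit_box R n) (fun v => \int[mu1]_r (\1_(I m) r * `|df ord0 (cons_rV (r, v))|)).
    have := bounded_on_Rintegralr (bIT m).
    by congr bounded_on; apply/funext => v; apply: eq_Rintegral => r _; rewrite ITE.
  wlog st : s t / s <= t.
    by move=> H It Is; have [/H|/ltW/H] := leP s t; [exact|rewrite distrC; exact].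
  move=> It Is; move: st; rewrite le_eqVlt => /predU1P[->|st].
    by rewrite subrr normr0; apply: Rintegral_ge0 => x _; rewrite mulr_ge0.
  rewrite /g -RintegralB//; try exact: unit_box_integrable.
  have bd : bounded_on (unit_box R n)
      (fun v => \1_(Q j) v * f (cons_rV (t, v)) - \1_(Q j) v * f (cons_rV (s, v))).
    apply: bounded_onD => //.
    rewrite (_ : (fun s => _) = (fun v => (-1) * (\1_(Q j) v * f (cons_rV (s, v))))).
      exact: bounded_onZ.
    by apply/funext => v; rewrite mulN1r.
  apply: (le_trans (le_normr_Rintegral _ (unit_box_integrable bd))) => //.
  rewrite /M (Rintegral_consr (bIT m)).
  rewrite (@eq_Rintegral _ _ _ _ _
    (fun v => \int[mu1]_r (\1_(I m) r * `|df ord0 (cons_rV (r, v))|))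
    (fun v => \int[mu1]_r _)); last first.
    by move=> v _; apply: eq_Rintegral => r _; rewrite ITE.
  apply: le_Rintegral => //.
  - exact: integrable_norm (unit_box_integrable bd).
  - exact: unit_box_integrable.
  move=> v _; rewrite -mulrBr normrM.
  apply: (@le_trans _ _ `|f (cons_rV (t, v)) - f (cons_rV (s, v))|).
    rewrite -[leRHS]mul1r ler_wpM2r//.
    by rewrite indicE; case: (_ \in _); rewrite ?normr1 ?normr0.
  move: It Is; rewrite /I/= !in_itv/= => /andP[_ tb] /andP[as_ _].
  have [cf cdf ddf _] := hf.
  apply: (@increment_le_Rintegral (fun r => f (cons_rV (r, v))) (fun r => df ord0 (cons_rV (r, v)))) => //.
  - by move=> r; apply: is_derive_consl; exact: ddf.
  - by move=> r; apply: continuous_comp; [exact: continuous_cons_rVl|exact: cdf].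
  - exact: bounded_on_slicer (bdf ord0) v.
have gI m j : \int[mu1]_t (\1_(I m) t * g j t ^+ 2) <=
    2 / h * G (m, j) ^+ 2 + 2 * h * (h * 2 ^+ n * D0).
  have bg2 := bounded_onMindic (mI m) (bounded_on_sqr (bg j)).
  pose c := 2 * (G (m, j) / h) ^+ 2 + 2 * M m ^+ 2.
  have bI1 : bounded_on (unit_itv R) (\1_(I m) : _ -> R).
    by apply: bounded_on_indic => //; apply: subset_itv; rewrite bnd_simp.
  have II : \int[mu1]_s (\1_(I m) s : R) = h.
    have <- : fine (mu1 `[a m, b m]%classic) = h.
      by rewrite lebesgue_measure_itv/= lte_fin ab -EFinD bah.
    by rewrite /Rintegral integral_indic// setIT.
  apply: (@le_trans _ _ (\int[mu1]_t (c * \1_(I m) t))).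
    apply: le_Rintegral => //; try exact: unit_itv_integrable.
      by apply: unit_itv_integrable; exact: bounded_onZ.
    move=> t _; rewrite indicE; have [/set_mem It|_] := boolP (t \in I m); last first.
      by rewrite mul0r mulr0.
    rewrite mul1r mulr1 /c GE -(bah m); apply: oscillation_le_mean => //.
    by move=> s Is; apply: osc.
  rewrite RintegralZl//; last exact: unit_itv_integrable.
  rewrite II /c mulrDl lerD//.
    by rewrite le_eqVlt; apply/orP; left; apply/eqP; field; rewrite gt_eqF.
  by rewrite mulrAC ler_wpM2l// mulr_ge0// ltW.
have gsum j : \int[mu1]_t (g j t ^+ 2) <= \sum_m \int[mu1]_t (\1_(I m) t * g j t ^+ 2).
  have bg2 m := bounded_onMindic (mI m) (bounded_on_sqr (bg j)).
  rewrite -Rintegral_fsum; last by move=> m; exact: unit_itv_integrable.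
  apply: le_Rintegral => //.
  - exact: unit_itv_integrable (bounded_on_sqr (bg j)).
  - by apply: unit_itv_integrable; exact: bounded_on_sum.
  move=> t _; have [_ [_ _ g0]] := bounded_onP (bg j).
  have [t1|/g0 ->] := pselect ((unit_itv R) t); last first.
    by rewrite expr0n sumr_ge0// => m _; rewrite mulr0.
  have [m Im] : exists m, I m t.
    have /andP[tm1 t1'] : -1 <= t <= 1 by move: t1; rewrite /= in_itv.
    have th0 : 0 <= (t + 1) / h by rewrite divr_ge0 ?(ltW h0)// -lerBlDr sub0r.
    pose q := Num.truncn ((t + 1) / h).
    have qt : q%:R * h <= t + 1 by rewrite -ler_pdivlMr// truncn_le.
    have tq : t + 1 <= q.+1%:R * h by rewrite -ler_pdivrMr// ltW// truncnS_gt.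
    have [qK|Kq] := ltnP q K.
      exists (Ordinal qK); rewrite /I/= in_itv/= /a /b/=.
      by rewrite -lerBrDl opprK qt -lerBlDl opprK.
    have Km : (K.-1 < K)%N by [].
    have t_eq : t = 1.
      apply/le_anti; rewrite t1'/=.
      have : K%:R * h <= q%:R * h by rewrite (ler_wpM2r (ltW h0))// ler_nat.
      rewrite Kh => /le_trans/(_ qt).
      by rewrite (_ : 2 = 1 + 1)// lerD2r.
    exists (Ordinal Km); rewrite /I/= in_itv/= t_eq; apply/andP; split.
      by rewrite (le_trans (ltW (ab _)))//; exact: b1.
    by rewrite /b/= (_ : _ * h = 2) //; lra.
  rewrite (bigD1 m)//= indicE mem_set// mul1r lerDl sumr_ge0// => i _.
  by rewrite mulr_ge0// sqr_ge0.
have step : \int[lebesgue_rV R n.+1]_x (f x ^+ 2) <=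
    e * \sum_i \int[lebesgue_rV R n.+1]_x (df (lift ord0 i) x ^+ 2) +
    C * \sum_j \int[mu1]_t (g j t ^+ 2).
  have bdf2 i := bounded_on_sqr (bdf i).
  have bdI i := bounded_on_Rintegrall (bdf2 i).
  have bsum : bounded_on (unit_itv R) (fun t : measurableTypeR R =>
      \sum_i \int[lebesgue_rV R n]_v (df (lift ord0 i) (cons_rV (t, v)) ^+ 2)).
    exact: bounded_on_sum.
  have bsum' : bounded_on (unit_itv R) (fun t : measurableTypeR R => \sum_j (g j t) ^+ 2).
    by apply: bounded_on_sum => j; exact: bounded_on_sqr.
  rewrite (Rintegral_consl (bounded_on_sqr bf)).
  rewrite (_ : \sum_i _ = \int[mu1]_t \sum_i
    \int[lebesgue_rV R n]_v (df (lift ord0 i) (cons_rV (t, v)) ^+ 2)); last first.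
    rewrite Rintegral_fsum; last by move=> i; exact: unit_itv_integrable.
    by apply: eq_bigr => i _; rewrite (Rintegral_consl (bdf2 _)).
  rewrite (_ : \sum_j _ = \int[mu1]_t \sum_j (g j t ^+ 2)); last first.
    by rewrite Rintegral_fsum// => j; apply: unit_itv_integrable; exact: bounded_on_sqr.
  rewrite -!RintegralZl//; try exact: unit_itv_integrable.
  rewrite -RintegralD//; try by apply: unit_itv_integrable; exact: bounded_onZ.
  apply: le_Rintegral => //.
  - by apply: unit_itv_integrable; exact: bounded_on_Rintegrall (bounded_on_sqr bf).
  - by apply: unit_itv_integrable; apply: bounded_onD; exact: bounded_onZ.
  by move=> t _; exact: IH (C1_box_slice t hf).
apply: (le_trans step); rewrite big_ord_recl mulrDr -addrA addrCA lerD2l.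
have gb : \sum_j \int[mu1]_t (g j t ^+ 2) <=
    2 / h * \sum_p G p ^+ 2 + #|J|%:R * (4 * h * 2 ^+ n * D0).
  apply: (@le_trans _ _ (\sum_j \sum_m (2 / h * G (m, j) ^+ 2 + 2 * h * (h * 2 ^+ n * D0)))).
    apply: ler_sum => j _; apply: (le_trans (gsum j)).
    by apply: ler_sum => m _; exact: gI.
  under eq_bigr do rewrite big_split/= sumr_const card_ord -[_ *+ K]mulr_natl.
  rewrite big_split/= sumr_const -[_ *+ #|_|]mulr_natl lerD//.
    under eq_bigr do rewrite -mulr_sumr.
    rewrite -mulr_sumr exchange_big/= (pair_bigA _ (fun m j => G (m, j) ^+ 2))/=.
    by rewrite le_eqVlt; apply/orP; left; apply/eqP; congr (_ * _); apply: eq_bigr => -[].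
  rewrite ler_wpM2l// le_eqVlt; apply/orP; left; apply/eqP.
  rewrite (_ : _ * _ = K%:R * h * (2 * (h * 2 ^+ n * D0))); last by ring.
  by rewrite Kh; ring.
apply: (le_trans (ler_wpM2l C0 gb)).
have h1 : C * (#|J|%:R * (4 * h * 2 ^+ n * D0)) <= e * D0.
  have D00 : 0 <= D0 by apply: Rintegral_ge0 => x _; exact: sqr_ge0.
  rewrite (_ : _ * _ = X / K%:R * (e * D0)); last first.
    by rewrite /X /h; field; rewrite !gt_eqF.
  rewrite -[leRHS]mul1r ler_wpM2r//; first by rewrite mulr_ge0// ltW.
  by rewrite ler_pdivrMr// mul1r.
rewrite mulrDr [leRHS]addrC; apply: lerD; last exact: h1.
by rewrite -[C * (2 / h) * _]mulrA.
Qed.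

End compactness_estimate.

(** * Square integrable functions and weighted inner products *)

Section L2.
Context d (T : measurableType d) (R : realType) (mu : {measure set T -> \bar R}).
Implicit Types (f g w : T -> R).

Definition square_integrable f :=
  measurable_fun setT f /\ mu.-integrable setT (EFin \o (fun x => f x ^+ 2)).

Lemma integrable_le f g : measurable_fun setT f ->
  mu.-integrable setT (EFin \o g) -> (forall x, `|f x| <= g x) ->
  mu.-integrable setT (EFin \o f).
Proof.
move=> mf ig fg; apply: le_integrable ig => //; first exact/measurable_EFinP.
by move=> x _; rewrite /= lee_fin (le_trans (fg x))// ler_norm.
Qed.

Lemma integrable_addR f g : mu.-integrable setT (EFin \o f) ->
  mu.-integrable setT (EFin \o g) -> mu.-integrable setT (EFin \o (fun x => f x + g x)).
Proof.
move=> hf hg; apply: (eq_integrable _ _ _ _ (integrableD _ hf hg)) => // x _.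
Qed.

Lemma integrable_scaleR f c : mu.-integrable setT (EFin \o f) ->
  mu.-integrable setT (EFin \o (fun x => c * f x)).
Proof.
move=> hf; apply: (eq_integrable _ _ _ _ (integrableZl _ c hf)) => // x _.
Qed.

Lemma square_integrableM f g : square_integrable f -> square_integrable g ->
  mu.-integrable setT (EFin \o (fun x => f x * g x)).
Proof.
move=> [mf hf] [mg hg]; apply: integrable_le (integrable_addR hf hg) _.
  exact: measurable_funM.
move=> x; rewrite ler_norml.
have := sqr_ge0 (f x - g x); have := sqr_ge0 (f x + g x).
have := sqr_ge0 (f x); have := sqr_ge0 (g x).
by rewrite sqrrB sqrrD => *; apply/andP; split; lra.
Qed.

Lemma square_integrable_lin c f g : square_integrable f -> square_integrable g ->
  square_integrable (fun x => c * f x + g x).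
Proof.
move=> hf hg; have hfg := square_integrableM hf hg.
move: hf hg => [mf hf] [mg hg]; split.
  by apply: measurable_funD => //; exact: measurable_funM.
apply: (eq_integrable _ _ _ _
  (integrable_addR (integrable_scaleR (c ^+ 2) hf)
  (integrable_addR (integrable_scaleR (2 * c) hfg) hg))) => // x _.
by rewrite /=; congr _%:E; ring.
Qed.

Definition L2_pred : {pred (T -> R^o)} := fun f => `[< square_integrable f >].

Fact L2_submod_closed : submod_closed L2_pred.
Proof.
split.
  apply/asboolP; split; first exact: measurable_cst.
  apply: (eq_integrable _ _ _ _ (integrable0 mu setT)) => // x _.
  by rewrite /= expr0n.
move=> c f g /asboolP hf /asboolP hg; apply/asboolP.
exact: square_integrable_lin.
Qed.

HB.instance Definition _ := GRing.isSubmodClosed.Build _ _ L2_pred L2_submod_closed.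

(** Functions rather than classes modulo almost everywhere equality: pointwise
    identities between integrands remain available, and the product is a
    semidefinite form. *)
Record L2fun := MkL2fun { L2val : T -> R^o; _ : L2val \in L2_pred }.
HB.instance Definition _ := [isSub for L2val].
HB.instance Definition _ := [Choice of L2fun by <:].
HB.instance Definition _ := [SubChoice_isSubLmodule of L2fun by <:].

Definition L2fun_apply (f : L2fun) : T -> R := L2val f.
Coercion L2fun_apply : L2fun >-> Funclass.

Lemma L2P (u : L2fun) : square_integrable u.
Proof. by case: u => f /= /asboolP. Qed.

Definition toL2 f : L2fun :=
  if pselect (square_integrable f) is left hf then MkL2fun (asboolT hf) else 0.

Lemma toL2E f : square_integrable f -> toL2 f = f :> (T -> R).
Proof. by rewrite /toL2; case: pselect. Qed.

Lemma L2D (u v : L2fun) x : (u + v) x = u x + v x. Proof. by []. Qed.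
Lemma L2B (u v : L2fun) x : (u - v) x = u x - v x. Proof. by []. Qed.
Lemma L2Z c (u : L2fun) x : (c *: u) x = c * u x. Proof. by []. Qed.

Lemma L2_ext (u v : L2fun) : (forall x, u x = v x) -> u = v.
Proof. by move=> uv; apply/val_inj/funext. Qed.

(** Weights are bounded, so that multiplication by a weight is a bounded
    operator of L2. *)
Definition weight w := measurable_fun setT w /\ exists C : R, forall x, `|w x| <= C.

Lemma square_integrable_weight w f : weight w -> square_integrable f ->
  square_integrable (fun x => w x * f x).
Proof.
move=> [mw [C wC]] [mf hf]; split; first exact: measurable_funM.
apply: integrable_le (integrable_scaleR (C ^+ 2) hf) _.
  by apply: measurable_funX; exact: measurable_funM.
move=> x; rewrite ger0_norm ?sqr_ge0// exprMn ler_wpM2r ?sqr_ge0//.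
by rewrite -real_normK ?num_real// lerXn2r// nnegrE (le_trans _ (wC x)).
Qed.

Lemma weightM w1 w2 : weight w1 -> weight w2 -> weight (fun x => w1 x * w2 x).
Proof.
move=> [m1 [C1 h1]] [m2 [C2 h2]]; split; first exact: measurable_funM.
by exists (C1 * C2) => x; rewrite normrM; exact: ler_pM.
Qed.

Lemma weight_cst c : weight (fun=> c).
Proof. by split; [exact: measurable_cst|exists `|c|]. Qed.

(** All the quadratic expressions of the proof are instances of this product, and
    differ by the weight only. *)
Definition wip w (u v : L2fun) : R := \int[mu]_x (w x * u x * v x).

Lemma wip_integrable w (u v : L2fun) : weight w ->
  mu.-integrable setT (EFin \o (fun x => w x * u x * v x)).
Proof.
by move=> hw; apply: square_integrableM (L2P v); apply: square_integrable_weight (L2P u).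
Qed.

Lemma wip_linearl w c (f g h : L2fun) : weight w ->
  wip w (c *: f + g) h = c * wip w f h + wip w g h.
Proof.
move=> hw; rewrite /wip -RintegralZl//; last exact: wip_integrable.
rewrite -RintegralD//; try exact: wip_integrable.
  by apply: eq_Rintegral => x _; rewrite L2D L2Z; ring.
exact: integrable_scaleR (wip_integrable _ _ hw).
Qed.

Lemma wip_sym w (f g : L2fun) : wip w f g = wip w g f.
Proof. by apply: eq_Rintegral => x _; rewrite mulrAC. Qed.

Lemma wip_linear_weight w1 w2 c (f g : L2fun) : weight w1 -> weight w2 ->
  wip (fun x => c * w1 x + w2 x) f g = c * wip w1 f g + wip w2 f g.
Proof.
move=> h1 h2; rewrite /wip -RintegralZl//; last exact: wip_integrable.
rewrite -RintegralD//; try exact: wip_integrable.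
  by apply: eq_Rintegral => x _; ring.
exact: integrable_scaleR (wip_integrable _ _ h1).
Qed.

Lemma wip_psd w : weight w -> (forall x, 0 <= w x) -> psd_form (wip w).
Proof.
move=> hw w0; split => [c f g h|f g|f].
- exact: wip_linearl.
- exact: wip_sym.
- by apply: Rintegral_ge0 => x _; rewrite -mulrA mulr_ge0// -expr2 sqr_ge0.
Qed.

Definition ip := wip (fun=> 1).

Lemma ip_psd : psd_form ip.
Proof. by apply: wip_psd => //; exact: weight_cst. Qed.

Lemma wipE w (u v : L2fun) : weight w -> wip w u v = ip (toL2 (fun x => w x * u x)) v.
Proof.
move=> hw; apply: eq_Rintegral => x _.
by rewrite toL2E ?mul1r//; exact: square_integrable_weight (L2P u).
Qed.

Lemma le_wip w1 w2 (u : L2fun) : weight w1 -> weight w2 ->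
  (forall x, w1 x <= w2 x) -> wip w1 u u <= wip w2 u u.
Proof.
move=> h1 h2 h12; apply: le_Rintegral => //; try exact: wip_integrable.
by move=> x _; rewrite -!mulrA ler_wpM2r// -expr2 sqr_ge0.
Qed.

Lemma wip_bound w : weight w -> exists2 C : R, 0 <= C &
  forall u v, wip w u v ^+ 2 <= C * (ip u u * ip v v).
Proof.
move=> hw; have [_ [C wC]] := hw; exists (C ^+ 2); first exact: sqr_ge0.
move=> u v; rewrite wipE// (le_trans (form_CauchySchwarz ip_psd _ _))//.
rewrite mulrA ler_wpM2r ?(form_ge0 ip_psd)//.
have hw2 := weightM hw hw.
have -> : ip (toL2 (fun x => w x * u x)) (toL2 (fun x => w x * u x)) =
    wip (fun x => w x * w x) u u.
  apply: eq_Rintegral => x _; rewrite !toL2E; first by ring.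
  exact: square_integrable_weight (L2P u).
have -> : C ^+ 2 * ip u u = wip (fun=> C ^+ 2 * 1 + 0) u u.
  rewrite (@wip_linear_weight (fun=> 1) (fun=> 0)) ?addr0; try exact: weight_cst.
  rewrite [X in _ = _ + X](_ : _ = 0) ?addr0//.
  rewrite /wip (@eq_Rintegral _ _ _ _ _ (cst 0)) ?Rintegral_cst ?mul0r// => x _.
  by rewrite !mul0r.
apply: le_wip => //; first exact: weight_cst.
move=> x; rewrite mulr1 addr0 -expr2 -real_normK ?num_real//.
by rewrite lerXn2r// nnegrE (le_trans _ (wC x)).
Qed.

End L2.

(** * Completeness of L2 *)

Section L2_complete.
Context d (T : measurableType d) (R : realType) (mu : {measure set T -> \bar R}).
Local Notation L2 := (L2fun mu).

Lemma ipE (u v : L2) : ip u v = \int[mu]_x (u x * v x).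
Proof. by apply: eq_Rintegral => x _; rewrite mul1r. Qed.

Lemma ip_sqrE (u : L2) : ip u u = \int[mu]_x (u x ^+ 2).
Proof. by rewrite ipE. Qed.

Lemma integral_sqr (u : L2) : (\int[mu]_x (u x ^+ 2)%:E = (ip u u)%:E)%E.
Proof.
rewrite ip_sqrE /Rintegral fineK//.
by have := integrable_fin_num measurableT (L2P u).2.
Qed.

Lemma limn_einf_le (u : (\bar R)^nat) (e : \bar R) K :
  (forall n, (K <= n)%N -> (u n <= e)%E) -> (limn_einf u <= e)%E.
Proof.
move=> ue; rewrite limn_einf_lim; apply: lime_le; first exact: is_cvg_einfs.
exists K => // n Kn; apply: le_trans (ue n Kn); apply: ereal_inf_lbound.
by exists n => /=.
Qed.

Lemma fast_cauchy_cvg (x : nat -> R) (S : R) :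
  (forall k, 4 ^+ k * (x k.+1 - x k) ^+ 2 <= S ^+ 2) -> cvgn x.
Proof.
move=> hx.
have hd k : `|x k.+1 - x k| <= geometric `|S| (2^-1) k.
  rewrite /geometric/= exprVn ler_pdivlMr ?exprn_gt0//.
  rewrite -(@ler_pXn2r _ 2)// ?nnegrE ?mulr_ge0 ?exprn_ge0// exprMn.
  rewrite !real_normK ?num_real// mulrC -exprM mulnC exprM.
  by rewrite (_ : 2 ^+ 2 = 4) ?hx// -natrX.
have cs : cvgn (series (telescope x)).
  apply: normed_cvg; apply: (series_le_cvg _ _ hd) => [n|n|].
  - exact: normr_ge0.
  - by rewrite /geometric/= mulr_ge0// exprn_ge0// invr_ge0.
  - by apply: is_cvg_geometric_series; rewrite ger0_norm ?invr_ge0// invf_lt1// ltr1n.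
have -> : x = (fun n => x 0%N + series (telescope x) n).
  by apply/funext => n; exact: eq_sum_telescope.
by apply: is_cvgD => //; exact: is_cvg_cst.
Qed.

Section fast_subsequence.
Variable f : nat -> L2.
Hypothesis fast : forall k, ip (f k.+1 - f k) (f k.+1 - f k) <= 16^-1 ^+ k.

Let S x : \bar R := (\sum_(0 <= k <oo) (4 ^+ k * (f k.+1 x - f k x) ^+ 2)%:E)%E.

Let S_ge0 k x : (0 <= (4 ^+ k * (f k.+1 x - f k x) ^+ 2)%:E)%E.
Proof. by rewrite lee_fin; apply: mulr_ge0; [exact: exprn_ge0|exact: sqr_ge0]. Qed.

Let mterm k : measurable_fun setT (fun x => (4 ^+ k * (f k.+1 x - f k x) ^+ 2)%:E).
Proof.
apply/measurable_EFinP; apply: measurable_funM => //.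
by apply: measurable_funX; apply: measurable_funB; exact: (L2P _).1.
Qed.

Let mS : measurable_fun setT S.
Proof. by apply: ge0_emeasurable_sum => // k x _ _; exact: S_ge0. Qed.

Let iS : mu.-integrable setT S.
Proof.
apply/integrableP; split => //.
under eq_integral do rewrite gee0_abs ?nneseries_ge0//.
rewrite integral_nneseries//.
apply: (@le_lt_trans _ _ (\sum_(0 <= k <oo) (geometric 1 4^-1 k)%:E)%E).
  apply: lee_nneseries => [k _ _|k _]; first by apply: integral_ge0 => x _; exact: S_ge0.
  rewrite (@eq_integral _ _ _ mu setT (fun x => (((2 ^+ k *: (f k.+1 - f k)) x) ^+ 2)%:E)); last first.
    move=> x _; rewrite L2Z L2B exprMn -exprM mulnC exprM.
    by rewrite (_ : 2 ^+ 2 = 4)// -natrX.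
  rewrite integral_sqr (formZl (ip_psd mu)) (formZr (ip_psd mu)) lee_fin.
  rewrite /geometric/= mul1r mulrA -exprMn -natrM.
  rewrite -ler_pdivlMl ?exprn_gt0// -exprVn -exprMn.
  by apply: le_trans (fast k) _; rewrite (_ : 16^-1 = 4^-1 * 4^-1)// -invfM -natrM.
have := is_cvg_geometric_series (a := (1 : R)) (z := 4^-1).
rewrite ger0_norm ?invr_ge0// invf_lt1// ltr1n => /(_ isT) /cvg_ex[l hl].
have : (\sum_(0 <= k < n) (geometric 1 4^-1 k)%:E)%E @[n --> \oo] --> l%:E.
  under eq_fun do rewrite sumEFin.
  by apply: cvg_EFin => //; apply: nearW.
by move/cvg_lim => ->//; rewrite ltry.
Qed.

Let A := [set x | (S x < +oo)%E].

Let mA : measurable A.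
Proof.
by rewrite -[A]setTI; exact: (emeasurable_fun_infty_o measurableT mS).
Qed.

Let negA : mu (~` A) = 0.
Proof.
have := integrable_ae measurableT iS; move=> [N [mN N0 hN]].
apply/eqP; rewrite eq_le measure_ge0 andbT -N0 le_measure ?inE//.
  exact: measurableC.
move=> x Ax; apply: hN => /= h; apply: Ax; rewrite /A/=.
by rewrite ltey_eq h.
Qed.

Let g k x := \1_A x * f k x.

Let cvg_g x : cvgn (g ^~ x).
Proof.
rewrite /g indicE; have [/set_mem Ax|_] := boolP (x \in A); last first.
  by under eq_fun do rewrite mul0r; exact: is_cvg_cst.
under eq_fun do rewrite mul1r.
have Sfin : S x \is a fin_num by rewrite ge0_fin_numE ?nneseries_ge0.
apply: (@fast_cauchy_cvg _ (Num.sqrt (fine (S x)))) => k.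
rewrite sqr_sqrtr; last by rewrite fine_ge0// nneseries_ge0.
rewrite -lee_fin fineK//.
apply: (le_trans _ (@nneseries_lim_ge _ _ predT 0%N k.+1 _)); last by move=> n _ _; exact: S_ge0.
by rewrite big_nat_recr//= leeDr// sume_ge0.
Qed.

Let v0 x := limn (g ^~ x).

Let mv0 : measurable_fun setT v0.
Proof.
apply: (@measurable_fun_cvg _ _ _ _ g) => [m|x _]; last exact: cvg_g.
by apply: measurable_funM; [exact: measurable_indic|exact: (L2P _).1].
Qed.

(** The sum of 4^k |f_(k+1) - f_k|^2 is integrable, hence finite almost everywhere;
    where it is finite f_k converges geometrically, and Fatou's lemma bounds the
    distance to the limit. *)
Lemma fast_cauchy_L2 (u : L2) (e : R) K :
  (forall k, (K <= k)%N -> ip (u - f k) (u - f k) <= e) ->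
  square_integrable mu (fun x => u x - v0 x) /\
  \int[mu]_x (u x - v0 x) ^+ 2 <= e.
Proof.
move=> ue.
have muv : measurable_fun setT (fun x => u x - v0 x).
  by apply: measurable_funB => //; exact: (L2P u).1.
have mug k : measurable_fun setT (fun x => u x - g k x).
  apply: measurable_funB; first exact: (L2P u).1.
  by apply: measurable_funM; [exact: measurable_indic|exact: (L2P _).1].
have key : (\int[mu]_x ((u x - v0 x) ^+ 2)%:E <= e%:E)%E.
  have F := @fatou _ _ _ mu setT measurableT (fun k x => ((u x - g k x) ^+ 2)%:E).
  have mg k : measurable_fun setT (fun x => ((u x - g k x) ^+ 2)%:E).
    by apply/measurable_EFinP; exact: measurable_funX.
  have {F} := F mg (fun k x _ => sqr_ge0 _).
  under eq_integral => x _.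
    rewrite (_ : limn_einf _ = ((u x - v0 x) ^+ 2)%:E); last first.
      apply: (cvg_limn_einf_sup _).1; apply: cvg_EFin; first exact: nearW.
      have h : u x - g n x @[n --> \oo] --> u x - v0 x.
        by apply: cvgB; [exact: cvg_cst|exact: cvg_g].
      by rewrite expr2; under eq_fun do rewrite expr2; exact: (cvgM h h).
    over.
  move/le_trans; apply; apply: (@limn_einf_le _ _ K) => k Kk.
  apply: (@le_trans _ _ (\int[mu]_x ((u - f k) x ^+ 2)%:E)%E); last first.
    by rewrite integral_sqr lee_fin; exact: ue.
  rewrite le_eqVlt; apply/orP; left; apply/eqP; apply: ae_eq_integral => //.
  - by apply/measurable_EFinP; apply: measurable_funX; exact: (L2P (u - f k)).1.
  - exists (~` A); split => //; first exact: measurableC.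
    apply: subsetC => x Ax _; rewrite L2B /g indicE mem_set// mul1r//.
have uv0 : square_integrable mu (fun x => u x - v0 x).
  split => //; apply/integrableP; split.
    by apply/measurable_EFinP; exact: measurable_funX.
  under eq_integral do rewrite gee0_abs ?lee_fin ?sqr_ge0//.
  by apply: le_lt_trans key _; rewrite ltry.
split => //; rewrite -lee_fin /Rintegral fineK//.
exact: integrable_fin_num uv0.2.
Qed.

Lemma fast_cauchy_lim (u0 : L2) (e0 : R) :
  (forall k, ip (u0 - f k) (u0 - f k) <= e0) ->
  exists v : L2, forall (u : L2) (e : R) K,
  (forall k, (K <= k)%N -> ip (u - f k) (u - f k) <= e) -> ip (u - v) (u - v) <= e.
Proof.
move=> hu0; have [uv0 _] := @fast_cauchy_L2 u0 e0 0%N (fun k _ => hu0 k).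
exists (u0 - toL2 mu (fun x => u0 x - v0 x)) => u e K hu.
have [_] := fast_cauchy_L2 hu; rewrite ip_sqrE; apply: le_trans.
rewrite le_eqVlt; apply/orP; left; apply/eqP; apply: eq_Rintegral => x _.
by rewrite !L2B toL2E//; congr (_ ^+ 2); ring.
Qed.

End fast_subsequence.

(** Riesz-Fischer: a Cauchy sequence converges as soon as a subsequence does, and
    one can be extracted whose squared increments are at most 16^-k. *)
Theorem L2_complete (f : nat -> L2) :
  (forall e : R, 0 < e -> exists M, forall m l, (M <= m)%N -> (M <= l)%N ->
     ip (f m - f l) (f m - f l) < e) ->
  exists v : L2, ip (f m - v) (f m - v) @[m --> \oo] --> 0.
Proof.
move=> cauchy.
have /choice[N NP] : forall k : nat, exists M, forall m l, (M <= m)%N -> (M <= l)%N ->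
     ip (f m - f l) (f m - f l) < 16^-1 ^+ k.
  by move=> k; apply: cauchy; rewrite exprn_gt0// invr_gt0.
(* the index must dominate all earlier thresholds for the subsequence to be fast *)
pose n k := (k + \max_(i < k.+1) N i)%N.
have Nn k i : (i <= k)%N -> (N i <= n k)%N.
  move=> ik; rewrite /n (leq_trans _ (leq_addl _ _))//.
  by have := @leq_bigmax _ (fun i : 'I_k.+1 => N i) (Ordinal (ik : (i < k.+1)%N)).
have [v vP] : exists v : L2, forall (u : L2) (e : R) K,
    (forall k, (K <= k)%N -> ip (u - f (n k)) (u - f (n k)) <= e) -> ip (u - v) (u - v) <= e.
  apply: (@fast_cauchy_lim (f \o n) _ (f (N 0%N)) 1) => k /=.
    by apply/ltW/NP; exact: Nn.
  by have := NP 0%N (N 0%N) (n k) (leqnn _) (Nn _ _ (leq0n k)); rewrite expr0 => /ltW.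
exists v; apply/cvgrPdist_le => e e0.
have [M MP] := cauchy e e0; exists M => // m Mm.
rewrite sub0r normrN ger0_norm ?(form_ge0 (ip_psd mu))//.
apply: (vP _ _ M) => k Mk; apply/ltW/MP => //.
by rewrite (leq_trans Mk)// leq_addr.
Qed.

End L2_complete.

(** * Smooth functions and test functions *)

Section smooth_functions.
Variables (R : realType) (n : nat).
Implicit Types (f g : 'rV[R]_n -> R) (i : 'I_n) (Omega : set 'rV[R]_n).

Lemma partial_is_derive f i x : differentiable f x ->
  is_derive x (delta_mx ord0 i) f (partial i f x).
Proof. by move=> df; split => //; exact: diff_derivable. Qed.

Lemma partialD f g i : (forall x, differentiable f x) -> (forall x, differentiable g x) ->
  partial i (fun x => f x + g x) = (fun x => partial i f x + partial i g x).
Proof.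
by move=> df dg; apply/funext => x; apply: deriveD; exact: diff_derivable.
Qed.

Lemma partialM f g i : (forall x, differentiable f x) -> (forall x, differentiable g x) ->
  partial i (fun x => f x * g x) =
  (fun x => partial i f x * g x + f x * partial i g x).
Proof.
move=> df dg; apply/funext => x.
rewrite /partial deriveM; try exact: diff_derivable.
by rewrite addrC mulrC.
Qed.

Lemma partial_cst (c : R) i : partial i (fun _ : 'rV[R]_n => c) = (fun=> 0).
Proof. by apply/funext => x; exact: derive_cst. Qed.

Lemma is_derive_coord i j (x : 'rV[R]_n) :
  is_derive x (delta_mx ord0 i) (fun y : 'rV[R]_n => y ord0 j) (i == j)%:R.
Proof.
have -> : (i == j)%:R = (delta_mx ord0 i : 'rV[R]_n) ord0 j.
  by rewrite mxE eqxx eq_sym.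
pose w := (delta_mx ord0 i : 'rV[R]_n) ord0 j.
apply: (is_derive_line (f := @id R) (x := x ord0 j) (v := w)).
  by move=> h; rewrite /w /= !mxE.
Qed.

Lemma partial_coord j i :
  partial i (fun y : 'rV[R]_n => y ord0 j) = (fun=> (i == j)%:R).
Proof. by apply/funext => x; exact: (derive_val (is_derive := is_derive_coord i j x)). Qed.

(** Differentiability up to a finite order, because the closure of smooth
    functions under products is proved by induction on the order. *)
Definition smooth_upto k f :=
  forall (s : seq 'I_n) x, (size s <= k)%N -> differentiable (foldr (@partial R n) f s) x.

Lemma smooth_uptoP f : smooth f <-> forall k, smooth_upto k f.
Proof. by split=> [sf k s x _|sf s x]; [exact: sf|exact: (sf (size s))]. Qed.

Lemma smooth_uptoS k f : smooth_upto k.+1 f <->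
  (forall x, differentiable f x) /\ forall i, smooth_upto k (partial i f).
Proof.
split=> [sf|[df sf] s x].
  split=> [x|i s x sk]; first exact: (sf [::]).
  by rewrite -foldr_rcons; apply: sf; rewrite size_rcons.
case: (lastP s) => [|s' i] => [_|]; first exact: df.
by rewrite size_rcons foldr_rcons; exact: sf.
Qed.

Lemma smooth_uptoW k f : smooth_upto k.+1 f -> smooth_upto k f.
Proof. by move=> sf s x sk; apply: sf; exact: leqW. Qed.

Lemma smooth_uptoD k f g : smooth_upto k f -> smooth_upto k g ->
  smooth_upto k (fun x => f x + g x).
Proof.
elim: k => [|k IH] in f g * => sf sg.
  by move=> [|//] x _; apply: differentiableD; [exact: (sf [::])|exact: (sg [::])].
move/smooth_uptoS : sf => [df sf]; move/smooth_uptoS : sg => [dg sg].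
apply/smooth_uptoS; split=> [x|i]; first exact: differentiableD.
by rewrite partialD//; exact: IH.
Qed.

Lemma smooth_uptoM k f g : smooth_upto k f -> smooth_upto k g ->
  smooth_upto k (fun x => f x * g x).
Proof.
elim: k => [|k IH] in f g * => sf sg.
  by move=> [|//] x _; apply: differentiableM; [exact: (sf [::])|exact: (sg [::])].
have wf := smooth_uptoW sf; have wg := smooth_uptoW sg.
move/smooth_uptoS : sf => [df sf]; move/smooth_uptoS : sg => [dg sg].
apply/smooth_uptoS; split=> [x|i]; first exact: differentiableM.
by rewrite partialM//; apply: smooth_uptoD; exact: IH.
Qed.

Lemma smoothD f g : smooth f -> smooth g -> smooth (fun x => f x + g x).
Proof.
by move=> /smooth_uptoP sf /smooth_uptoP sg; apply/smooth_uptoP => k; exact: smooth_uptoD.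
Qed.

Lemma smoothM f g : smooth f -> smooth g -> smooth (fun x => f x * g x).
Proof.
by move=> /smooth_uptoP sf /smooth_uptoP sg; apply/smooth_uptoP => k; exact: smooth_uptoM.
Qed.

Lemma smooth_cst (c : R) : smooth (fun _ : 'rV[R]_n => c).
Proof.
apply/smooth_uptoP => k; elim: k => [|k IH] in c *.
  by move=> [|//] x _; exact: differentiable_cst.
apply/smooth_uptoS; split=> [x|i]; first exact: differentiable_cst.
by rewrite partial_cst; exact: IH.
Qed.

Lemma smooth_coord j : smooth (fun x : 'rV[R]_n => x ord0 j).
Proof.
apply/smooth_uptoP => -[|k].
  by move=> [|//] x _; exact: differentiable_coord.
apply/smooth_uptoS; split=> [x|i]; first exact: differentiable_coord.
by rewrite partial_coord; move/smooth_uptoP : (smooth_cst (i == j)%:R); exact.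
Qed.

Lemma smoothZ c f : smooth f -> smooth (fun x => c * f x).
Proof. by move=> sf; apply: smoothM => //; exact: smooth_cst. Qed.

Lemma smooth_sum (I : Type) (s : seq I) (F : I -> 'rV[R]_n -> R) :
  (forall j, smooth (F j)) -> smooth (fun x => \sum_(j <- s) F j x).
Proof.
move=> hF; elim: s => [|i s IH].
  by under eq_fun do rewrite big_nil; exact: smooth_cst.
by under eq_fun do rewrite big_cons; exact: smoothD.
Qed.

Lemma smooth_diff f x : smooth f -> differentiable f x.
Proof. by move=> /(_ [::]); exact. Qed.

Lemma smooth_partial f i : smooth f -> smooth (partial i f).
Proof. by move=> sf s x; rewrite -foldr_rcons; exact: sf. Qed.

Lemma smooth_continuous f : smooth f -> continuous f.
Proof. by move=> sf x; apply: differentiable_continuous; exact: smooth_diff. Qed.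

Lemma smooth_is_derive f i x : smooth f -> is_derive x (delta_mx ord0 i) f (partial i f x).
Proof. by move=> sf; apply: partial_is_derive; exact: smooth_diff. Qed.

Lemma near_is_derive f g i x d : (\near x, f x = g x) ->
  is_derive x (delta_mx ord0 i) g d -> is_derive x (delta_mx ord0 i) f d.
Proof.
move=> fg [dg <-]; split; last exact: near_eq_derive.
apply: near_eq_derivable dg; apply: filterS fg => y; exact: esym.
Qed.

Lemma near_cont f g x : (\near x, f x = g x) ->
  {for x, continuous g} -> {for x, continuous f}.
Proof.
move=> fg cg; rewrite /prop_for /continuous_at (nbhs_singleton fg).
have gf : {near x, g =1 f} by apply: filterS fg => y; exact: esym.
exact: cvg_trans (near_eq_cvg gf) cg.
Qed.

Lemma near_support0 (K : set 'rV[R]_n) f x : compact K ->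
  (forall y, ~ K y -> f y = 0) -> ~ K x -> \near x, f x = 0.
Proof.
move=> cK fK nKx.
have oK : open (~` K) by apply: closed_openC; apply: compact_closed => //; exact: norm_hausdorff.
by have : nbhs x (~` K) by [exact: open_nbhs_nbhs]; apply: filterS.
Qed.

Lemma partial_support (K : set 'rV[R]_n) f i x : compact K ->
  (forall y, ~ K y -> f y = 0) -> ~ K x -> partial i f x = 0.
Proof.
move=> cK fK nKx; rewrite /partial (@near_eq_derive _ _ _ f (fun=> 0)) ?derive_cst//.
exact: near_support0 nKx.
Qed.

Lemma test_functionD Omega c f g : test_function Omega f -> test_function Omega g ->
  test_function Omega (fun x => c * f x + g x).
Proof.
move=> [sf [K [cK KO fK]]] [sg [K' [cK' KO' gK]]]; split.
  by apply: smoothD => //; exact: smoothZ.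
exists (K `|` K'); split; first exact: compactU.
- by move=> x [/KO|/KO'].
- by move=> x nx; rewrite fK ?gK ?mulr0 ?addr0// => ?; apply: nx; [right|left].
Qed.

Lemma test_functionM Omega h f : smooth h -> test_function Omega f ->
  test_function Omega (fun x => h x * f x).
Proof.
move=> sh [sf [K [cK KO fK]]]; split; first exact: smoothM.
by exists K; split => // x /fK ->; rewrite mulr0.
Qed.

Lemma test_function_partial Omega f i : test_function Omega f ->
  test_function Omega (partial i f).
Proof.
move=> [sf [K [cK KO fK]]]; split; first exact: smooth_partial.
by exists K; split => // x; exact: partial_support.
Qed.

Lemma test_function_out Omega f x : test_function Omega f -> ~ Omega x -> f x = 0.
Proof. by move=> [_ [K [_ KO fK]]] nOx; apply: fK => /KO. Qed.

Lemma enorm_sqr (x : 'rV[R]_n) : enorm x ^+ 2 = \sum_i x ord0 i ^+ 2.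
Proof. by rewrite sqr_sqrtr// sumr_ge0// => i _; exact: sqr_ge0. Qed.

Lemma smooth_enorm_sqr : smooth (fun x : 'rV[R]_n => enorm x ^+ 2).
Proof.
under eq_fun do rewrite enorm_sqr; apply: smooth_sum => i.
by under eq_fun do rewrite expr2; apply: smoothM; exact: smooth_coord.
Qed.

Lemma unit_ballE (x : 'rV[R]_n) : unit_ball x <-> \sum_i x ord0 i ^+ 2 < 1.
Proof.
rewrite -enorm_sqr /unit_ball/=; split => h.
  by rewrite expr_lt1// sqrtr_ge0.
by rewrite -(@expr_lt1 _ 2)// sqrtr_ge0.
Qed.

Lemma unit_ball_box (x : 'rV[R]_n) : unit_ball x -> unit_box R n x.
Proof.
move=> /unit_ballE h i; rewrite -(@expr_le1 _ 2)// real_normK ?num_real//.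
rewrite (le_trans _ (ltW h))// (bigD1 i)//= lerDl sumr_ge0// => j _.
exact: sqr_ge0.
Qed.

End smooth_functions.

(** * Bounded domains of the hyperbolic ball *)

Section bounded_domains.
Variables (R : realType) (n : nat) (Omega : set 'rV[R]_n).
Hypothesis hOmega : bounded_domain Omega.
Local Notation mu := (lebesgue_rV R n).

(** Young's inequality, with a parameter making the first constant close to 1. *)
Lemma sqnorm_le_split (x y : 'rV[R]_n) (t : R) : 0 < t ->
  enorm x ^+ 2 <= (1 + t) * enorm y ^+ 2 + (1 + t^-1) * enorm (x - y) ^+ 2.
Proof.
move=> t0; rewrite !enorm_sqr !mulr_sumr -big_split/=; apply: ler_sum => i _.
rewrite !mxE -subr_ge0.
set a := x ord0 i; set b := y ord0 i.
rewrite (_ : _ - _ = t^-1 * (t * b - (a - b)) ^+ 2).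
  by rewrite mulr_ge0 ?sqr_ge0// invr_ge0 ltW.
by field; rewrite gt_eqF.
Qed.

(** Since arcosh t >= ln t, bounding the distance to a point x0 of the domain bounds
    |x - x0|^2 by a multiple of 1 - |x|^2, which prevents |x| from tending to 1. *)
Lemma bounded_domain_radius : exists2 r : R, r < 1 &
  forall x, Omega x -> enorm x ^+ 2 <= r.
Proof.
have [_ _ [x0 Ox0] OB [M hM]] := hOmega.
have s1 x : Omega x -> enorm x ^+ 2 < 1.
  by move=> /OB/unit_ballE; rewrite enorm_sqr.
pose s0 := enorm x0 ^+ 2; have s01 : s0 < 1 by exact: s1.
have s00 : 0 <= s0 by exact: sqr_ge0.
(* chosen so that (1 + dl) s0 < 1 *)
pose dl := (1 - s0) / 2; have dl0 : 0 < dl by rewrite divr_gt0// subr_gt0.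
pose E := expR M; have E0 : 0 < E by exact: expR_gt0.
pose C := (1 + dl^-1) * (E / 2).
have C0 : 0 <= C by rewrite mulr_ge0 ?divr_ge0 ?addr_ge0 ?invr_ge0// ltW.
exists (((1 + s0) / 2 + C) / (1 + C)).
  by rewrite ltr_pdivrMr ?ltr_wpDr// mul1r ltrD2r ltr_pdivrMr// mul1r; lra.
move=> x Ox; have sx := s1 x Ox; set s := enorm x ^+ 2 in sx *.
have key : enorm (x - x0) ^+ 2 <= E / 2 * (1 - s).
  have := hM x x0 Ox Ox0; rewrite /hyp_dist /arcosh -/s -/s0.
  set D := enorm (x - x0) ^+ 2; set p := (1 - s) * (1 - s0).
  have D0 : 0 <= D by exact: sqr_ge0.
  have p0 : 0 < p by rewrite mulr_gt0// subr_gt0.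
  have q0 : 0 <= 2 * D / p by apply: divr_ge0; [exact: mulr_ge0|exact: ltW].
  set t := 1 + _; set u := Num.sqrt _ => h.
  have u0 : 0 <= u by exact: sqrtr_ge0.
  have tu : 0 < t + u by rewrite /t -addrA ltr_pwDl// addr_ge0.
  have {}h : t + u <= E by rewrite -(lnK tu) ler_expR.
  have h2 : 2 * D / p <= E by apply: le_trans h; rewrite /t addrAC lerDr addr_ge0.
  rewrite ler_pdivrMr// in h2.
  have h3 : p <= 1 - s by rewrite /p ler_piMr ?subr_ge0 ?(ltW sx)// gerBl.
  have : 2 * D <= E * (1 - s) by apply: (le_trans h2); rewrite ler_wpM2l// ltW.
  by rewrite mulrAC ler_pdivlMr// (mulrC D).
have := sqnorm_le_split x x0 dl0; rewrite -/s -/s0 => h.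
rewrite ler_pdivlMr ?ltr_wpDr//.
have dl1 : 0 <= 1 + dl^-1 by rewrite addr_ge0// invr_ge0 ltW.
have h' : (1 + dl^-1) * enorm (x - x0) ^+ 2 <= C * (1 - s).
  by rewrite /C -mulrA ler_wpM2l.
have h'' : (1 + dl) * s0 <= (1 + s0) / 2.
  rewrite -subr_ge0 (_ : _ - _ = (1 - s0) ^+ 2 / 2) ?divr_ge0 ?sqr_ge0//.
  by rewrite /dl; field.
rewrite mulrDr mulr1.
have -> : s * C = C - C * (1 - s) by ring.
rewrite addrCA addrC lerD2r lerBlDr.
by apply: (le_trans h); apply: lerD.
Qed.

Lemma bounded_domain_compact : exists K : set 'rV[R]_n,
  [/\ compact K, Omega `<=` K & K `<=` @unit_ball R n].
Proof.
have [r r1 Or] := bounded_domain_radius.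
exists [set x | enorm x ^+ 2 <= r].
have KB : [set x | enorm x ^+ 2 <= r] `<=` @unit_ball R n.
  by move=> x /= xr; apply/unit_ballE; rewrite -enorm_sqr; exact: le_lt_trans xr r1.
split => //.
apply: subclosed_compact (compact_unit_box (n := n)) _.
  apply: (@closed_comp _ _ (fun x : 'rV[R]_n => enorm x ^+ 2) [set y | y <= r]).
    by move=> x _; exact: (smooth_continuous (@smooth_enorm_sqr R n)).
  exact: closed_le.
by move=> x /KB; exact: unit_ball_box.
Qed.

Lemma measurable_domain : measurable Omega.
Proof. by apply: open_measurable_rV; case: hOmega. Qed.

(** Weights are cut off to the domain, so that all integrals run over the whole
    space. *)
Definition on_domain (c : 'rV[R]_n -> R) x := \1_Omega x * c x.

Lemma on_domain_in c x : Omega x -> on_domain c x = c x.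
Proof. by move=> Ox; rewrite /on_domain indicE mem_set// mul1r. Qed.

Lemma on_domain_out c x : ~ Omega x -> on_domain c x = 0.
Proof. by move=> Ox; rewrite /on_domain indicE memNset// mul0r. Qed.

Lemma on_domainE c : on_domain c = c \_ Omega.
Proof.
apply/funext => x; rewrite patchE /on_domain indicE.
by case: (_ \in _); rewrite ?mul1r ?mul0r.
Qed.

(** The domain lies in a compact subset of the ball, where c is bounded even if it
    blows up at the sphere, as the conformal factor does. *)
Lemma ball_weight (c : 'rV[R]_n -> R) :
  (forall x, unit_ball x -> {for x, continuous c}) -> weight (on_domain c).
Proof.
move=> cc; have [oO _ _ OB _] := hOmega; split.
  have mc : measurable_fun Omega c.
    by apply: (open_continuous_measurable_rV oO) => x Ox; apply: cc; exact: OB.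
  rewrite on_domainE.
  exact: (measurable_restrictT c measurable_domain).1 mc.
have [K [cK OK KB]] := bounded_domain_compact.
have cw : {within K, continuous c}.
  by apply: continuous_in_subspaceT => x /set_mem/KB; exact: cc.
have /compact_bounded[M [_ cM]] := continuous_compact cw cK.
exists (Num.max (M + 1) 0) => x; have [Ox|nOx] := pselect (Omega x).
  rewrite on_domain_in// le_max; apply/orP; left.
  by apply: (cM (M + 1)); [rewrite ltrDl|exists x => //; exact: OK].
by rewrite on_domain_out// normr0 le_max lexx orbT.
Qed.

End bounded_domains.

(** * The Sobolev space of functions vanishing on the boundary *)

Lemma cvg_sumR (R : realType) (I : Type) (r : seq I) (f : I -> nat -> R) (l : I -> R) :
  (forall i, f i m @[m --> \oo] --> l i) ->
  \sum_(i <- r) f i m @[m --> \oo] --> \sum_(i <- r) l i.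
Proof.
move=> fl; elim: r => [|i r IH].
  by rewrite big_nil; under eq_fun do rewrite big_nil; exact: cvg_cst.
by rewrite big_cons; under eq_fun do rewrite big_cons; exact: cvgD.
Qed.

Section sobolev.
Variables (R : realType) (n : nat) (Omega : set 'rV[R]_n).
Hypothesis hOmega : bounded_domain Omega.
Local Notation mu := (lebesgue_rV R n).
Local Notation L2 := (L2fun mu).
Local Notation W := (option 'I_n -> L2).
Local Notation test := (test_function Omega).
Implicit Types (F G : W) (o : option 'I_n).

(** A function of H^1_0 is represented by its jet F: F None is the function and
    F (Some i) its weak Euclidean derivative in direction i. *)
Definition sob_ip F G := \sum_o ip (F o) (G o).

Lemma sob_psd : psd_form sob_ip.
Proof.
have P := ip_psd mu; split => [c f g h|f g|f].
- rewrite /sob_ip mulr_sumr -big_split/=; apply: eq_bigr => o _.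
  exact: (form_linear P).
- by apply: eq_bigr => o _; exact: (form_sym P).
- by apply: sumr_ge0 => o _; exact: (form_ge0 P).
Qed.

Lemma le_sob_ip o F : ip (F o) (F o) <= sob_ip F F.
Proof.
rewrite /sob_ip (bigD1 o)//= lerDl sumr_ge0// => i _.
exact: (form_ge0 (ip_psd mu)).
Qed.

Definition jet o (f : 'rV[R]_n -> R) := if o is Some i then partial i f else f.

Definition test_jet f : W := fun o => toL2 mu (jet o f).

Lemma test_jet_test o f : test f -> test (jet o f).
Proof. by case: o => [i|] //; exact: test_function_partial. Qed.

Lemma test_bounded f : test f -> bounded_on (unit_box R n) f.
Proof.
move=> tf; apply: continuous_bounded_on; first exact: smooth_continuous tf.1.
move=> x nx; apply: test_function_out tf _ => Ox; apply: nx.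
by apply: unit_ball_box; case: hOmega => _ _ _ OB _; exact: OB.
Qed.

Lemma bounded_on_L2 f : bounded_on (unit_box R n) f -> square_integrable mu f.
Proof.
by move=> bf; split; [exact: bf.1|apply: unit_box_integrable; exact: bounded_on_sqr].
Qed.

Lemma test_L2 f : test f -> square_integrable mu f.
Proof. by move=> tf; apply: bounded_on_L2; exact: test_bounded. Qed.

Lemma test_jetE f o x : test f -> test_jet f o x = jet o f x.
Proof. by move=> tf; rewrite /test_jet toL2E//; apply: test_L2; exact: test_jet_test. Qed.

Lemma test_jet_linear c f g : test f -> test g ->
  test_jet (fun x => c * f x + g x) = c *: test_jet f + test_jet g.
Proof.
move=> tf tg; apply/funext => o; apply: L2_ext => x.
have tcfg := test_functionD c tf tg.
rewrite L2D L2Z !test_jetE//; case: o => [i|]//=.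
have df y := smooth_diff y tf.1; have dg y := smooth_diff y tg.1.
rewrite partialD//; last by move=> y; apply: differentiableM.
rewrite partialM// partial_cst; congr (_ + _).
by rewrite mul0r add0r.
Qed.

(** The Euclidean norm is used: on a hyperbolically bounded domain it is equivalent
    to the norm of the hyperbolic metric. *)
Definition sobolev0 F :=
  forall e : R, 0 < e -> exists2 f, test f & sob_ip (F - test_jet f) (F - test_jet f) < e.

Lemma sobolev0_lin c F G : sobolev0 F -> sobolev0 G -> sobolev0 (c *: F + G).
Proof.
move=> hF hG e e0; pose d := e / (4 * (c ^+ 2 + 1)).
have c1 : 0 < c ^+ 2 + 1 by rewrite ltr_wpDl// sqr_ge0.
have d0 : 0 < d by rewrite divr_gt0// mulr_gt0.
have [f tf fF] := hF d d0; have [g tg gG] := hG d d0.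
exists (fun x => c * f x + g x); first exact: test_functionD.
rewrite test_jet_linear//.
have -> : c *: F + G - (c *: test_jet f + test_jet g) =
    c *: (F - test_jet f) + (G - test_jet g).
  by rewrite scalerBr opprD addrACA.
apply: (le_lt_trans (form_le2 sob_psd _ _)).
rewrite (formZl sob_psd) (formZr sob_psd).
have -> : e = 2 * (c * (c * d)) + 2 * d + (2 * (c ^+ 2 + 1) * d).
  by rewrite /d; field; rewrite gt_eqF.
rewrite -[ltLHS]addr0; apply: ler_ltD; last by rewrite mulr_gt0// mulr_gt0.
apply: lerD; last by rewrite ler_wpM2l// ltW.
rewrite ler_wpM2l// mulrA [leRHS]mulrA -expr2.
by apply: ler_wpM2l; [exact: sqr_ge0|exact: ltW].
Qed.

Lemma sobolev0_test f : test f -> sobolev0 (test_jet f).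
Proof. by move=> tf e e0; exists f => //; rewrite subrr (form0l sob_psd). Qed.

Lemma sobolev0_zero : sobolev0 0.
Proof.
have t0 : test (fun=> 0).
  split; first exact: smooth_cst.
  by exists set0; split => //; exact: compact0.
by have := sobolev0_lin (-1) (sobolev0_test t0) (sobolev0_test t0); rewrite scaleN1r addNr.
Qed.

Lemma sobolev0_sum (I : Type) (r : seq I) (c : I -> R) (F : I -> W) :
  (forall i, sobolev0 (F i)) -> sobolev0 (\sum_(i <- r) c i *: F i).
Proof.
move=> hF; elim: r => [|i r IH]; first by rewrite big_nil; exact: sobolev0_zero.
rewrite big_cons; exact (sobolev0_lin (c i) (hF i) IH).
Qed.

Lemma sobolev0_closed F :
  (forall e : R, 0 < e -> exists2 G, sobolev0 G & sob_ip (F - G) (F - G) < e) -> sobolev0 F.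
Proof.
move=> h e e0; have e4 : 0 < e / 4 by rewrite divr_gt0.
have [G hG FG] := h _ e4; have [f tf fG] := hG _ e4; exists f => //.
rewrite -(subrKA G); apply: (le_lt_trans (form_le2 sob_psd _ _)); lra.
Qed.

Lemma sobolev0_complete (f : nat -> W) : (forall m, sobolev0 (f m)) ->
  (forall e : R, 0 < e -> exists M, forall m l, (M <= m)%N -> (M <= l)%N ->
     sob_ip (f m - f l) (f m - f l) < e) ->
  exists2 v, sobolev0 v & sob_ip (f m - v) (f m - v) @[m --> \oo] --> 0.
Proof.
move=> hf cauchy.
have /choice[v vP] : forall o, exists v : L2,
    ip (f m o - v) (f m o - v) @[m --> \oo] --> 0.
  move=> o; apply: L2_complete => e e0; have [M MP] := cauchy e e0.
  exists M => m l Mm Ml; apply: le_lt_trans (MP m l Mm Ml).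
  exact: (le_sob_ip o).
have cv : sob_ip (f m - v) (f m - v) @[m --> \oo] --> 0.
  rewrite [X in _ --> X](_ : 0 = \sum_(o : option 'I_n) 0); last by rewrite big1.
  by apply: cvg_sumR => o; exact: vP.
exists v => //; apply: sobolev0_closed => e e0.
have /cvgrPdist_lt/(_ e e0)[M _ MP] := cv.
exists (f M) => //; have := MP M (leqnn M).
rewrite sub0r normrN ger0_norm ?(form_ge0 sob_psd)//.
by rewrite -opprB (formNl sob_psd) (formNr sob_psd) opprK.
Qed.

Lemma sobolev0_seq F : sobolev0 F -> exists2 f : nat -> 'rV[R]_n -> R,
  forall m, test (f m) & sob_ip (test_jet (f m) - F) (test_jet (f m) - F) @[m --> \oo] --> 0.
Proof.
move=> hF; have /choice[f fP] : forall m : nat, exists f, test f /\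
    sob_ip (F - test_jet f) (F - test_jet f) < m.+1%:R^-1.
  by move=> m; have [|f tf h] := hF m.+1%:R^-1; [rewrite invr_gt0|exists f].
exists f; first by move=> m; exact: (fP m).1.
apply: (squeeze_cvgr _ (cvg_cst 0) (@cvg_harmonic R)); apply: nearW => m.
rewrite (form_ge0 sob_psd)/= -opprB (formNl sob_psd) (formNr sob_psd) opprK.
exact/ltW/(fP m).2.
Qed.

Definition bounded_functional (l : W -> R) :=
  (forall c F G, l (c *: F + G) = c * l F + l G) /\
  exists C : R, forall F, l F ^+ 2 <= C * sob_ip F F.

(** Identities that are continuous in F pass from test functions to H^1_0. *)
Lemma bounded_functional_dense l : bounded_functional l ->
  (forall f, test f -> l (test_jet f) = 0) -> forall F, sobolev0 F -> l F = 0.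
Proof.
move=> [ll [C lC]] l0 F hF; apply/eqP; rewrite -sqrf_eq0 eq_le sqr_ge0 andbT.
apply/ler_addgt0Pr => e e0; rewrite add0r.
pose C' := Num.max C 1; have C'0 : 0 < C' by rewrite lt_max ltr01 orbT.
have [|f tf fF] := hF (e / C'); first by rewrite divr_gt0.
have -> : l F = l (F - test_jet f).
  by rewrite -scaleN1r addrC ll l0// mulr0 add0r.
apply: (le_trans (lC _)); apply: (@le_trans _ _ (C' * sob_ip (F - test_jet f) (F - test_jet f))).
  by rewrite ler_wpM2r ?(form_ge0 sob_psd)// le_max lexx.
by rewrite mulrC -ler_pdivlMr// ltW.
Qed.

Lemma bounded_functionalD l1 l2 : bounded_functional l1 -> bounded_functional l2 ->
  bounded_functional (fun F => l1 F + l2 F).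
Proof.
move=> [h1 [C1 b1]] [h2 [C2 b2]]; split.
  by move=> c F G; rewrite h1 h2; ring.
exists (2 * C1 + 2 * C2) => F; have := b1 F; have := b2 F.
have := sqr_ge0 (l1 F - l2 F); rewrite sqrrB sqrrD; lra.
Qed.

Lemma bounded_functional_sum (I : Type) (r : seq I) (l : I -> W -> R) :
  (forall i, bounded_functional (l i)) -> bounded_functional (fun F => \sum_(i <- r) l i F).
Proof.
move=> hl; elim: r => [|i r IH].
  split=> [c F G|]; first by rewrite !big_nil mulr0 addr0.
  by exists 0 => F; rewrite big_nil expr0n mul0r.
have [h1 h2] := bounded_functionalD (hl i) IH; split.
  by move=> c F G; have := h1 c F G; rewrite !big_cons.
by have [C hC] := h2; exists C => F; have := hC F; rewrite !big_cons.
Qed.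

Lemma bounded_functionalN l : bounded_functional l ->
  bounded_functional (fun F => - l F).
Proof.
move=> [h [C b]]; split; first by move=> c F G; rewrite h; ring.
by exists C => F; rewrite sqrrN.
Qed.

Lemma bounded_functional_wip w o v : weight w ->
  bounded_functional (fun F => wip w (F o) v).
Proof.
move=> hw; split; first by move=> c F G; exact: wip_linearl.
have [C C0 hC] := wip_bound mu hw; exists (C * ip v v) => F.
apply: (le_trans (hC _ _)); rewrite -mulrA ler_wpM2l//.
by rewrite mulrC ler_wpM2l ?(form_ge0 (ip_psd mu))//; exact: le_sob_ip.
Qed.

Lemma bounded_functional_wipr w o v : weight w ->
  bounded_functional (fun F => wip w v (F o)).
Proof.
by move=> hw; under eq_fun do rewrite wip_sym; exact: bounded_functional_wip.
Qed.

Lemma weight_on_domain_cst c : weight (on_domain Omega (fun=> c)).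
Proof. by apply: ball_weight => // x _; exact: cst_continuous. Qed.

(** True of test functions, which vanish off the domain; it says that F o vanishes
    almost everywhere there. *)
Lemma sobolev0_domain o F v : sobolev0 F ->
  ip (F o) v = wip (on_domain Omega (fun=> 1)) (F o) v.
Proof.
move=> hF; apply/eqP; rewrite -subr_eq0; apply/eqP; move: F hF.
apply: bounded_functional_dense => [|f tf].
  apply: bounded_functionalD; first exact: bounded_functional_wip (weight_cst _ _).
  by apply: bounded_functionalN; apply: bounded_functional_wip; exact: weight_on_domain_cst.
apply/eqP; rewrite subr_eq0; apply/eqP; apply: eq_Rintegral => x _.
rewrite test_jetE//; have [Ox|nOx] := pselect (Omega x).
  by rewrite on_domain_in.
by rewrite (test_function_out (test_jet_test o tf) nOx) !mulr0.
Qed.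

Section multiplication.
Variable h : 'rV[R]_n -> R.
Hypothesis sh : smooth h.

Definition wmul w (f : L2) : L2 := toL2 mu (fun x => w x * f x).

(** The derivatives of the product are those prescribed by the Leibniz rule. *)
Definition sob_mul F : W := fun o => if o is Some i
  then wmul (on_domain Omega h) (F (Some i)) + wmul (on_domain Omega (partial i h)) (F None)
  else wmul (on_domain Omega h) (F None).

Lemma sob_mulS F i : sob_mul F (Some i) =
  wmul (on_domain Omega h) (F (Some i)) + wmul (on_domain Omega (partial i h)) (F None).
Proof. by []. Qed.

Lemma sob_mulN F : sob_mul F None = wmul (on_domain Omega h) (F None).
Proof. by []. Qed.

Lemma smooth_weight g : smooth g -> weight (on_domain Omega g).
Proof. by move=> sg; apply: ball_weight => // x _; exact: smooth_continuous. Qed.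

Lemma wmulE w f x : weight w -> wmul w f x = w x * f x.
Proof. by move=> hw; rewrite toL2E//; exact: square_integrable_weight (L2P f). Qed.

Lemma wmul_linear w c (f g : L2) : weight w -> wmul w (c *: f + g) = c *: wmul w f + wmul w g.
Proof.
by move=> hw; apply: L2_ext => x; rewrite L2D L2Z !wmulE// L2D L2Z; ring.
Qed.

Lemma wmul_bound w : weight w -> exists2 C : R, 0 <= C &
  forall f, ip (wmul w f) (wmul w f) <= C * ip f f.
Proof.
move=> hw; have hw2 := weightM hw hw.
have [C C0 hC] := wip_bound mu hw2; exists (Num.sqrt C); first exact: sqrtr_ge0.
move=> f; have e : ip (wmul w f) (wmul w f) = wip (fun x => w x * w x) f f.
  by apply: eq_Rintegral => x _; rewrite !wmulE//; ring.
rewrite -(@ler_pXn2r _ 2)// ?nnegrE ?(form_ge0 (ip_psd mu))//; last first.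
  by rewrite mulr_ge0 ?sqrtr_ge0// (form_ge0 (ip_psd mu)).
by rewrite exprMn sqr_sqrtr// e; have := hC f f; rewrite -expr2.
Qed.

Lemma sob_mul_linear c F G : sob_mul (c *: F + G) = c *: sob_mul F + sob_mul G.
Proof.
apply/funext => -[i|].
  rewrite [LHS]/sob_mul !wmul_linear; try exact: smooth_weight (smooth_partial _ sh).
    set w := on_domain _ _; set w' := on_domain _ _.
    transitivity (c *: (wmul w (F (Some i)) + wmul w' (F None)) +
      (wmul w (G (Some i)) + wmul w' (G None))); last by [].
    by rewrite scalerDr addrACA.
  exact: smooth_weight.
by rewrite [LHS]/sob_mul wmul_linear//; exact: smooth_weight.
Qed.

Lemma sob_mul_bound : exists2 C : R, 0 <= C &
  forall F, sob_ip (sob_mul F) (sob_mul F) <= C * sob_ip F F.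
Proof.
have wh := smooth_weight sh; have [C0 C00 h0] := wmul_bound wh.
have /choice[C1 h1] : forall i, exists C1 : R, 0 <= C1 /\ forall f,
    ip (wmul (on_domain Omega (partial i h)) f) (wmul (on_domain Omega (partial i h)) f) <= C1 * ip f f.
  by move=> i; have [C ? ?] := wmul_bound (smooth_weight (smooth_partial i sh)); exists C.
pose C (o : option 'I_n) : R := if o is Some i then 2 * C0 + 2 * C1 i else C0.
have Cge0 o : 0 <= C o.
  by case: o => [i|]//=; rewrite addr_ge0// mulr_ge0//; exact: (h1 i).1.
exists (\sum_o C o); first exact: sumr_ge0.
move=> F; rewrite [leLHS]/sob_ip mulr_suml; apply: ler_sum => -[i|] _ /=.
  apply: (le_trans (form_le2 (ip_psd mu) _ _)); rewrite [leRHS](mulrDl (2 * C0)); apply: lerD.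
    rewrite -mulrA ler_wpM2l//; apply: (le_trans (h0 _)).
    by rewrite ler_wpM2l//; exact: (le_sob_ip (Some i)).
  rewrite -mulrA ler_wpM2l//; apply: (le_trans ((h1 i).2 _)).
  by rewrite ler_wpM2l//; [exact: (h1 i).1|exact: (le_sob_ip None)].
apply: (le_trans (h0 _)).
by rewrite ler_wpM2l//; exact: (le_sob_ip None).
Qed.

Lemma sob_mul_test f : test f -> sob_mul (test_jet f) = test_jet (fun x => h x * f x).
Proof.
move=> tf; have thf := test_functionM sh tf.
have wh := smooth_weight sh; have wdh i := smooth_weight (smooth_partial i sh).
apply/funext => o; apply: L2_ext => x; rewrite test_jetE//.
have [Ox|nOx] := pselect (Omega x); last first.
  rewrite [RHS](test_function_out (test_jet_test o thf) nOx).
  by case: o => [i|]; rewrite ?sob_mulS ?sob_mulN ?L2D !wmulE// !on_domain_out// !mul0r ?addr0.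
case: o => [i|]; rewrite ?sob_mulS ?sob_mulN ?L2D !wmulE// !on_domain_in// !test_jetE//=.
rewrite partialM; first by rewrite addrC.
- by move=> y; exact: smooth_diff.
- by move=> y; exact: smooth_diff tf.1.
Qed.

Lemma sobolev0_mul F : sobolev0 F -> sobolev0 (sob_mul F).
Proof.
move=> hF e e0; have [C C0 hC] := sob_mul_bound.
have C1 : 0 < C + 1 by rewrite ltr_wpDl.
have [|f tf fF] := hF (e / (C + 1)); first by rewrite divr_gt0.
exists (fun x => h x * f x); first exact: test_functionM.
rewrite -sob_mul_test//.
have -> : sob_mul F - sob_mul (test_jet f) = sob_mul (F - test_jet f).
  by rewrite -[in RHS]scaleN1r [in RHS]addrC sob_mul_linear scaleN1r addrC.
apply: (le_lt_trans (hC _)).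
have s0 := form_ge0 sob_psd (F - test_jet f).
apply: (@le_lt_trans _ _ ((C + 1) * sob_ip (F - test_jet f) (F - test_jet f))).
  by rewrite ler_wpM2r// lerDl.
by rewrite mulrC -ltr_pdivlMr.
Qed.

End multiplication.

End sobolev.

(** * Integration by parts and compactness *)

Section C1_ball.
Variables (R : realType) (n : nat).
Implicit Types (c : 'rV[R]_n -> R) (dc : 'I_n -> 'rV[R]_n -> R).

(** The weights q^n s^j may be singular on the unit sphere, so their regularity is
    local; the derivatives are data because they are needed in closed form. *)
Definition C1_ball c dc := forall x, unit_ball x ->
  [/\ {for x, continuous c}, forall i, {for x, continuous (dc i)}
    & forall i, is_derive x (delta_mx ord0 i) c (dc i x)].

Lemma unit_ball_open : open (@unit_ball R n).
Proof.
have -> : @unit_ball R n = (fun x : 'rV[R]_n => enorm x ^+ 2) @^-1` [set y | y < 1].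
  by apply/seteqP; split => x; rewrite /preimage/= enorm_sqr => /unit_ballE.
by apply: open_comp; [move=> x _; exact: (smooth_continuous (@smooth_enorm_sqr R n))|exact: open_lt].
Qed.

Lemma C1_ball_eq c dc dc' : C1_ball c dc ->
  (forall i x, unit_ball x -> dc' i x = dc i x) -> C1_ball c dc'.
Proof.
move=> hc e x Bx; have [h1 h2 h3] := hc x Bx; split => // i; last by rewrite e.
apply: near_cont (h2 i).
have : nbhs x (@unit_ball R n) by exact: open_nbhs_nbhs (conj unit_ball_open Bx).
by apply: filterS => y; exact: e.
Qed.

Lemma is_derive_mul (f g : 'rV[R]_n -> R) x v (a b : R) :
  is_derive x v f a -> is_derive x v g b ->
  is_derive x v (fun y => f y * g y) (a * g x + f x * b).
Proof.
move=> df dg; apply: is_derive_eq (is_deriveM df dg) _.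
by rewrite addrC mulrC.
Qed.

Lemma continuous_mul (f g : 'rV[R]_n -> R) x : {for x, continuous f} ->
  {for x, continuous g} -> {for x, continuous (fun y => f y * g y)}.
Proof. by move=> cf cg; exact: continuousM. Qed.

Lemma continuous_add (f g : 'rV[R]_n -> R) x : {for x, continuous f} ->
  {for x, continuous g} -> {for x, continuous (fun y => f y + g y)}.
Proof. by move=> cf cg; exact: continuousD. Qed.

Lemma C1_ballM c1 dc1 c2 dc2 : C1_ball c1 dc1 -> C1_ball c2 dc2 ->
  C1_ball (fun x => c1 x * c2 x) (fun i x => dc1 i x * c2 x + c1 x * dc2 i x).
Proof.
move=> h1 h2 x Bx; have [a1 b1 d1] := h1 x Bx; have [a2 b2 d2] := h2 x Bx; split.
- exact: continuous_mul.
- by move=> i; apply: continuous_add; exact: continuous_mul.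
- by move=> i; exact: is_derive_mul.
Qed.

Lemma C1_ball_cst (r : R) : C1_ball (fun=> r) (fun _ _ => 0).
Proof.
by move=> x _; split => [|i|i]; [exact: cst_continuous|exact: cst_continuous|exact: is_derive_cst].
Qed.

Lemma C1_ballX c dc k : C1_ball c dc ->
  C1_ball (fun x => c x ^+ k) (fun i x => k%:R * c x ^+ k.-1 * dc i x).
Proof.
move=> hc; elim: k => [|k IH].
  rewrite (_ : (fun x => _) = (fun=> 1)); last by apply/funext => x; rewrite expr0.
  by apply: C1_ball_eq (C1_ball_cst 1) _ => i x _; rewrite !mul0r.
have := C1_ballM hc IH; under [X in C1_ball X _ -> _]eq_fun do rewrite -exprS.
move/C1_ball_eq; apply => i x Bx /=; case: k {IH} => [|k] /=.
  by rewrite !mul0r mulr0 addr0 expr0 !mulr1 mul1r.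
by rewrite -natr1 exprS; ring.
Qed.

Lemma smooth_C1_ball f : smooth f -> C1_ball f (fun i => partial i f).
Proof.
move=> sf x _; split.
- exact: smooth_continuous.
- by move=> i; apply: smooth_continuous; exact: smooth_partial.
- by move=> i; exact: smooth_is_derive.
Qed.

Lemma is_derive_inv (f : 'rV[R]_n -> R) x v (a : R) : f x != 0 ->
  is_derive x v f a -> is_derive x v (fun y => (f y)^-1) (- (f x)^-1 ^+ 2 * a).
Proof.
move=> fx df; pose g (t : R) := f (t *: v + x).
have g0 : g 0 = f x by rewrite /g scale0r add0r.
have dg : is_derive (0 : R) (1 : R) g a.
  by apply: is_derive_line df => h; rewrite /g addr0 /GRing.scale/= mulr1.
have gx : g 0 != 0 by rewrite g0.
have dgV := is_deriveV gx dg; rewrite exprVn -g0.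
apply: is_derive_line dgV => h.
by rewrite /g addr0 /GRing.scale/= mulr1.
Qed.

Lemma C1_ballV c dc : C1_ball c dc -> (forall x, unit_ball x -> c x != 0) ->
  C1_ball (fun x => (c x)^-1) (fun i x => - (c x)^-1 ^+ 2 * dc i x).
Proof.
move=> hc c0 x Bx; have [a b d] := hc x Bx.
have cV : {for x, continuous (fun y => (c y)^-1)} by exact: cvgV (c0 x Bx) a.
split => // [i|i].
  apply: continuous_mul => //; apply: continuousN.
  exact: (continuous_mul cV cV).
exact: is_derive_inv (c0 x Bx) (d i).
Qed.

End C1_ball.

Section sobolev_calculus.
Variables (R : realType) (n : nat) (Omega : set 'rV[R]_n).
Hypothesis hOmega : bounded_domain Omega.
Local Notation mu := (lebesgue_rV R n).
Local Notation L2 := (L2fun mu).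
Local Notation W := (option 'I_n -> L2).
Local Notation test := (test_function Omega).
Implicit Types (F G : W) (o : option 'I_n).

Lemma test_C1_box f : test f -> C1_box f (fun i => partial i f).
Proof.
move=> tf; have OB x : ~ unit_box R n x -> ~ Omega x.
  by move=> nx Ox; apply: nx; apply: unit_ball_box; case: hOmega => _ _ _ OB _; exact: OB.
split.
- exact: smooth_continuous tf.1.
- by move=> i; apply: smooth_continuous; exact: smooth_partial tf.1.
- by move=> x i; exact: smooth_is_derive tf.1.
- move=> x /OB nOx; rewrite (test_function_out tf nOx); split => // i.
  exact: test_function_out (test_function_partial i tf) nOx.
Qed.

(** Rellich compactness in quantified form, for test functions an instance of
    [mean_values_control_norm] and in general by density. *)
Lemma sobolev0_mean_control e : 0 < e ->
  exists (J : finType) (q : J -> L2) (C : R), 0 <= C /\ forall F, sobolev0 Omega F ->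
    ip (F None) (F None) <=
    e * \sum_i ip (F (Some i)) (F (Some i)) + C * \sum_j ip (F None) (q j) ^+ 2.
Proof.
move=> e0; have [J [Q [C [C0 mQ hQ]]]] := @mean_values_control_norm R n e e0.
have bQ j : bounded_on (unit_box R n) (\1_(Q j `&` unit_box R n) : _ -> R).
  apply: bounded_on_indic => [|x []//].
  by apply: measurableI => //; exact: measurable_unit_box.
exists J, (fun j => toL2 mu (\1_(Q j `&` unit_box R n))), C; split => // F hF.
have [f tf cf] := sobolev0_seq hF.
have co o : ip (test_jet (f m) o - F o) (test_jet (f m) o - F o) @[m --> \oo] --> 0.
  apply: (squeeze_cvgr _ (cvg_cst 0) cf); apply: nearW => m.
  by rewrite (form_ge0 (ip_psd mu))/=; exact: (le_sob_ip o).
have cn o := form_cvg (ip_psd mu) (co o).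
have cl j := form_cvgl (h := toL2 mu (\1_(Q j `&` unit_box R n))) (ip_psd mu) (co None).
apply: (@ler_cvg_to _ _ _ _ _ _ _ _ (cn None) (_ : (fun m =>
    e * \sum_i ip (test_jet (f m) (Some i)) (test_jet (f m) (Some i)) +
    C * \sum_j ip (test_jet (f m) None) (toL2 mu (\1_(Q j `&` unit_box R n))) ^+ 2) m @[m --> \oo] --> _)).
  apply: cvgD; apply: cvgMl_tmp; apply: cvg_sumR => i; first exact: cn.
  by rewrite expr2; under eq_fun do rewrite expr2; exact: (cvgM (cl i) (cl i)).
apply: nearW => m; have := hQ _ _ (test_C1_box (tf m)); congr (_ <= _).
  by rewrite ip_sqrE; apply: eq_Rintegral => x _; rewrite (test_jetE hOmega).
congr (_ * _ + _ * _); apply: eq_bigr => i _.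
  by rewrite ip_sqrE; apply: eq_Rintegral => x _; rewrite (test_jetE hOmega).
congr (_ ^+ 2); rewrite ipE; apply: eq_Rintegral => x _.
rewrite (test_jetE hOmega)// toL2E; last by apply: bounded_on_L2; exact: bQ.
rewrite mulrC/=; have [Ox|nOx] := pselect (Omega x); last first.
  by rewrite (test_function_out (tf m) nOx) !mul0r.
congr (_ * _); rewrite !indicE in_setI; congr (nat_of_bool _)%:R.
rewrite [X in _ && X]mem_set ?andbT//.
by apply: unit_ball_box; case: hOmega => _ _ _ OB _; exact: OB.
Qed.

(** The compact support of f makes the product differentiable everywhere, although
    c is so only in the ball. *)
Lemma C1_box_mul c dc f g : C1_ball c dc -> test f -> test g ->
  C1_box (fun x => c x * (f x * g x)) (fun i x => dc i x * (f x * g x) +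
     c x * (partial i f x * g x + f x * partial i g x)).
Proof.
move=> hc tf tg; have [_ _ _ OB _] := hOmega.
have [sf [K [cK KO fK]]] := tf; have sg := tg.1.
have KB x : K x -> unit_ball x by move=> /KO/OB.
have f0 x : ~ K x -> \near x, f x = 0 by exact: near_support0.
have df0 i x : ~ K x -> \near x, partial i f x = 0.
  by apply: near_support0 => // y nKy; exact: partial_support nKy.
have sc h x : smooth h -> {for x, continuous h} by move=> sh; exact: smooth_continuous.
split.
- move=> x; have [/KB Bx|nKx] := pselect (K x).
    have [a b d] := hc x Bx; apply: continuous_mul => //.
    by apply: continuous_mul; exact: sc.
  apply: (@near_cont _ _ _ (fun=> 0)); last exact: cst_continuous.
  by apply: filterS (f0 x nKx) => y ->; rewrite mul0r mulr0.
- move=> i x; have [/KB Bx|nKx] := pselect (K x).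
    have [a b d] := hc x Bx; apply: continuous_add; apply: continuous_mul => //.
      by apply: continuous_mul; exact: sc.
    apply: continuous_add; apply: continuous_mul; apply: sc => //; exact: smooth_partial.
  apply: (@near_cont _ _ _ (fun=> 0)); last exact: cst_continuous.
  apply: filterS2 (f0 x nKx) (df0 i x nKx) => y -> ->.
  by rewrite !mul0r addr0 !mulr0 addr0.
- move=> x i; have [/KB Bx|nKx] := pselect (K x).
    have [a b d] := hc x Bx; exact: is_derive_mul (d i)
      (is_derive_mul (smooth_is_derive i x sf) (smooth_is_derive i x sg)).
  rewrite (nbhs_singleton (f0 x nKx)) (nbhs_singleton (df0 i x nKx)).
  rewrite !mul0r addr0 !mulr0 addr0.
  have n0 : \near x, c x * (f x * g x) = (fun=> 0) x.
    by apply: filterS (f0 x nKx) => y ->; rewrite mul0r mulr0.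
  by apply: (near_is_derive n0); exact: is_derive_cst.
- move=> x nx; have nKx : ~ K x by move=> /KB/unit_ball_box.
  rewrite (nbhs_singleton (f0 x nKx)) mul0r mulr0; split => // i.
  by rewrite (nbhs_singleton (df0 i x nKx)) !mul0r addr0 !mulr0 addr0.
Qed.

Lemma C1_ball_weight c dc : C1_ball c dc -> weight (on_domain Omega c).
Proof. by move=> hc; apply: ball_weight => // x Bx; case: (hc x Bx). Qed.

Lemma C1_ball_dweight c dc i : C1_ball c dc -> weight (on_domain Omega (dc i)).
Proof. by move=> hc; apply: ball_weight => // x Bx; case: (hc x Bx). Qed.

(** The integral of the i-th derivative of c f g vanishes: the divergence theorem
    when f and g are test functions, density in each argument in general. *)
Lemma sobolev0_by_parts c dc i F G : C1_ball c dc -> sobolev0 Omega F -> sobolev0 Omega G ->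
  wip (on_domain Omega c) (F None) (G (Some i)) +
  wip (on_domain Omega c) (F (Some i)) (G None) +
  wip (on_domain Omega (dc i)) (F None) (G None) = 0.
Proof.
move=> hc hF hG; have wc := C1_ball_weight hc; have wdc := C1_ball_dweight i hc.
move: G hG; apply: bounded_functional_dense => [|g tg].
  apply: bounded_functionalD; last exact: bounded_functional_wipr.
  by apply: bounded_functionalD; exact: bounded_functional_wipr.
move: F hF; apply: bounded_functional_dense => [|f tf].
  apply: bounded_functionalD; last exact: bounded_functional_wip.
  by apply: bounded_functionalD; exact: bounded_functional_wip.
have := Rintegral_partial0 i (C1_box_mul hc tf tg).
rewrite /wip -!RintegralD//; try exact: wip_integrable; last first.
  exact: integrable_addR (wip_integrable _ _ wc) (wip_integrable _ _ wc).
move=> e; rewrite -[RHS]e; apply: eq_Rintegral => x _.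
rewrite !(test_jetE hOmega)//=; have [Ox|nOx] := pselect (Omega x).
  by rewrite !on_domain_in//; ring.
rewrite !on_domain_out// (test_function_out tf nOx).
by rewrite (test_function_out (test_function_partial i tf) nOx); ring.
Qed.

End sobolev_calculus.

(** * The weights of the hyperbolic metric *)

Section hyperbolic_weights.
Variables (R : realType) (n : nat).
Implicit Types (x : 'rV[R]_n).

(** The inverse of the conformal factor q, a polynomial in x. *)
Definition half_gap x : R := (1 - enorm x ^+ 2) / 2.
Definition conf_factor x : R := (half_gap x)^-1.
Definition volume_weight x : R := conf_factor x ^+ n.
(** The volume contributes q^n and the squared norm of a hyperbolic gradient
    q^-2. Writing the latter as a power of the half gap avoids the exponent n - 2. *)
Definition energy_weight x : R := conf_factor x ^+ n * half_gap x ^+ 2.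

Lemma half_gap_gt0 x : unit_ball x -> 0 < half_gap x.
Proof. by move=> /unit_ballE h; rewrite divr_gt0// subr_gt0 enorm_sqr. Qed.

Lemma half_gap_neq0 x : unit_ball x -> half_gap x != 0.
Proof. by move=> /half_gap_gt0 h; rewrite gt_eqF. Qed.

Lemma half_gap_le x : half_gap x <= 2^-1.
Proof. by rewrite ler_pdivrMr// mulVf// gerBl sqr_ge0. Qed.

Lemma conf_inv x : (conf x)^-1 = half_gap x ^+ 2.
Proof. by rewrite /conf invf_div /half_gap expr_div_n; congr (_ / _); rewrite -natrX. Qed.

Lemma conf_factorE x : conf x = conf_factor x ^+ 2.
Proof. by rewrite /conf_factor exprVn -conf_inv invrK. Qed.

Lemma conf_factor_gt0 x : unit_ball x -> 0 < conf_factor x.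
Proof. by move=> Bx; rewrite invr_gt0 half_gap_gt0. Qed.

Lemma conf_factor_half_gap x : unit_ball x -> conf_factor x * half_gap x = 1.
Proof. by move=> Bx; rewrite mulVf// half_gap_neq0. Qed.

Lemma vol_densityE x : unit_ball x -> vol_density x = volume_weight x.
Proof.
move=> Bx; rewrite /vol_density conf_factorE -exprM mulnC exprM sqrtr_sqr.
by rewrite ger0_norm// exprn_ge0// ltW// conf_factor_gt0.
Qed.

Lemma volume_weight_ge1 x : unit_ball x -> 1 <= volume_weight x.
Proof.
move=> Bx; apply: exprn_ege1; rewrite -[leLHS]invr1 lef_pV2 ?posrE ?half_gap_gt0//.
by apply: (le_trans (half_gap_le x)); rewrite invf_le1// ler1n.
Qed.

Lemma smooth_half_gap : smooth half_gap.
Proof.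
have -> : half_gap = fun x => 2^-1 + (- 2^-1) * \sum_i (x ord0 i * x ord0 i).
  apply/funext => x; rewrite /half_gap enorm_sqr.
  by under eq_bigr do rewrite expr2; field.
apply: smoothD; first exact: smooth_cst.
apply: smoothZ; apply: smooth_sum => i; apply: smoothM; exact: smooth_coord.
Qed.

Lemma partial_sum (I : Type) (r : seq I) (F : I -> 'rV[R]_n -> R) i :
  (forall j, smooth (F j)) ->
  partial i (fun x => \sum_(j <- r) F j x) = (fun x => \sum_(j <- r) partial i (F j) x).
Proof.
move=> sF; elim: r => [|j r IH].
  by apply/funext => x; under eq_fun do rewrite big_nil; rewrite big_nil partial_cst.
under eq_fun do rewrite big_cons; rewrite partialD.
- by apply/funext => x; rewrite big_cons IH.
- by move=> x; exact: smooth_diff.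
- by move=> x; apply: smooth_diff; exact: smooth_sum.
Qed.

Lemma half_gap_C1 : C1_ball half_gap (fun i x => - x ord0 i).
Proof.
apply: C1_ball_eq (smooth_C1_ball smooth_half_gap) _ => i x _.
have -> : half_gap = fun x => 2^-1 + (- 2^-1) * \sum_j (x ord0 j * x ord0 j).
  apply/funext => y; rewrite /half_gap enorm_sqr.
  by under eq_bigr do rewrite expr2; field.
have sc j : smooth (fun x : 'rV[R]_n => x ord0 j) by exact: smooth_coord.
have sq : smooth (fun x : 'rV[R]_n => \sum_j (x ord0 j * x ord0 j)).
  by apply: smooth_sum => j; exact: smoothM.
rewrite partialD; last 2 first.
- by move=> y; exact: differentiable_cst.
- by move=> y; apply: smooth_diff; exact: smoothZ.
rewrite partialM; last 2 first.
- by move=> y; exact: differentiable_cst.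
- by move=> y; exact: smooth_diff.
rewrite !partial_cst partial_sum; last by move=> j; exact: smoothM.
rewrite add0r mul0r add0r (bigD1 i)//= big1 ?addr0; last first.
  move=> j ji; rewrite partialM; try by move=> y; exact: smooth_diff.
  by rewrite partial_coord eq_sym (negbTE ji) mul0r mulr0 addr0.
rewrite partialM; try by move=> y; exact: smooth_diff.
by rewrite partial_coord eqxx /=; field.
Qed.

Lemma conf_factor_C1 : C1_ball conf_factor (fun i x => conf_factor x ^+ 2 * x ord0 i).
Proof.
apply: C1_ball_eq (C1_ballV half_gap_C1 half_gap_neq0) _ => i x Bx.
by rewrite mulrNN.
Qed.

(** With q the conformal factor and s its inverse, d_i q = q^2 x_i and
    d_i s = - x_i. *)
Lemma power_weight_C1 j : C1_ball (fun x => conf_factor x ^+ n * half_gap x ^+ j)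
  (fun i x => conf_factor x ^+ n * (n%:R * conf_factor x * half_gap x ^+ j
     - j%:R * half_gap x ^+ j.-1) * x ord0 i).
Proof.
apply: C1_ball_eq (C1_ballM (C1_ballX n conf_factor_C1) (C1_ballX j half_gap_C1)) _.
move=> i x Bx /=.
have e k (Q : R) : k%:R * Q ^+ k.-1 * (Q ^+ 2 * x ord0 i) = Q ^+ k * (k%:R * Q) * x ord0 i.
  case: k => [|k]; first by rewrite mulr0n !mul0r mulr0 mul0r.
  by rewrite [k.+1.-1]/= (exprS _ k); ring.
by rewrite e; ring.
Qed.

Lemma energy_weight_C1 : C1_ball energy_weight (fun i x =>
  (n%:R - 2) * (conf_factor x ^+ n * half_gap x) * x ord0 i).
Proof.
apply: C1_ball_eq (power_weight_C1 2) _ => i x Bx /=.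
rewrite expr1 expr2 (mulrA (n%:R * _)) -(mulrA n%:R) (conf_factor_half_gap Bx).
by ring.
Qed.

Lemma cubic_weight_C1 i : C1_ball
  (fun x => conf_factor x ^+ n * half_gap x ^+ 3 * x ord0 i)
  (fun l x => conf_factor x ^+ n * ((n%:R - 3) * half_gap x ^+ 2 * x ord0 l * x ord0 i +
     half_gap x ^+ 3 * (l == i)%:R)).
Proof.
have cC1 : C1_ball (fun x : 'rV[R]_n => x ord0 i) (fun l _ => (l == i)%:R).
  by apply: C1_ball_eq (smooth_C1_ball (@smooth_coord R n i)) _ => l x _; rewrite partial_coord.
apply: C1_ball_eq (C1_ballM (power_weight_C1 3) cC1) _ => l x Bx /=.
have e : conf_factor x * half_gap x ^+ 3 = half_gap x ^+ 2.
  by rewrite exprS mulrA conf_factor_half_gap// mul1r.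
by rewrite -(mulrA n%:R) e; ring.
Qed.

Lemma energy_coord_weight_C1 i : C1_ball
  (fun x => energy_weight x * x ord0 i)
  (fun l x => (n%:R - 2) * (conf_factor x ^+ n * half_gap x) * x ord0 l * x ord0 i +
     energy_weight x * (l == i)%:R).
Proof.
have cC1 : C1_ball (fun x : 'rV[R]_n => x ord0 i) (fun l _ => (l == i)%:R).
  by apply: C1_ball_eq (smooth_C1_ball (@smooth_coord R n i)) _ => l x _; rewrite partial_coord.
exact: C1_ball_eq (C1_ballM energy_weight_C1 cC1) _.
Qed.

End hyperbolic_weights.

(** * Mass and Dirichlet energy *)

Section dirichlet_forms.
Variables (R : realType) (n : nat) (Omega : set 'rV[R]_n).
Hypothesis hOmega : bounded_domain Omega.
Local Notation mu := (lebesgue_rV R n).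
Local Notation L2 := (L2fun mu).
Local Notation W := (option 'I_n -> L2).
Local Notation test := (test_function Omega).
Local Notation onO := (on_domain Omega).
Local Notation H := (sobolev0 Omega).
Implicit Types (F G : W) (o : option 'I_n).

Let OB x : Omega x -> unit_ball x.
Proof. by case: hOmega => _ _ _ OB _; exact: OB. Qed.

Definition mass F G := wip (onO (@volume_weight R n)) (F None) (G None).
Definition energy F G := \sum_i wip (onO (@energy_weight R n)) (F (Some i)) (G (Some i)).

Lemma weight_volume : weight (onO (@volume_weight R n)).
Proof. exact: (C1_ball_weight hOmega (c := @volume_weight R n) (C1_ballX n (@conf_factor_C1 R n))). Qed.

Lemma weight_energy : weight (onO (@energy_weight R n)).
Proof. exact: (C1_ball_weight hOmega (@energy_weight_C1 R n)). Qed.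

Lemma on_domain_ge0 c x : (forall y, Omega y -> 0 <= c y) -> 0 <= onO c x.
Proof.
move=> c0; have [Ox|nOx] := pselect (Omega x); first by rewrite on_domain_in// c0.
by rewrite on_domain_out.
Qed.

Lemma energy_weight_ge0 x : Omega x -> 0 <= energy_weight x.
Proof.
move=> /OB Bx; rewrite mulr_ge0 ?sqr_ge0// exprn_ge0//.
by rewrite ltW// conf_factor_gt0.
Qed.

Lemma volume_weight_ge0 x : Omega x -> 0 <= volume_weight x.
Proof. by move=> /OB/volume_weight_ge1; exact: le_trans. Qed.

Lemma mass_psd : psd_form mass.
Proof.
have P : psd_form (wip (mu := mu) (onO (@volume_weight R n))).
  by apply: wip_psd weight_volume _ => x; apply: on_domain_ge0; exact: volume_weight_ge0.
split => [c f g h|f g|f].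
- exact: (form_linear P).
- exact: (form_sym P).
- exact: (form_ge0 P).
Qed.

Lemma energy_psd : psd_form energy.
Proof.
have P : psd_form (wip (mu := mu) (onO (@energy_weight R n))).
  by apply: wip_psd weight_energy _ => x; apply: on_domain_ge0; exact: energy_weight_ge0.
split => [c f g h|f g|f].
- rewrite /energy mulr_sumr -big_split/=; apply: eq_bigr => i _; exact: (form_linear P).
- by apply: eq_bigr => i _; exact: (form_sym P).
- by apply: sumr_ge0 => i _; exact: (form_ge0 P).
Qed.

Lemma wip_le_ip w : weight w -> exists2 C : R, 0 <= C &
  forall u : L2, wip w u u <= C * ip u u.
Proof.
move=> hw; have [C C0 hC] := wip_bound mu hw; exists (Num.sqrt C); first exact: sqrtr_ge0.
move=> u; have u0 := form_ge0 (ip_psd mu) u.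
apply: (le_trans (ler_norm _)).
rewrite -(@ler_pXn2r _ 2)// ?nnegrE ?mulr_ge0 ?sqrtr_ge0//.
by rewrite real_normK ?num_real// exprMn sqr_sqrtr//; have := hC u u; rewrite -expr2.
Qed.

Lemma sob_ip_split F G :
  sob_ip F G = ip (F None) (G None) + \sum_i ip (F (Some i)) (G (Some i)).
Proof.
rewrite /sob_ip (bigD1 None)//=; congr (_ + _).
rewrite (reindex_omap Some id)/=; first by apply: eq_bigl => i; rewrite eqxx.
by case.
Qed.

Lemma mass_energy_le_sob : exists2 C : R, 0 <= C &
  forall F, mass F F <= C * sob_ip F F /\ energy F F <= C * sob_ip F F.
Proof.
have [C1 C10 h1] := wip_le_ip weight_volume.
have [C2 C20 h2] := wip_le_ip weight_energy.
exists (C1 + C2); first exact: addr_ge0.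
move=> F; have s0 := form_ge0 (@sob_psd R n) F; rewrite mulrDl; split.
  rewrite -[leLHS]addr0; apply: lerD; last exact: mulr_ge0.
  by apply: (le_trans (h1 _)); rewrite ler_wpM2l//; exact: (le_sob_ip None).
rewrite -[leLHS]add0r; apply: lerD; first exact: mulr_ge0.
apply: (@le_trans _ _ (\sum_i C2 * ip (F (Some i)) (F (Some i)))).
  by apply: ler_sum => i _; exact: h2.
rewrite -mulr_sumr ler_wpM2l// sob_ip_split lerDr.
exact: (form_ge0 (ip_psd mu)).
Qed.

Lemma wipZ w c (u v : L2) : weight w -> wip (fun x => c * w x) u v = c * wip w u v.
Proof.
move=> hw; rewrite /wip -RintegralZl//; last exact: wip_integrable.
by apply: eq_Rintegral => x _; ring.
Qed.

(** The conformal factor is at least 1. *)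
Lemma ip_le_mass F : H F -> ip (F None) (F None) <= mass F F.
Proof.
move=> hF; rewrite (sobolev0_domain hOmega)//; apply: le_wip.
- exact: weight_on_domain_cst.
- exact: weight_volume.
- move=> x; have [Ox|nOx] := pselect (Omega x).
    by rewrite !on_domain_in//; exact/volume_weight_ge1/OB.
  by rewrite !on_domain_out.
Qed.

Lemma energy_weight_lower : exists2 c : R, 0 < c <= 1 &
  forall x, Omega x -> c <= energy_weight x.
Proof.
have [r r1 Or] := bounded_domain_radius hOmega.
have r0 : 0 < (1 - r) / 2 by rewrite divr_gt0// subr_gt0.
exists (Num.min 1 (((1 - r) / 2) ^+ 2)).
  by rewrite lt_min ltr01 exprn_gt0//= ge_min lexx.
move=> x Ox; have Bx := OB Ox; rewrite ge_min; apply/orP; right.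
rewrite -[leLHS]mul1r; apply: ler_pM => //; first exact: sqr_ge0.
  exact: volume_weight_ge1.
rewrite lerXn2r ?nnegrE//; first exact: ltW.
  by rewrite ltW// half_gap_gt0.
by rewrite ler_pM2r// lerB// Or.
Qed.

(** The energy weight is bounded below because the domain stays away from the
    sphere. *)
Lemma energy_coercive : exists2 c : R, 0 < c &
  forall F, H F -> c * \sum_i ip (F (Some i)) (F (Some i)) <= energy F F.
Proof.
have [c /andP[c0 _] hc] := energy_weight_lower; exists c => // F hF.
rewrite mulr_sumr; apply: ler_sum => i _; rewrite (sobolev0_domain hOmega)// -wipZ; last first.
  exact: weight_on_domain_cst.
apply: le_wip => [||x].
- apply: weightM; [exact: weight_cst|exact: weight_on_domain_cst].
- exact: weight_energy.
- have [Ox|nOx] := pselect (Omega x).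
    by rewrite !on_domain_in// mulr1 hc.
  by rewrite !on_domain_out// mulr0.
Qed.

Lemma on_domain_measurable c : measurable_fun Omega c -> measurable_fun setT (onO c).
Proof.
move=> mc; rewrite on_domainE.
exact: (measurable_restrictT c (measurable_domain hOmega)).1 mc.
Qed.

Lemma weight_measurable c : weight (onO c) -> measurable_fun Omega c.
Proof.
move=> [mc _]; rewrite on_domainE in mc.
exact: (measurable_restrictT c (measurable_domain hOmega)).2 mc.
Qed.

(** Functions in the hyperbolic H^1_0 and their weak gradients are given as measurable
    functions at a finite weighted distance from test functions; this shows that they
    are square integrable. *)
Lemma L2_of_close (p g h : 'rV[R]_n -> R) w0 e : square_integrable mu p ->
  (forall x, ~ Omega x -> p x = 0) -> measurable_fun Omega g ->
  measurable_fun Omega h -> 0 < w0 ->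
  (forall x, Omega x -> w0 * (p x - g x) ^+ 2 <= h x) ->
  (\int[mu]_(x in Omega) (h x)%:E < e%:E)%E ->
  square_integrable mu (onO g) /\
  ip (toL2 mu (onO g) - toL2 mu p) (toL2 mu (onO g) - toL2 mu p) <= e / w0.
Proof.
move=> hp p0 mg mh w00 hle he; pose dd x := p x - onO g x.
have md : measurable_fun setT dd.
  by apply: measurable_funB; [exact: hp.1|exact: on_domain_measurable].
have mwd : measurable_fun setT (fun x => w0 * dd x ^+ 2).
  by apply: measurable_funM => //; exact: measurable_funX.
have wd0 x : 0 <= w0 * dd x ^+ 2 by apply: mulr_ge0; [exact: ltW|exact: sqr_ge0].
have key : (\int[mu]_x (w0 * dd x ^+ 2)%:E < e%:E)%E.
  apply: le_lt_trans he; rewrite [leRHS]integral_mkcond.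
  apply: ge0_le_integral => //.
  - by move=> x _; rewrite lee_fin.
  - exact/measurable_EFinP.
  - rewrite restrict_EFin; apply/measurable_EFinP; rewrite -on_domainE.
    exact: on_domain_measurable.
  - move=> x _; rewrite restrict_EFin lee_fin -on_domainE /dd.
    have [Ox|nOx] := pselect (Omega x); first by rewrite !on_domain_in//; exact: hle.
    by rewrite !on_domain_out// p0// subrr expr0n mulr0.
have iwd : mu.-integrable setT (EFin \o (fun x => w0 * dd x ^+ 2)).
  apply/integrableP; split; first exact/measurable_EFinP.
  under eq_integral do rewrite gee0_abs ?lee_fin//.
  by apply: lt_trans key _; rewrite ltry.
have idd : square_integrable mu dd.
  split => //; apply: (eq_integrable _ _ _ _ (integrable_scaleR w0^-1 iwd)) => // x _.
  by rewrite /= mulKf// gt_eqF.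
have ig : square_integrable mu (onO g).
  have := square_integrable_lin (-1) idd hp; congr (square_integrable mu _).
  by apply/funext => x; rewrite /dd; ring.
split => //; rewrite ip_sqrE ler_pdivlMr// mulrC -RintegralZl//; last first.
  exact: (L2P (toL2 mu (onO g) - toL2 mu p)).2.
rewrite -lee_fin /Rintegral fineK.
  apply: le_trans (ltW key); rewrite le_eqVlt; apply/orP; left; apply/eqP.
  apply: eq_integral => x _; rewrite L2B !toL2E// /dd; congr _%:E; ring.
apply: integrable_fin_num => //.
apply: integrable_scaleR; exact: (L2P (toL2 mu (onO g) - toL2 mu p)).2.
Qed.

Lemma hyp_sqnorm_energy (f : 'rV[R]_n -> R) (X x : 'rV[R]_n) : unit_ball x ->
  hyp_sqnorm x (hyp_grad f x - X) * vol_density x =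
  energy_weight x * \sum_j (partial j f x - conf x * X ord0 j) ^+ 2.
Proof.
move=> Bx; rewrite /hyp_sqnorm vol_densityE// enorm_sqr mulrAC mulrC [in LHS]mulr_suml.
rewrite [in RHS]mulr_sumr; apply: eq_bigr => j _; rewrite !mxE conf_inv conf_factorE.
rewrite /energy_weight /volume_weight /conf_factor.
by field; exact: half_gap_neq0.
Qed.

Definition represents F v := forall x, Omega x -> F None x = v x.

(** The Euclidean derivatives are recovered from the hyperbolic gradient through the
    factor q^2; as the weights are bounded below, hyperbolic convergence of the
    test functions implies Euclidean convergence. *)
Lemma H10_sobolev v : H10 Omega v -> exists2 F, H F & represents F v.
Proof.
move=> [X [phi [mv mX tphi cv cX]]].
pose g o := if o is Some i then fun x => conf x * X x ord0 i else v.
pose F : W := fun o => toL2 mu (onO (g o)).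
pose I1 m := hyp_integral Omega (fun x => (phi m x - v x) ^+ 2).
pose I2 m := hyp_integral Omega (fun x => hyp_sqnorm x (hyp_grad (phi m) x - X x)).
have [w0 /andP[w00 w01] hw0] := energy_weight_lower.
have mconf : measurable_fun Omega (@conf R n).
  rewrite (_ : @conf R n = fun x => conf_factor x ^+ 2); last first.
    by apply/funext => x; exact: conf_factorE.
  exact: weight_measurable (C1_ball_weight hOmega (C1_ballX 2 (@conf_factor_C1 R n))).
have mXi i : measurable_fun Omega (fun x => X x ord0 i).
  exact: measurableT_comp (measurable_coord i) mX.
have mg o : measurable_fun Omega (g o).
  by case: o => [i|] //=; exact: measurable_funM.
have mtest f : test f -> measurable_fun Omega f.
  move=> tf; apply: measurable_funTS; apply: continuous_measurable_rV.
  exact: smooth_continuous tf.1.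
have close m (e : R) : (I1 m < e%:E)%E ->
    (I2 m < e%:E)%E ->
    forall o, square_integrable mu (onO (g o)) /\
      ip (F o - test_jet (phi m) o) (F o - test_jet (phi m) o) <= e / w0.
  move=> e1 e2 o; have tp := test_jet_test o (tphi m).
  pose h x := if o is Some i
    then energy_weight x * \sum_j (partial j (phi m) x - conf x * X x ord0 j) ^+ 2
    else (phi m x - v x) ^+ 2 * volume_weight x.
  apply: (@L2_of_close _ _ h) => //.
  - exact: (test_L2 hOmega).
  - by move=> x nOx; exact: test_function_out tp nOx.
  - rewrite /h; case: o {h tp} => [i|].
      apply: measurable_funM; first exact: weight_measurable weight_energy.
      apply: measurable_sum => j; apply: measurable_funX; apply: measurable_funB.
        by apply: mtest; exact: test_function_partial.
      exact: measurable_funM.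
    apply: measurable_funM; last exact: weight_measurable weight_volume.
    by apply: measurable_funX; apply: measurable_funB => //; exact: mtest.
  - move=> x Ox; rewrite /h; case: o {h tp} => [i|] /=.
      apply: ler_pM; [exact: ltW|exact: sqr_ge0|exact: hw0|].
      by rewrite (bigD1 i)//= lerDl sumr_ge0// => j _; exact: sqr_ge0.
    rewrite mulrC ler_wpM2l ?sqr_ge0// (le_trans w01)//.
    exact/volume_weight_ge1/OB.
  - rewrite /h; case: o {h tp} => [i|].
      apply: le_lt_trans e2; rewrite le_eqVlt; apply/orP; left; apply/eqP.
      by apply: eq_integral => x /set_mem Ox; rewrite hyp_sqnorm_energy//; exact: OB.
    apply: le_lt_trans e1; rewrite le_eqVlt; apply/orP; left; apply/eqP.
    by apply: eq_integral => x /set_mem Ox; rewrite vol_densityE//; exact: OB.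
have pick (e : R) : 0 < e -> exists m, (I1 m < e%:E)%E /\
    (I2 m < e%:E)%E.
  move=> e0.
  have /fine_cvgP[f1 /cvgrPdist_lt/(_ e e0) g1] := cv.
  have /fine_cvgP[f2 /cvgrPdist_lt/(_ e e0) g2] := cX.
  have [m [[h1 h2] [h3 h4]]] := filter_ex (filterI (filterI f1 g1) (filterI f2 g2)).
  exists m; split.
    rewrite /I1 -(fineK h1) lte_fin; apply: le_lt_trans h2.
    by rewrite sub0r normrN ler_norm.
  rewrite /I2 -(fineK h3) lte_fin; apply: le_lt_trans h4.
  by rewrite sub0r normrN ler_norm.
have sg o : square_integrable mu (onO (g o)).
  by have [m [h1 h2]] := pick 1 ltr01; have [] := close m 1 h1 h2 o.
exists F; last by move=> x Ox; rewrite /F toL2E// on_domain_in.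
move=> e e0; pose d := e * w0 / (2 * #|{: option 'I_n}|%:R).
have N0 : (0 : R) < #|{: option 'I_n}|%:R by rewrite ltr0n card_option.
have d0 : 0 < d by rewrite divr_gt0 ?mulr_gt0.
have [m [h1 h2]] := pick d d0; exists (phi m) => //.
apply: (@le_lt_trans _ _ (\sum_(o : option 'I_n) d / w0)).
  by apply: ler_sum => o _; have [] := close m d h1 h2 o.
rewrite sumr_const -mulr_natr.
have -> : d / w0 * #|{: option 'I_n}|%:R = e / 2.
  by rewrite /d; field; rewrite !gt_eqF.
by rewrite ltr_pdivrMr// ltr_pMr// ltr1n.
Qed.

End dirichlet_forms.

(** * Weak eigenfunctions *)

Section eigenvalue_problem.
Variables (R : realType) (n : nat) (Omega : set 'rV[R]_n).
Hypothesis hOmega : bounded_domain Omega.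
Local Notation mu := (lebesgue_rV R n).
Local Notation L2 := (L2fun mu).
Local Notation W := (option 'I_n -> L2).
Local Notation test := (test_function Omega).
Local Notation onO := (on_domain Omega).
Local Notation H := (sobolev0 Omega).
Local Notation mass := (@mass R n Omega).
Local Notation energy := (@energy R n Omega).
Implicit Types (F G : W) (o : option 'I_n).

Let OB x : Omega x -> unit_ball x.
Proof. by case: hOmega => _ _ _ OB _; exact: OB. Qed.

Lemma hyp_integralE f g : mu.-integrable setT (EFin \o g) ->
  (forall x, Omega x -> f x * vol_density x = g x) ->
  (forall x, ~ Omega x -> g x = 0) ->
  hyp_integral Omega f = (\int[mu]_x g x)%:E.
Proof.
move=> ig fg g0; rewrite /Rintegral fineK; last exact: integrable_fin_num.
rewrite /hyp_integral [LHS]integral_mkcond; apply: eq_integral => x _.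
rewrite restrict_EFin -on_domainE /=; have [Ox|nOx] := pselect (Omega x).
  by rewrite on_domain_in// fg.
by rewrite on_domain_out// g0.
Qed.

Lemma hyp_RintegralE f g : mu.-integrable setT (EFin \o g) ->
  (forall x, Omega x -> f x * vol_density x = g x) ->
  (forall x, ~ Omega x -> g x = 0) ->
  hyp_Rintegral Omega f = \int[mu]_x g x.
Proof. by move=> ig fg g0; rewrite /hyp_Rintegral (hyp_integralE ig). Qed.

Lemma hyp_Rintegral_wip f c (u v : L2) : weight (onO c) ->
  (forall x, Omega x -> f x * volume_weight x = c x * u x * v x) ->
  hyp_Rintegral Omega f = wip (onO c) u v.
Proof.
move=> wc e; apply: (@hyp_RintegralE _ (fun x => onO c x * u x * v x)) => /=.
  exact: wip_integrable.
  by move=> x Ox; rewrite (vol_densityE (OB Ox)) on_domain_in// e.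
by move=> x nOx; rewrite on_domain_out// !mul0r.
Qed.

(** The weights are bounded above, so that Euclidean convergence implies hyperbolic
    convergence; the hyperbolic gradient is s^2 times the Euclidean one. *)
Lemma sobolev_H10 F : H F -> H10 Omega (F None).
Proof.
move=> hF; have [phi tphi cphi] := sobolev0_seq hF.
have [C C0 hC] := mass_energy_le_sob hOmega.
pose D m := test_jet (phi m) - F.
have DE m o x : D m o x = jet o (phi m) x - F o x.
  by rewrite -(test_jetE hOmega).
exists (fun x => \row_i (half_gap x ^+ 2 * F (Some i) x)), phi; split => //.
- by apply: measurable_funTS; exact: (L2P (F None)).1.
- apply: measurable_funTS; apply: measurable_fun_rV => i.
  under eq_fun do rewrite mxE; apply: measurable_funM; last exact: (L2P (F (Some i))).1.
  apply: measurable_funX; apply: continuous_measurable_rV.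
  exact: (smooth_continuous (@smooth_half_gap R n)).
- have -> : (fun m => hyp_integral Omega (fun x => (phi m x - F None x) ^+ 2)) =
      (fun m => (mass (D m) (D m))%:E).
    apply/funext => m.
    apply: (@hyp_integralE _ (fun x => onO (@volume_weight R n) x * D m None x * D m None x)).
    + exact: (wip_integrable _ _ (weight_volume hOmega)).
    + by move=> x Ox; rewrite (vol_densityE (OB Ox)) on_domain_in// !DE/=; ring.
    + by move=> x nOx; rewrite on_domain_out// !mul0r.
  apply: cvg_EFin; first exact: nearW.
  apply: (squeeze_cvgr _ (cvg_cst 0) (_ : (fun m => C * sob_ip (D m) (D m)) m @[m --> \oo] --> 0)).
    by apply: nearW => m; rewrite (form_ge0 (mass_psd hOmega))/=; exact: (hC _).1.
  by rewrite -(mulr0 C); apply: cvgMl_tmp.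
- have -> : (fun m => hyp_integral Omega (fun x => hyp_sqnorm x (hyp_grad (phi m) x -
      \row_i (half_gap x ^+ 2 * F (Some i) x)))) = (fun m => (energy (D m) (D m))%:E).
    apply/funext => m; rewrite /energy /wip -Rintegral_fsum; last first.
      by move=> i; exact: (wip_integrable _ _ (weight_energy hOmega)).
    apply: (@hyp_integralE _ (fun x => \sum_i onO (@energy_weight R n) x * D m (Some i) x * D m (Some i) x)).
    + have := @integrable_sum _ _ _ mu _ measurableT _ (index_enum 'I_n) predT _
        (fun i _ => wip_integrable (D m (Some i)) (D m (Some i)) (weight_energy hOmega)).
      by apply: eq_integrable => // x _; rewrite /= -sumEFin.
    + move=> x Ox; rewrite (hyp_sqnorm_energy _ _ (OB Ox)) mulr_sumr; apply: eq_bigr => i _.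
      rewrite on_domain_in// !DE/= mxE conf_factorE mulrA -exprMn.
      by rewrite (conf_factor_half_gap (OB Ox)) expr1n; ring.
    + by move=> x nOx; rewrite big1// => i _; rewrite on_domain_out// !mul0r.
  apply: cvg_EFin; first exact: nearW.
  apply: (squeeze_cvgr _ (cvg_cst 0) (_ : (fun m => C * sob_ip (D m) (D m)) m @[m --> \oo] --> 0)).
    by apply: nearW => m; rewrite (form_ge0 (energy_psd hOmega))/=; exact: (hC _).2.
  by rewrite -(mulr0 C); apply: cvgMl_tmp.
Qed.

(** In coordinates the Laplacian is q^-n times the divergence of a grad f, and the
    factor q^-n cancels the volume density; integrate by parts once. *)
Lemma weak_laplacian f F v : test f -> H F -> represents Omega F v ->
  hyp_Rintegral Omega (fun x => v x * hyp_laplacian f x) = - energy F (test_jet f).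
Proof.
move=> tf hF Fv; have tdf i := test_function_partial i tf.
have kE i : (fun y => vol_density y * hyp_grad f y ord0 i) =
    (fun y => energy_weight y * partial i f y).
  apply/funext => y; rewrite mxE conf_inv; have [By|nBy] := pselect (unit_ball y).
    by rewrite vol_densityE// /energy_weight /volume_weight mulrA.
  by rewrite (test_function_out (tdf i)) ?mulr0// => /OB.
pose da i (x : 'rV[R]_n) : R := (n%:R - 2) * (conf_factor x ^+ n * half_gap x) * x ord0 i.
have aC1 := @energy_weight_C1 R n.
have wda i := C1_ball_dweight hOmega i aC1.
have wa := weight_energy hOmega.
have dk i x : unit_ball x -> partial i (fun y => vol_density y * hyp_grad f y ord0 i) x =
    da i x * partial i f x + energy_weight x * partial i (partial i f) x.
  move=> Bx; rewrite kE; have [_ _ d] := aC1 x Bx.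
  exact: (derive_val (is_derive := is_derive_mul (d i) (smooth_is_derive i x (tdf i).1))).
pose t1 i := wip (onO (da i)) (F None) (test_jet f (Some i)).
pose t2 i := wip (onO (@energy_weight R n)) (F None) (test_jet (partial i f) (Some i)).
have -> : hyp_Rintegral Omega (fun x => v x * hyp_laplacian f x) = \sum_i (t1 i + t2 i).
  pose g i x := onO (da i) x * F None x * test_jet f (Some i) x +
    onO (@energy_weight R n) x * F None x * test_jet (partial i f) (Some i) x.
  have ig i : mu.-integrable setT (EFin \o g i).
    by apply: integrable_addR; [exact: (wip_integrable _ _ (wda i))|exact: (wip_integrable _ _ wa)].
  rewrite (hyp_RintegralE (g := fun x => \sum_i g i x)).
  - rewrite Rintegral_fsum//; apply: eq_bigr => i _.
    by rewrite RintegralD//; [exact: (wip_integrable _ _ (wda i))|exact: (wip_integrable _ _ wa)].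
  - have := @integrable_sum _ _ _ mu _ measurableT _ (index_enum 'I_n) predT _ (fun i _ => ig i).
    by apply: eq_integrable => // x _; rewrite /= -sumEFin.
  - move=> x Ox; have Bx := OB Ox; rewrite /hyp_laplacian /hyp_div.
    have v0 : vol_density x != 0.
      rewrite vol_densityE// gt_eqF// (lt_le_trans ltr01)//; exact: volume_weight_ge1.
    rewrite -!mulrA (mulrC _ (vol_density x)) mulKf// mulr_sumr.
    apply: eq_bigr => i _; rewrite dk// /g !on_domain_in//.
    by rewrite !(test_jetE hOmega)//= Fv//; ring.
  - by move=> x nOx; rewrite big1// => i _; rewrite /g !on_domain_out// !mul0r addr0.
rewrite /energy -sumrN; apply: eq_bigr => i _.
have jetE : test_jet (partial i f) None = test_jet f (Some i) by [].
have := sobolev0_by_parts hOmega i aC1 hF (sobolev0_test (tdf i)); rewrite jetE.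
rewrite -[X in wip X (F None) (test_jet f (Some i))]/(onO (da i)) -/(t1 i) -/(t2 i) => e.
apply/eqP; rewrite -subr_eq0 opprK (addrC (t1 i)) addrAC; exact/eqP.
Qed.

Lemma weak_mass f F v : test f -> H F -> represents Omega F v ->
  hyp_Rintegral Omega (fun x => v x * f x) = mass F (test_jet f).
Proof.
move=> tf hF Fv; apply: hyp_Rintegral_wip; first exact: weight_volume.
by move=> x Ox; rewrite (test_jetE hOmega)//= Fv//; ring.
Qed.

Definition weak_eigenfunction la F :=
  H F /\ forall G, H G -> energy F G = la * mass F G.

Lemma bounded_functional_energy F la :
  bounded_functional (fun G => energy F G + - (la * mass F G)).
Proof.
apply: bounded_functionalD.
  apply: bounded_functional_sum => i; apply: bounded_functional_wipr.
  exact: weight_energy.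
apply: bounded_functionalN.
have [h [C hC]] : bounded_functional (fun G => mass F G).
  by apply: bounded_functional_wipr; exact: weight_volume.
split; first by move=> c G G'; rewrite h; ring.
by exists (la ^+ 2 * C) => G; rewrite exprMn -mulrA ler_wpM2l ?sqr_ge0.
Qed.

Lemma weak_eigenfunction_test la F : H F ->
  (forall f, test f -> energy F (test_jet f) = la * mass F (test_jet f)) ->
  weak_eigenfunction la F.
Proof.
move=> hF e; split => // G hG; apply/eqP; rewrite -subr_eq0; apply/eqP; move: G hG.
apply: bounded_functional_dense; first exact: bounded_functional_energy.
by move=> f tf; rewrite e// subrr.
Qed.

(** The equation in the sense of distributions is the weak equation tested on test
    functions, and these are dense. *)
Lemma dirichlet_weak la v : dirichlet_eigenspace Omega la v ->
  exists2 F, weak_eigenfunction la F & represents Omega F v.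
Proof.
move=> [/(H10_sobolev hOmega)[F hF Fv] e]; exists F => //.
apply: weak_eigenfunction_test => // f tf.
have := e f tf; rewrite (weak_laplacian tf hF Fv) (weak_mass tf hF Fv).
by rewrite mulNr => /oppr_inj.
Qed.

Lemma weak_dirichlet la F : weak_eigenfunction la F ->
  dirichlet_eigenspace Omega la (F None).
Proof.
move=> [hF e]; split; first exact: sobolev_H10.
have Fv : represents Omega F (F None) by [].
move=> f tf; rewrite (weak_laplacian tf hF Fv) (weak_mass tf hF Fv).
by rewrite (e _ (sobolev0_test tf)) mulNr.
Qed.

End eigenvalue_problem.

(** * The Rayleigh principle *)

Section variational.
Variables (R : realType) (n : nat) (Omega : set 'rV[R]_n).
Hypothesis hOmega : bounded_domain Omega.
Local Notation mu := (lebesgue_rV R n).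
Local Notation L2 := (L2fun mu).
Local Notation W := (option 'I_n -> L2).
Local Notation H := (sobolev0 Omega).
Local Notation mass := (@mass R n Omega).
Local Notation energy := (@energy R n Omega).
Implicit Types (F G : W).

Let mP := mass_psd hOmega.
Let eP := energy_psd hOmega.

Lemma exists_left_kernel (F : fieldType) d (A : 'M[F]_(d.+1, d)) :
  exists2 a : 'rV[F]_d.+1, a != 0 & a *m A = 0.
Proof.
exists (nz_row (kermx A)); last by apply/sub_kermxP; exact: nz_row_sub.
by rewrite nz_row_eq0 kermx_eq0 /row_free neq_ltn ltnS rank_leq_col.
Qed.

(** Functions of a d-dimensional space satisfy, as soon as there are d + 1 of them,
    a nontrivial linear relation almost everywhere; this relation has mass zero,
    which orthonormality forbids. *)
Lemma orthonormal_le_dimension (E : ('rV[R]_n -> R) -> Prop) d (e : 'I_d.+1 -> W) :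
  has_dimension Omega E d -> (forall t, E (e t None)) ->
  (forall t t', mass (e t) (e t') = (t == t')%:R) -> False.
Proof.
move=> [w [_ _ span]] Ee ortho.
have /choice[c hc] := fun t => span _ (Ee t).
have [a a0 aA] := exists_left_kernel (\matrix_(t, l) c t l).
pose Z := \sum_t a ord0 t *: e t.
have mZ : mass Z Z = \sum_t a ord0 t ^+ 2.
  rewrite /Z (form_suml mP); apply: eq_bigr => t _; rewrite (formZl mP) (form_sumr mP).
  rewrite (bigD1 t)//= big1 ?addr0.
    by rewrite (formZr mP) ortho eqxx mulr1 expr2.
  by move=> t' tt'; rewrite (formZr mP) ortho eq_sym (negbTE tt') mulr0.
have Zx x : Z None x = \sum_t a ord0 t * e t None x.
  rewrite /Z; elim: (index_enum _) => [|t r IH]; first by rewrite !big_nil.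
  by rewrite !big_cons -IH.
have Z0 : ae_eq_on Omega (Z None) (fun=> 0).
  have : {ae mu, forall x, forall t : 'I_d.+1, Omega x -> e t None x = \sum_i c t i * w i x}.
    by apply: filter_forall => t; exact: hc.
  apply: filterS => x hx Ox; rewrite Zx.
  under eq_bigr do rewrite hx// mulr_sumr.
  rewrite exchange_big/= big1// => l _.
  under eq_bigr do rewrite mulrA; rewrite -mulr_suml.
  have /matrixP/(_ ord0 l) := aA; rewrite !mxE.
  by under eq_bigr do rewrite mxE; move=> ->; rewrite mul0r.
have : mass Z Z = 0.
  rewrite /mass /wip /Rintegral (@ae_eq_integral _ _ _ mu setT (cst 0%E))//.
  - by rewrite integral0.
  - exact: (measurable_int _ (wip_integrable (Z None) (Z None) (weight_volume hOmega))).
  - apply: filterS Z0 => x hx _ /=; have [Ox|nOx] := pselect (Omega x).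
      by rewrite hx// mulr0.
    by rewrite on_domain_out// !mul0r.
rewrite mZ => /eqP; rewrite psumr_eq0; last by move=> t _; exact: sqr_ge0.
move=> /allP h; case/eqP: a0; apply/rowP => t; rewrite mxE.
by have := h t (mem_index_enum t); rewrite /= sqrf_eq0 => /eqP.
Qed.

Lemma sob_le_mass_energy : exists2 K : R, 0 < K &
  forall F, H F -> sob_ip F F <= K * (mass F F + energy F F).
Proof.
have [c c0 hc] := energy_coercive hOmega; exists (1 + c^-1).
  by rewrite addr_gt0// invr_gt0.
move=> F hF; rewrite sob_ip_split.
have h1 := ip_le_mass hOmega hF; have h2 := hc F hF.
have m0 := form_ge0 mP F; have e0 := form_ge0 eP F.
rewrite mulrDr; apply: lerD.
  by apply: (le_trans h1); rewrite mulrDl mul1r lerDl mulr_ge0// invr_ge0 ltW.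
apply: (@le_trans _ _ (c^-1 * energy F F)).
  by rewrite ler_pdivlMl.
by rewrite mulrDl mul1r lerDr.
Qed.

(** The compactness hypothesis of [Rayleigh_quotient_attained]. *)
Lemma mass_compact (e : R) : 0 < e -> exists (M : nat) (l : 'I_M -> W -> R) (C : R),
  [/\ 0 <= C, forall j f g, l j (f - g) = l j f - l j g,
      forall j f, H f -> l j f ^+ 2 <= C * mass f f
    & forall f, H f -> mass f f <= e * energy f f + C * \sum_j l j f ^+ 2].
Proof.
move=> e0; have [c c0 hc] := energy_coercive hOmega.
have [C1 C10 h1] := wip_le_ip (weight_volume hOmega).
pose C1' := C1 + 1; have C1'0 : 0 < C1' by rewrite ltr_wpDl.
have d0 : 0 < e * c / C1' by rewrite divr_gt0// mulr_gt0.
have [J [q [C [C0 hJ]]]] := sobolev0_mean_control hOmega d0.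
have ipP := ip_psd mu.
have q0 j : 0 <= ip (q j) (q j) by exact: (form_ge0 ipP).
exists #|J|, (fun j F => ip (F None) (q (enum_val j))), (C1' * C + \sum_j ip (q j) (q j)); split.
- by rewrite addr_ge0 ?sumr_ge0// mulr_ge0// ltW.
- by move=> j f g; rewrite (formDl ipP) (formNl ipP).
- move=> j f hf; apply: (le_trans (form_CauchySchwarz ipP _ _)).
  rewrite mulrC; apply: ler_pM => //; first exact: (form_ge0 ipP).
    apply: (@le_trans _ _ (\sum_j ip (q j) (q j))).
      by rewrite (bigD1 (enum_val j))//= lerDl sumr_ge0.
    by rewrite lerDr; apply: mulr_ge0 => //; exact: ltW.
  exact: ip_le_mass.
move=> F hF; have hm : mass F F <= C1' * ip (F None) (F None).
  apply: (le_trans (h1 _)); rewrite ler_wpM2r ?(form_ge0 ipP)//.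
  by rewrite lerDl.
apply: (le_trans hm); apply: (le_trans (ler_wpM2l (ltW C1'0) (hJ F hF))).
rewrite mulrDr; apply: lerD.
  rewrite (_ : C1' * _ = e * (c * \sum_i ip (F (Some i)) (F (Some i)))); last first.
    by field; rewrite gt_eqF.
  by rewrite (ler_wpM2l (ltW e0))//; exact: hc.
rewrite mulrA (reindex_onto (@enum_val J predT) (@enum_rank J))/=; last first.
  by move=> j _; rewrite enum_rankK.
under eq_bigl do rewrite enum_valK eqxx.
by rewrite ler_wpM2r ?lerDl ?sumr_ge0// => j _; exact: sqr_ge0.
Qed.

Variables (lam : nat -> R) (U : nat -> W).
Hypotheses (hlam : lists_dirichlet_eigenvalues Omega lam)
  (hlamS : forall i, lam i <= lam i.+1)
  (hU : forall i, weak_eigenfunction Omega (lam i) (U i))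
  (orthoU : forall i j, mass (U i) (U j) = (i == j)%:R).

Lemma lam_le i j : (i <= j)%N -> lam i <= lam j.
Proof.
move=> /subnK <-; elim: (j - i)%N => // m IH.
by rewrite addSn; apply: le_trans IH _.
Qed.

(** Otherwise minimize the Rayleigh quotient among the functions orthogonal to the
    first k eigenfunctions. The minimizer v has an eigenvalue la < lam k, and v
    together with the eigenfunctions listed for la forms an orthonormal family too
    large for the eigenspace. *)
Lemma Rayleigh_principle k F : H F -> (forall j, (j < k)%N -> mass F (U j) = 0) ->
  lam k * mass F F <= energy F F.
Proof.
move=> hF oF; rewrite leNgt; apply/negP => lt.
pose H' F := H F /\ forall j, (j < k)%N -> mass F (U j) = 0.
have H'lin c f g : H' f -> H' g -> H' (c *: f + g).
  move=> [hf of_] [hg og]; split; first exact (sobolev0_lin hOmega c hf hg).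
  by move=> j jk; rewrite (form_linear mP) of_// og// mulr0 addr0.
have H'compl (f : nat -> W) : (forall m, H' (f m)) ->
    (forall e : R, 0 < e -> exists M, forall m l, (M <= m)%N -> (M <= l)%N ->
      mass (f m - f l) (f m - f l) + energy (f m - f l) (f m - f l) < e) ->
    exists2 v, H' v & mass (f m - v) (f m - v) + energy (f m - v) (f m - v) @[m --> \oo] --> 0.
  move=> hf cauchy; have [K K0 hK] := sob_le_mass_energy.
  have hHf m : H (f m) by case: (hf m).
  have [|v hv cv] := sobolev0_complete hHf.
    move=> e e0; have [|M MP] := cauchy (e / K); first by rewrite divr_gt0.
    exists M => m l Mm Ml.
    have hd : H (f m - f l).
      by rewrite -scaleN1r addrC; exact (sobolev0_lin hOmega (-1) (hHf l) (hHf m)).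
    by apply: (le_lt_trans (hK _ hd)); rewrite mulrC -ltr_pdivlMr//; exact: MP.
  have [C C0 hC] := mass_energy_le_sob hOmega.
  have cm : mass (f m - v) (f m - v) @[m --> \oo] --> 0.
    apply: (squeeze_cvgr _ (cvg_cst 0) (_ : (fun m => C * sob_ip (f m - v) (f m - v)) m @[m --> \oo] --> 0)).
      by apply: nearW => m; rewrite (form_ge0 mP)/=; exact: (hC _).1.
    by rewrite -(mulr0 C); apply: cvgMl_tmp.
  have ce : energy (f m - v) (f m - v) @[m --> \oo] --> 0.
    apply: (squeeze_cvgr _ (cvg_cst 0) (_ : (fun m => C * sob_ip (f m - v) (f m - v)) m @[m --> \oo] --> 0)).
      by apply: nearW => m; rewrite (form_ge0 eP)/=; exact: (hC _).2.
    by rewrite -(mulr0 C); apply: cvgMl_tmp.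
  exists v; last by rewrite -[X in _ --> X]addr0; exact: cvgD.
  split => // j jk; have h := form_cvgl (h := U j) mP cm.
  apply: (@cvg_unique R _ (mass (f m) (U j) @[m --> \oo])) h _; first exact: norm_hausdorff.
  rewrite (_ : (fun m => mass (f m) (U j)) = (fun=> 0)); first exact: cvg_cst.
  by apply/funext => m; case: (hf m) => _ ->.
have H'cpt (e : R) : 0 < e -> exists (M : nat) (l : 'I_M -> W -> R) (C : R),
    [/\ 0 <= C, forall j f g, l j (f - g) = l j f - l j g,
      forall j f, H' f -> l j f ^+ 2 <= C * mass f f
    & forall f, H' f -> mass f f <= e * energy f f + C * \sum_j l j f ^+ 2].
  move=> e0; have [M [l [C [C0 h1 h2 h3]]]] := mass_compact e0.
  exists M, l, C; split => // [j f [hf _]|f [hf _]]; [exact: h2|exact: h3].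
have [v [la [[hv ov] lak mv ev]]] :=
  Rayleigh_quotient_attained mP eP H'lin H'compl H'cpt (conj hF oF : H' F) lt.
(* The equation holds against admissible functions; a general G is corrected by
   its projection on the first k eigenfunctions, to which v is orthogonal for
   both forms. *)
have wv : weak_eigenfunction Omega la v.
  split => // G hG; pose P := \sum_(j < k) (- mass G (U j)) *: U j.
  have hP : H P.
    exact: (sobolev0_sum hOmega (index_enum 'I_k) (fun j => - mass G (U j)) (fun j : 'I_k => (hU j).1)).
  have vU j : (j < k)%N -> energy v (U j) = 0.
    by move=> jk; rewrite (form_sym eP) (hU j).2// (form_sym mP) ov// mulr0.
  have eP0 : energy v P = 0.
    rewrite (form_sumr eP) big1// => j _; by rewrite (formZr eP) vU ?mulr0.
  have mP0 : mass v P = 0.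
    rewrite (form_sumr mP) big1// => j _; by rewrite (formZr mP) ov ?mulr0.
  have := ev (G + P); rewrite (formDr eP) (formDr mP) eP0 mP0 !addr0; apply.
  split; first by rewrite -[G]scale1r; exact (sobolev0_lin hOmega 1 hG hP).
  move=> j jk; rewrite (formDl mP) (form_suml mP) (bigD1 (Ordinal jk))//= big1 ?addr0.
    by rewrite (formZl mP) orthoU eqxx mulr1 subrr.
  by move=> i ij; rewrite (formZl mP) orthoU (negbTE (_ : _ != j :> nat)) ?mulr0.
have [s [us sP dimE]] := hlam la.
(* the eigenfunctions listed for la, followed by v *)
pose e (t : 'I_(size s).+1) : W := if unlift ord_max t is Some t' then U (nth 0%N s t') else v.
have sk i : i \in s -> (i < k)%N.
  by rewrite sP => /eqP li; rewrite ltnNge; apply/negP => /lam_le; rewrite li leNgt lak.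
apply: (orthonormal_le_dimension (e := e) dimE) => [t|t t'].
  rewrite /e; case: unliftP => [t' _|_]; last exact: weak_dirichlet.
  have /eqP <- : lam (nth 0%N s t') == la by rewrite -sP mem_nth.
  exact: weak_dirichlet.
rewrite /e; case: (unliftP ord_max t) => [i ->|->]; case: (unliftP ord_max t') => [j ->|->].
- by rewrite orthoU (inj_eq lift_inj) nth_uniq.
- rewrite (form_sym mP) ov; last by apply: sk; exact: mem_nth.
  by rewrite eq_sym (negbTE (neq_lift _ _)).
- rewrite ov; last by apply: sk; exact: mem_nth.
  by rewrite (negbTE (neq_lift _ _)).
- by rewrite mv eqxx.
Qed.

End variational.

(** * Commutators with the coordinates *)

Section weighted_integrals.
Variables (R : realType) (n : nat) (Omega : set 'rV[R]_n).
Hypothesis hOmega : bounded_domain Omega.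
Local Notation mu := (lebesgue_rV R n).
Local Notation L2 := (L2fun mu).
Local Notation onO := (on_domain Omega).
Implicit Types (c : 'rV[R]_n -> R) (u v : L2).

Lemma wip_on_eq c c' u v u' v' :
  (forall x, Omega x -> c x * u x * v x = c' x * u' x * v' x) ->
  wip (onO c) u v = wip (onO c') u' v'.
Proof.
move=> e; apply: eq_Rintegral => x _; have [Ox|nOx] := pselect (Omega x).
  by rewrite !on_domain_in// e.
by rewrite !on_domain_out// !mul0r.
Qed.

Lemma weight_smoothM c h : weight (onO c) -> smooth h ->
  weight (onO (fun x => c x * h x)).
Proof.
move=> wc sh; have -> : onO (fun x => c x * h x) = (fun x => onO c x * onO h x).
  apply/funext => x; have [Ox|nOx] := pselect (Omega x).
    by rewrite !on_domain_in.
  by rewrite !on_domain_out// mul0r.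
by apply: weightM => //; exact: (smooth_weight hOmega sh).
Qed.

Lemma wip_on_lin k c1 c2 u v : weight (onO c1) -> weight (onO c2) ->
  wip (onO (fun x => k * c1 x + c2 x)) u v = k * wip (onO c1) u v + wip (onO c2) u v.
Proof.
move=> w1 w2; rewrite -wip_linear_weight//; congr (wip _ u v); apply/funext => x.
by rewrite /on_domain; ring.
Qed.

Lemma wip_on_scale k c u v : weight (onO c) ->
  wip (onO (fun x => k * c x)) u v = k * wip (onO c) u v.
Proof.
move=> wc; rewrite -wipZ//; congr (wip _ u v); apply/funext => x.
by rewrite /on_domain; ring.
Qed.

Lemma wip_on_sum (I : Type) (r : seq I) (c : I -> 'rV[R]_n -> R) u v :
  (forall i, weight (onO (c i))) ->
  wip (onO (fun x => \sum_(i <- r) c i x)) u v = \sum_(i <- r) wip (onO (c i)) u v.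
Proof.
move=> wc; rewrite /wip -Rintegral_fsum; last by move=> i; exact: wip_integrable.
apply: eq_Rintegral => x _; rewrite -!mulr_suml; congr (_ * _ * _).
by rewrite /on_domain mulr_sumr.
Qed.

End weighted_integrals.

Section universal_inequality.
Variables (R : realType) (n : nat) (Omega : set 'rV[R]_n).
Hypothesis hOmega : bounded_domain Omega.
Local Notation mu := (lebesgue_rV R n).
Local Notation L2 := (L2fun mu).
Local Notation W := (option 'I_n -> L2).
Local Notation H := (sobolev0 Omega).
Local Notation onO := (on_domain Omega).
Local Notation mass := (@mass R n Omega).
Local Notation energy := (@energy R n Omega).
Local Notation q := (@conf_factor R n).
Local Notation s := (@half_gap R n).
Implicit Types (F G : W).

Let mP := mass_psd hOmega.
Let eP := energy_psd hOmega.
Let B := wip (mu := mu) (onO (@volume_weight R n)).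
Let BP : psd_form B.
Proof.
apply: wip_psd; first exact: weight_volume.
by move=> x; apply: on_domain_ge0; exact: volume_weight_ge0.
Qed.

Section one_direction.
Variable p : 'I_n.
Let xp (x : 'rV[R]_n) : R := x ord0 p.
Let sxp : smooth xp := @smooth_coord R n p.
Let mulx := @sob_mul R n Omega xp.

Let mulxN F x : Omega x -> mulx F None x = xp x * F None x.
Proof.
move=> Ox; rewrite /mulx sob_mulN wmulE ?on_domain_in//.
exact: (smooth_weight hOmega sxp).
Qed.

Let mulxS F l x : Omega x ->
  mulx F (Some l) x = xp x * F (Some l) x + (l == p)%:R * F None x.
Proof.
move=> Ox; rewrite /mulx sob_mulS L2D !wmulE.
- by rewrite !on_domain_in// partial_coord.
- exact: (smooth_weight hOmega (smooth_partial _ sxp)).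
- exact: (smooth_weight hOmega sxp).
Qed.

(** The function 2 <grad x_p, grad u> + u Delta x_p = Delta (x_p u) - x_p Delta u. *)
Definition commutator F : L2 := wmul (onO (fun x => 2 * s x ^+ 2)) (F (Some p)) +
  wmul (onO (fun x => (n%:R - 2) * s x * x ord0 p)) (F None).

Lemma weight_commutator1 : weight (onO (fun x => 2 * s x ^+ 2)).
Proof.
apply: (smooth_weight hOmega); apply: smoothZ.
exact: (smoothM (@smooth_half_gap R n) (@smooth_half_gap R n)).
Qed.

Lemma weight_commutator2 : weight (onO (fun x => (n%:R - 2) * s x * x ord0 p)).
Proof.
apply: (smooth_weight hOmega); apply: smoothM => //.
exact: (smoothZ _ (@smooth_half_gap R n)).
Qed.

Lemma commutatorE F x : Omega x -> commutator F x =
  2 * s x ^+ 2 * F (Some p) x + (n%:R - 2) * s x * x ord0 p * F None x.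
Proof.
move=> Ox; rewrite L2D !wmulE ?on_domain_in//.
  exact: weight_commutator2.
exact: weight_commutator1.
Qed.

Let da x := (n%:R - 2) * (q x ^+ n * s x) * x ord0 p.
Let wa := weight_energy hOmega.
Let wda : weight (onO da) := C1_ball_dweight hOmega p (@energy_weight_C1 R n).

Lemma mass_commutator F v : B (commutator F) v =
  2 * wip (onO (@energy_weight R n)) (F (Some p)) v + wip (onO da) (F None) v.
Proof.
rewrite -wipZ// /B /wip -RintegralD//; last 2 first.
- apply: wip_integrable; apply: weightM => //; exact: weight_cst.
- exact: wip_integrable.
apply: eq_Rintegral => x _; have [Ox|nOx] := pselect (Omega x).
  by rewrite !on_domain_in// commutatorE// /volume_weight /energy_weight /da; ring.
by rewrite !on_domain_out//; ring.
Qed.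

Lemma mass_mulx F G : mass (mulx F) G = mass F (mulx G).
Proof. by apply: wip_on_eq => x Ox; rewrite !mulxN//; ring. Qed.

(** By the Leibniz rule the terms containing two derivatives cancel. *)
Lemma energy_mulx F G : energy (mulx F) G - energy F (mulx G) =
  wip (onO (@energy_weight R n)) (F None) (G (Some p)) -
  wip (onO (@energy_weight R n)) (F (Some p)) (G None).
Proof.
rewrite /energy -sumrB (bigD1 p)//= big1 ?addr0 => [|l lp].
  rewrite /wip -!RintegralB//; try exact: wip_integrable.
  apply: eq_Rintegral => x _; have [Ox|nOx] := pselect (Omega x).
    by rewrite !on_domain_in// !mulxS// eqxx/=; ring.
  by rewrite !on_domain_out//; ring.
apply/eqP; rewrite subr_eq0; apply/eqP; apply: wip_on_eq => x Ox.
by rewrite !mulxS// (negbTE lp)/= !mul0r !addr0; ring.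
Qed.

(** The weak form of - Delta (x_p u) = lambda x_p u - commutator u. *)
Lemma energy_commutator la F G : weak_eigenfunction Omega la F -> H G ->
  energy (mulx F) G = la * mass (mulx F) G - B (commutator F) (G None).
Proof.
move=> [hF eF] hG; have := energy_mulx F G.
rewrite (eF _ (sobolev0_mul hOmega sxp hG)) -mass_mulx => e.
have := sobolev0_by_parts hOmega p (@energy_weight_C1 R n) hF hG.
rewrite -[X in wip X (F None) (G None)]/(onO da) mass_commutator => e'.
move: e e'; set x1 := energy _ _; set x2 := la * _; set x3 := wip _ _ _.
set x4 := wip _ _ _; set x5 := wip _ _ _; lra.
Qed.

(** Up to a divergence, (2 <grad x_p, grad u> + u Delta x_p) x_p u is
    - |grad x_p|^2 u^2, and the gradient of x_p has squared norm s^2. *)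
Lemma commutator_mulx F : H F ->
  B (commutator F) (mulx F None) = - wip (onO (@energy_weight R n)) (F None) (F None).
Proof.
move=> hF; rewrite mass_commutator.
have c1 := @energy_coord_weight_C1 R n p; have wc := C1_ball_weight hOmega c1.
have wdap := weight_smoothM hOmega wda sxp.
have := sobolev0_by_parts hOmega p c1 hF hF.
have -> : wip (onO (@energy_weight R n)) (F (Some p)) (mulx F None) =
    wip (onO (fun x => energy_weight x * x ord0 p)) (F None) (F (Some p)).
  by apply: wip_on_eq => x Ox; rewrite mulxN// /xp; ring.
have -> : wip (onO da) (F None) (mulx F None) =
    wip (onO (fun x => da x * x ord0 p)) (F None) (F None).
  by apply: wip_on_eq => x Ox; rewrite mulxN// /xp; ring.
rewrite (wip_sym _ (F (Some p)) (F None)).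
have -> : wip (onO (fun x => (n%:R - 2) * (q x ^+ n * s x) * x ord0 p * x ord0 p +
    energy_weight x * (p == p)%:R)) (F None) (F None) =
    wip (onO (fun x => da x * x ord0 p)) (F None) (F None) +
    wip (onO (@energy_weight R n)) (F None) (F None).
  rewrite -[X in _ = X + _]mul1r -wip_on_lin//; apply: wip_on_eq => x Ox.
  by rewrite eqxx /da /=; ring.
set x1 := wip _ _ _; set x2 := wip _ _ _; set x3 := wip _ _ _; lra.
Qed.

Variables (lam : nat -> R) (U : nat -> W) (k : nat).
Hypotheses (hlam : lists_dirichlet_eigenvalues Omega lam)
  (hlamS : forall i, lam i <= lam i.+1)
  (hU : forall i, weak_eigenfunction Omega (lam i) (U i))
  (orthoU : forall i j, mass (U i) (U j) = (i == j)%:R).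

Let HU i : H (U i) := (hU i).1.

Lemma directional_inequality :
  \sum_(i < k) (lam k - lam i) ^+ 2 *
    wip (onO (@energy_weight R n)) (U i None) (U i None) <=
  \sum_(i < k) (lam k - lam i) * B (commutator (U i)) (commutator (U i)).
Proof.
pose u (i : 'I_k) := U i None; pose g (i : 'I_k) := mulx (U i) None.
pose P (i : 'I_k) := commutator (U i).
have Hx i : H (mulx (U i)) by exact: sobolev0_mul.
have gu (i j : 'I_k) : B (g i) (u j) = mass (mulx (U i)) (U j) by [].
have a_sym i j : B (g i) (u j) = B (g j) (u i).
  by rewrite !gu mass_mulx (form_sym mP).
apply: (@yang_inequality _ _ B BP k u g P (fun i => lam i) (lam k)) => //.
- by move=> i j; exact: orthoU.
- move=> i j; have := energy_commutator (hU i) (HU j).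
  rewrite (form_sym eP) (hU j).2; last exact: Hx.
  rewrite (form_sym mP) -gu -/(P i) -/(u j) => e.
  by move: e; set x1 := B _ _; set x2 := B _ _; lra.
- by move=> i; exact: commutator_mulx.
(* phi_i is admissible in the Rayleigh principle; it remains to express its energy. *)
- move=> i; pose Phi := mulx (U i) - \sum_j B (g i) (u j) *: U j.
  have hS : H (\sum_(j < k) B (g i) (u j) *: U j).
    exact: (sobolev0_sum hOmega (index_enum 'I_k) (fun j => B (g i) (u j)) (fun j : 'I_k => HU j)).
  have hPhi : H Phi.
    by rewrite /Phi -scaleN1r addrC; exact (sobolev0_lin hOmega (-1) hS (Hx i)).
  have PhiU j : (j < k)%N -> mass Phi (U j) = 0.
    move=> jk; rewrite /Phi (formDl mP) (formNl mP) (form_suml mP).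
    rewrite (bigD1 (Ordinal jk))//= big1 ?addr0.
      by rewrite (formZl mP) orthoU eqxx mulr1 gu subrr.
    by move=> l lj; rewrite (formZl mP) orthoU (negbTE (_ : _ != j :> nat)) ?mulr0.
  have PhiN : Phi None = g i - \sum_j B (g i) (u j) *: u j.
    rewrite /Phi /u; congr (_ - _); elim: (index_enum _) => [|l r IH].
      by rewrite !big_nil.
    by rewrite !big_cons -IH.
  rewrite -PhiN; have := Rayleigh_principle hOmega hlam hlamS hU orthoU hPhi PhiU.
  have S0 (Q : W -> W -> R) (hQ : psd_form Q) :
      (forall j : 'I_k, Q (U j) Phi = 0) -> Q Phi Phi = Q (mulx (U i)) Phi.
    move=> q0; rewrite {1}/Phi (formDl hQ) (formNl hQ) (form_suml hQ) big1 ?subr0//.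
    by move=> j _; rewrite (formZl hQ) q0 mulr0.
  have m0 (j : 'I_k) : mass (U j) Phi = 0 by rewrite (form_sym mP) PhiU.
  have e0 (j : 'I_k) : energy (U j) Phi = 0 by rewrite (hU j).2// m0 mulr0.
  rewrite (S0 _ eP e0) (energy_commutator (hU i) hPhi) -(S0 _ mP m0) -/(P i).
  rewrite -[B (Phi None) (Phi None)]/(mass Phi Phi).
  by set x1 := mass _ _; set x2 := B _ _; lra.
- by move=> i; apply: lam_le => //; exact: ltnW.
Qed.

End one_direction.

End universal_inequality.

(** * Summation over the coordinates *)

Section commutator_norm.
Variables (R : realType) (n : nat) (Omega : set 'rV[R]_n).
Hypothesis hOmega : bounded_domain Omega.
Local Notation mu := (lebesgue_rV R n).
Local Notation L2 := (L2fun mu).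
Local Notation W := (option 'I_n -> L2).
Local Notation H := (sobolev0 Omega).
Local Notation onO := (on_domain Omega).
Local Notation q := (@conf_factor R n).
Local Notation s := (@half_gap R n).
Implicit Types (F G : W) (p : 'I_n).

Let OB x : Omega x -> unit_ball x.
Proof. by case: hOmega => _ _ _ OB _; exact: OB. Qed.

Let wq j : weight (onO (fun x => q x ^+ n * s x ^+ j)) :=
  C1_ball_weight hOmega (@power_weight_C1 R n j).
Let sx p : smooth (fun x : 'rV[R]_n => x ord0 p) := @smooth_coord R n p.
Let ss : smooth (fun x => s x ^+ 2) := smoothM (@smooth_half_gap R n) (@smooth_half_gap R n).

Let T p F := wip (onO (fun x => q x ^+ n * s x ^+ 4)) (F (Some p)) (F (Some p)).
Let X p F := wip (onO (fun x => q x ^+ n * s x ^+ 3 * x ord0 p)) (F None) (F (Some p)).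
Let Y p F := wip (onO (fun x => q x ^+ n * s x ^+ 2 * (x ord0 p * x ord0 p))) (F None) (F None).
Let A F := wip (onO (@energy_weight R n)) (F None) (F None).
Let P F := wip (onO (fun x => energy_weight x * enorm x ^+ 2)) (F None) (F None).
Let Z F := wip (onO (fun x => q x ^+ n * s x ^+ 3)) (F None) (F None).

Let wX p : weight (onO (fun x => q x ^+ n * s x ^+ 3 * x ord0 p)).
Proof. exact: (weight_smoothM hOmega (wq 3) (sx p)). Qed.

Let wY p : weight (onO (fun x => q x ^+ n * s x ^+ 2 * (x ord0 p * x ord0 p))).
Proof. exact: (weight_smoothM hOmega (wq 2) (smoothM (sx p) (sx p))). Qed.

Let wP : weight (onO (fun x => energy_weight x * enorm x ^+ 2)).
Proof. exact: (weight_smoothM hOmega (weight_energy hOmega) (@smooth_enorm_sqr R n)). Qed.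

Let commutator_expand p F :
  wip (mu := mu) (onO (@volume_weight R n)) (commutator Omega p F) (commutator Omega p F) =
  4 * T p F + (4 * (n%:R - 2) * X p F + (n%:R - 2) ^+ 2 * Y p F).
Proof.
have iZ c w (u v : L2) : weight w ->
    mu.-integrable setT (EFin \o (fun x => c * w x * u x * v x)).
  by move=> hw; apply: wip_integrable; apply: weightM => //; exact: (weight_cst _ _).
rewrite /T /X /Y -!wipZ//; try exact: wq.
rewrite /wip -!RintegralD//; try apply: iZ; try exact: wq; try exact: wX; try exact: wY.
  apply: eq_Rintegral => x _; have [Ox|nOx] := pselect (Omega x).
    by rewrite !on_domain_in// (commutatorE hOmega)// /volume_weight; ring.
  by rewrite !on_domain_out//; ring.
by apply: integrable_addR; apply: iZ; [exact: wX|exact: wY].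
Qed.

(** The divergence of q^n s^3 x_p u^2 e_p integrates to zero. *)
Let X_by_parts p F : H F -> 2 * X p F + (n%:R - 3) * Y p F + Z F = 0.
Proof.
move=> hF; have := sobolev0_by_parts hOmega p (@cubic_weight_C1 R n p) hF hF.
rewrite (wip_sym _ (F (Some p)) (F None)) -/(X p F).
have -> : wip (onO (fun x => q x ^+ n * ((n%:R - 3) * s x ^+ 2 * x ord0 p * x ord0 p +
    s x ^+ 3 * (p == p)%:R))) (F None) (F None) = (n%:R - 3) * Y p F + Z F.
  rewrite -wip_on_lin//.
  by apply: wip_on_eq => x Ox; rewrite eqxx/=; ring.
by set x1 := X p F; set x2 := (_ * Y p F); set x3 := Z F; lra.
Qed.

Let sum_Y F : \sum_p Y p F = P F.
Proof.
rewrite -wip_on_sum//; apply: wip_on_eq => x Ox.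
by rewrite /energy_weight -mulr_sumr enorm_sqr; under eq_bigr do rewrite -expr2.
Qed.

Let Z_split F : Z F = 2^-1 * A F - 2^-1 * P F.
Proof.
rewrite /Z /A /P -mulNr -(wip_on_scale (- 2^-1))// -wip_on_lin//.
- apply: wip_on_eq => x Ox; congr (_ * _ * _).
  have -> : s x ^+ 3 = s x ^+ 2 * (2^-1 * (1 - enorm x ^+ 2)).
    by rewrite exprSr; congr (_ * _); rewrite /half_gap mulrC.
  by rewrite /energy_weight; ring.
- exact: (weight_energy hOmega).
- have := weightM (weight_cst _ (- 2^-1)) wP; congr weight.
  by apply/funext => x; rewrite /on_domain; ring.
Qed.

Let partial_ss p x : Omega x -> partial p (fun x => s x ^+ 2) x = - (2 * s x * x ord0 p).
Proof.
move=> Ox; have [_ _ d] := C1_ballX 2 (@half_gap_C1 R n) (OB Ox).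
rewrite /partial; have -> := derive_val (is_derive := d p) => /=.
by rewrite expr1; ring.
Qed.

(** The weak equation tested on s^2 u. *)
Let energy_identity la F : weak_eigenfunction Omega la F ->
  \sum_p T p F - 2 * \sum_p X p F = la * A F.
Proof.
move=> [hF eF]; have hG := sobolev0_mul hOmega ss hF.
have := eF _ hG.
have -> : mass Omega F (sob_mul Omega (fun x => s x ^+ 2) F) = A F.
  apply: wip_on_eq => x Ox; rewrite sob_mulN wmulE ?on_domain_in//.
    by rewrite /volume_weight /energy_weight; ring.
  exact: (smooth_weight hOmega ss).
move=> <-; rewrite mulr_sumr -sumrB; apply: eq_bigr => p _.
rewrite /T /X -wip_on_scale// -[in LHS]mulN1r.
have wX2 : weight (onO (fun x => 2 * (q x ^+ n * s x ^+ 3 * x ord0 p))).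
  have := weightM (weight_cst _ 2) (wX p); congr weight.
  by apply/funext => x; rewrite /on_domain; ring.
rewrite mulN1r /wip -RintegralB//; try exact: wip_integrable.
apply: eq_Rintegral => x _; have [Ox|nOx] := pselect (Omega x).
  rewrite !on_domain_in// sob_mulS L2D !wmulE.
  - by rewrite !on_domain_in// partial_ss// /energy_weight; ring.
  - exact: (smooth_weight hOmega (smooth_partial _ ss)).
  - exact: (smooth_weight hOmega ss).
by rewrite !on_domain_out//; ring.
Qed.

(** Expanding the squares leaves the integrals T of s^4 (d_p u)^2, X of
    s^3 x_p u d_p u and Y of s^2 x_p^2 u^2. The sum of Y over p is the integral of
    s^2 |x|^2 u^2; [X_by_parts] gives the sum of X and [energy_identity] that of T. *)
Lemma sum_commutator_sqr la F : weak_eigenfunction Omega la F ->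
  \sum_(p < n) wip (mu := mu) (onO (@volume_weight R n))
     (commutator Omega p F) (commutator Omega p F) =
  4 * la * wip (onO (@energy_weight R n)) (F None) (F None)
  - n%:R ^+ 2 * wip (onO (@energy_weight R n)) (F None) (F None)
  + (2 * n + 4)%:R * wip (onO (fun x => energy_weight x * enorm x ^+ 2)) (F None) (F None).
Proof.
move=> eF; have [hF _] := eF.
under eq_bigr do rewrite commutator_expand.
rewrite big_split big_split/= -!mulr_sumr sum_Y -/(A F) -/(P F).
have e1 := energy_identity eF.
have e2 : 2 * (\sum_p X p F) + (n%:R - 3) * P F + n%:R * Z F = 0.
  have -> : n%:R * Z F = \sum_(p < n) Z F by rewrite sumr_const card_ord mulr_natl.
  rewrite -sum_Y !mulr_sumr.
  by rewrite -!big_split/= big1// => p _; exact: X_by_parts.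
rewrite Z_split in e2; rewrite natrD natrM.
have -> : \sum_p T p F = la * A F + 2 * \sum_p X p F by rewrite -e1 subrK.
have -> : \sum_p X p F = - 2^-1 * ((n%:R - 3) * P F + n%:R * (2^-1 * A F - 2^-1 * P F)).
  by move: e2; set x1 := \sum_p X p F; set y := _ * P F; set z := n%:R * _; lra.
by field.
Qed.

End commutator_norm.

(* Indices start at 0: lam i and u i are the (i+1)-st eigenvalue and
   eigenfunction. *)
Theorem corollary1p5 (R : realType) (n : nat) (hn : (0 < n)%N)
    (Omega : set 'rV[R]_n) (hOmega : bounded_domain Omega)
    (lam : nat -> R) (u : nat -> 'rV[R]_n -> R)
    (hlam : lists_dirichlet_eigenvalues Omega lam)
    (hlam0 : 0 < lam 0%N) (hlam1 : lam 0%N < lam 1%N)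
    (hlamS : forall i, lam i <= lam i.+1)
    (hu : forall i, dirichlet_eigenspace Omega (lam i) (u i))
    (hortho : L2_orthonormal Omega u)
    (k : nat) (hk : (1 <= k)%N) :
  \sum_(i < k) (lam k - lam i) ^+ 2 *
    (n%:R * hyp_Rintegral Omega
       (fun x => (1 - enorm x ^+ 2) ^+ 2 * u i x ^+ 2))
  <=
  \sum_(i < k) (lam k - lam i) *
    (4 * lam i * hyp_Rintegral Omega
       (fun x => (1 - enorm x ^+ 2) ^+ 2 * u i x ^+ 2)
     - n%:R ^+ 2 * hyp_Rintegral Omega
       (fun x => (1 - enorm x ^+ 2) ^+ 2 * u i x ^+ 2)
     + (2 * n + 4)%:R * hyp_Rintegral Omega
       (fun x => (1 - enorm x ^+ 2) ^+ 2 * enorm x ^+ 2 * u i x ^+ 2)).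
Proof.
have /choice[U hU] : forall i, exists F,
    weak_eigenfunction Omega (lam i) F /\ represents Omega F (u i).
  by move=> i; have [F] := dirichlet_weak hOmega (hu i); exists F.
have eU i : weak_eigenfunction Omega (lam i) (U i) by case: (hU i).
have rU i x : Omega x -> U i None x = u i x by case: (hU i) => _; exact.
have orthoU i j : mass Omega (U i) (U j) = (i == j)%:R.
  rewrite -hortho; symmetry; apply: (hyp_Rintegral_wip hOmega (weight_volume hOmega)).
  by move=> x Ox; rewrite !rU//; ring.
pose A i := wip (on_domain Omega (@energy_weight R n)) (U i None) (U i None).
pose P i := wip (on_domain Omega (fun x => energy_weight x * enorm x ^+ 2))
  (U i None) (U i None).
have gapE (x : 'rV[R]_n) : 1 - enorm x ^+ 2 = 2 * half_gap x by rewrite /half_gap; field.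
have wA := weight_energy hOmega.
have wP := weight_smoothM hOmega wA (@smooth_enorm_sqr R n).
have w4 c : weight (on_domain Omega c) -> weight (on_domain Omega (fun x => 4 * c x)).
  move=> wc; have := weightM (weight_cst _ 4) wc; congr weight.
  by apply/funext => x; rewrite /on_domain; ring.
(* (1 - |x|^2)^2 = 4 s^2 and the volume density is q^n *)
have QE i : hyp_Rintegral Omega (fun x => (1 - enorm x ^+ 2) ^+ 2 * u i x ^+ 2) = 4 * A i.
  rewrite -wip_on_scale//; apply: (hyp_Rintegral_wip hOmega (w4 _ wA)) => x Ox.
  by rewrite gapE rU// /energy_weight /volume_weight; ring.
have PE i : hyp_Rintegral Omega
    (fun x => (1 - enorm x ^+ 2) ^+ 2 * enorm x ^+ 2 * u i x ^+ 2) = 4 * P i.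
  rewrite -wip_on_scale//; apply: (hyp_Rintegral_wip hOmega (w4 _ wP)) => x Ox.
  by rewrite gapE rU// /energy_weight /volume_weight; ring.
have /(@ler_sum _ _ (index_enum 'I_n) predT) main := fun p (_ : true) =>
  directional_inequality hOmega p k hlam hlamS eU orthoU.
rewrite sumr_const card_ord -mulr_natl exchange_big/= in main.
under [in leRHS]eq_bigr do rewrite PE QE.
under [in leLHS]eq_bigr do rewrite QE.
move: main; under [in leRHS]eq_bigr do
  rewrite -mulr_sumr (sum_commutator_sqr hOmega (eU _)) -/(A _) -/(P _).
rewrite -(ler_pM2l (_ : 0 < 4 :> R))// !mulr_sumr.
set l1 := \sum_(i < k) _; set r1 := \sum_(i < k) _.
set l2 := \sum_(i < k) _; set r2 := \sum_(i < k) _.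
have -> : l1 = l2 by apply: eq_bigr => i _; rewrite /A /P; ring.
by have -> : r1 = r2 by apply: eq_bigr => i _; rewrite /A /P; ring.
Qed.
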